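(* Fix $y \in \mathbb{Z}_p$. As a function of $x \in \Omega^*$, the zeros of $\zeta(x,-y)$ are simple and lie in $K_\infty = \mathbb{F}_q((T^{-1}))$. In fact they lie in the subfield $\mathbb{F}_p((T^{-1}))$.
   Context: Let $p$ be a prime, $s \ge 1$, $q = p^s$, $A = \mathbb{F}_q[T]$, $A^+$ the set of monic polynomials in $A$, $K_\infty = \mathbb{F}_q((T^{-1}))$ (the completion of $\mathbb{F}_q(T)$ at the $T^{-1}$-adic valuation), $\Omega$ the completion of an algebraic closure of $K_\infty$, and $\mathbb{Z}_p$ the $p$-adic integers. For monic $n$ put $\langle n \rangle := n T^{-\deg n}$; since $\langle n \rangle \equiv 1 \pmod{T^{-1}}$, $\langle n\rangle^y$ is well defined for $y \in \mathbb{Z}_p$. For $n\in A^+$ and $(x,y) \in \Omega^* \times \mathbb{Z}_p$ set $n^{(x,y)} := x^{\deg n}\langle n\rangle^y$. The Goss zeta function of $\mathbb{F}_q[T]$ is $\zeta(x,y) := \sum_{m \ge 0} x^{-m} \Big( \sum_{n \in A^+,\ \deg n = m} \langle n \rangle^{-y} \Big)$, which is well defined on all of $\Omega^* \times \mathbb{Z}_p$ (an entire power series in $x^{-1}$). Thus $\zeta(x,-y) = \sum_{m\ge 0} x^{-m}\sum_{n\in A^+,\deg n=m}\langle n\rangle^{y}$. *)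

(* Defs.v *)
From HB Require Import structures.
From mathcomp Require Import all_boot all_order all_algebra qpoly.
From mathcomp Require Import boolp classical_sets reals topology normedtype.
From mathcomp Require Import sequences.

Set Implicit Arguments.
Unset Strict Implicit.
Unset Printing Implicit Defensive.

Import Order.TTheory GRing.Theory Num.Theory.
Import numFieldNormedType.Exports.
Local Open Scope classical_set_scope.
Local Open Scope ring_scope.

(* Z_p as the inverse limit of the Z/p^k: [zp_res y k] is the representative in
   [0, p^k[ of the class of y modulo p^k. *)
Record padic_int (p : nat) : Type := PadicInt {
  zp_res :> nat -> nat;
  zp_compat : forall k, (zp_res k.+1 %% p ^ k = zp_res k)%N }.

Lemma zp_opp_compat (p : nat) (y : padic_int p) (k : nat) :
  (((p ^ k.+1 - y k.+1) %% p ^ k.+1) %% p ^ k = (p ^ k - y k) %% p ^ k)%N.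
Proof.
have dvd_pk : (p ^ k %| p ^ k.+1)%N by rewrite dvdn_exp2l.
rewrite modn_dvdm //; have [p0|p_gt0] := posnP p.
  case: k {dvd_pk} => [|k]; first by rewrite expn0 !modn1.
  have pX0 j : (p ^ j.+1 = 0)%N by rewrite p0 exp0n.
  by rewrite !pX0 !sub0n.
have le_y j : (y j <= p ^ j)%N.
  by rewrite -(zp_compat y j) ltnW // ltn_pmod // expn_gt0 p_gt0.
apply/eqP; rewrite -(eqn_modDr (y k.+1)) subnK //.
rewrite -[X in _ == X]modnDmr zp_compat subnK // modnn.
by move: dvd_pk; rewrite /dvdn.
Qed.

Definition zp_opp (p : nat) (y : padic_int p) : padic_int p :=
  PadicInt (fun k => zp_opp_compat y k).

Section ValuedField.
Variables (R : realType) (L : fieldType) (N : L -> R).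

Definition nonarch_abs : Prop :=
  [/\ forall x, 0 <= N x,
      forall x, N x = 0 <-> x = 0,
      forall x y, N (x * y) = N x * N y
    & forall x y, N (x + y) <= Num.max (N x) (N y)].

Definition cvg_abs (u : nat -> L) (l : L) : Prop :=
  N (u n - l) @[n --> \oo] --> (0 : R).

Definition cauchy_abs (u : nat -> L) : Prop :=
  forall e : R, 0 < e -> \forall m & n \near \oo, N (u m - u n) < e.

Definition complete_abs : Prop :=
  forall u, cauchy_abs u -> exists l, cvg_abs u l.

Definition dense_abs (D : set L) : Prop :=
  forall (x : L) (e : R), 0 < e -> exists2 z, D z & N (x - z) < e.

(* Equal to 0 when u does not converge. *)
Definition lim_abs (u : nat -> L) : L := xget 0 [set l | cvg_abs u l].

(* f is analytic at a and the first nonzero coefficient of its Taylor expansion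
   at a is the one of degree k. *)
Definition order_at (f : L -> L) (a : L) (k : nat) : Prop :=
  exists (r : R) (c : nat -> L),
    [/\ 0 < r, forall j, (j < k)%N -> c j = 0, c k != 0
      & forall x, N (x - a) < r ->
          cvg_abs (fun n => \sum_(j < n) c j * (x - a) ^+ j) (f x)].

Definition simple_zero (f : L -> L) (a : L) : Prop := order_at f a 1.

End ValuedField.

Definition prime_subfield (F : fieldType) : set F :=
  [set a | exists k : nat, a = k%:R].

Arguments prime_subfield F : clear implicits.

Definition algebraic_over (L : fieldType) (K : set L) : set L :=
  [set x | exists P : {poly L}, [/\ P != 0, forall i, K P`_i & root P x]].

Section Goss.
Variables (R : realType) (F : finFieldType) (Om : fieldType) (N : Om -> R).
Variable phi : {rmorphism {poly F} -> Om}.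

(* k((T^-1)) inside Om, for a set k of coefficients: the elements
   c_0 T^m + c_1 T^(m-1) + c_2 T^(m-2) + ... with all c_i in k. *)
Definition laurent (k : set F) : set Om :=
  [set x | exists (m : nat) (c : nat -> F), (forall i, k (c i)) /\
    cvg_abs N
      (fun n => \sum_(i < n) phi (c i)%:P * (phi 'X ^+ m / phi 'X ^+ i)) x].

Definition K_infty : set Om := laurent setT.

Definition K_infty_bar : set Om := algebraic_over K_infty.

(* Om, with absolute value N and structure map phi : F[T] -> Om, is a completion
   of an algebraic closure of K_infty, normalized by |T| = #|F|. An algebraic
   closure of K_infty contained in Om is the set of all elements of Om that are
   algebraic over K_infty. *)
Definition completed_alg_closure : Prop :=
  [/\ nonarch_abs N,
      forall n : {poly F}, n != 0 -> N (phi n) = #|F|%:R ^+ (size n).-1,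
      complete_abs N,
      forall P : {poly Om}, (1 < size P)%N -> (forall i, K_infty_bar P`_i) ->
        exists2 x, K_infty_bar x & root P x
    & dense_abs N K_infty_bar].

(* <n> = n T^(- deg n). *)
Definition one_unit_part (n : {poly F}) : Om := phi n / phi 'X ^+ (size n).-1.

(* u^y for a 1-unit u: the integers [y k] tend to y in Z_p. *)
Definition zp_pow (p : nat) (u : Om) (y : padic_int p) : Om :=
  lim_abs N (fun k => u ^+ y k).

Definition goss_zeta (p : nat) (x : Om) (y : padic_int p) : Om :=
  lim_abs N (fun M => \sum_(m < M) x ^- m *
    \sum_(n : {poly_m.+1 F} | (size n == m.+1) && (val n \is monic))
      zp_pow (one_unit_part n) (zp_opp y)).

End Goss.

(* Main.v *)
(* Put u = 1/T and expand <n> ^ y along the base-p digits of y.  Summing over the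
   coefficients of n writes the coefficient S_m(y) of x ^ (-m) as a signed sum of
   powers u ^ cost over combinatorial configurations.  A configuration is a strictly
   increasing tower of rows B_1 < ... < B_m indexed by Z/s, where the row B requires
   p B_(c+1) - B_c items of each colour c in Z/s; the digit y_j supplies y_j items of
   price p ^ j and colour j mod s, and the cost is the total price.

   Replacing two rows by their minimum and maximum does not raise the total price
   (uncrossing), and comparing base-p expansions shows that the cheapest tower is
   unique and that optimal towers of consecutive heights interlace.  Hence S_m(y) is
   zero or has valuation exactly the optimal price f(m), and uniqueness makes the
   convexity 2 f(m+1) < f(m) + f(m+2) strict.

   At a zero of the series exactly two consecutive terms then have maximal absolute
   value.  The derivative, dominated by the same pair, does not vanish; and solving
   for the ratio of the pair exhibits the zero as a fixed point of a contraction
   defined over the closure of F_p(T), which is F_p((1/T)). *)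
Require Import Defs.
From HB Require Import structures.
From mathcomp Require Import all_boot all_order all_algebra qpoly finfield.
From mathcomp Require Import zify lra ring.
From mathcomp Require Import boolp classical_sets reals topology normedtype.
From mathcomp Require Import sequences.

Set Implicit Arguments.
Unset Strict Implicit.
Unset Printing Implicit Defensive.

(** * Cheapest towers *)

(** Uncrossing alone shows only that the cheapest towers form a lattice; the difficulty is that
    there is just one. An exponent belongs to a single colour and at most p - 1 items carry it, so
    the price of one row, read in base p, determines the row. A sum over several rows carries no
    such information: a saving in one row could offset a loss in another. This is excluded by
    following, row by row, the largest exponent at which two optimal towers differ: it grows by at
    least the number of colours at each row, which leaves no room for compensation. Uniqueness then
    prevents cancellation in the power sums, since the coefficients are products of binomials of
    numbers below p, hence units. Only finitely many digits of y are used at a time. The first L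
    digits are completed by digits p - 1, so that rows never run out of items; the resulting costs
    depend on L and are trusted only below p ^ L. This also covers those y for which the
    coefficients vanish from some degree on. *)

Lemma ex_argmin (A : Type) (P : A -> Prop) (mu : A -> nat) :
  (exists x, P x) -> exists2 x, P x & forall y, P y -> mu x <= mu y.
Proof.
move=> [x0 Px0].
have ex : exists n, `[< exists2 x, P x & mu x = n >].
  by exists (mu x0); apply/asboolP; exists x0.
case: (ex_minnP ex) => n /asboolP[x Px <-] min; exists x => // y Py.
by apply: min; apply/asboolP; exists y.
Qed.

Lemma ex_argmax (A : Type) (P : A -> Prop) (mu : A -> nat) (K : nat) :
  (exists x, P x) -> (forall x, P x -> mu x <= K) ->
  exists2 x, P x & forall y, P y -> mu y <= mu x.
Proof.
move=> exP bnd; have [x Px min] := ex_argmin (fun x => K - mu x) exP.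
by exists x => // y Py; move: (min y Py) (bnd y Py) (bnd x Px); lia.
Qed.

Lemma count_window (n a k : nat) (P : pred nat) :
  (forall i, P i -> a <= i < a + k) -> \sum_(i < n | P i) 1 <= k.
Proof.
move=> Pw; rewrite sum1_card cardE size_filter -[X in _ <= X](size_iota a k).
rewrite -size_filter -(size_map val); apply: uniq_leq_size.
  by rewrite (map_inj_uniq val_inj) filter_uniq // -enumT enum_uniq.
move=> j /mapP[i]; rewrite mem_filter => /andP[Pi _] ->.
by rewrite mem_iota Pw.
Qed.

Section Staircase.
Variables (T : finType) (p : nat) (ex : T -> nat -> nat).
Hypothesis p_gt1 : 1 < p.
Hypothesis ex_mono : forall c i j, i <= j -> ex c i <= ex c j.
Hypothesis ex_col : forall c c' i j, ex c i = ex c' j -> c = c'.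
Hypothesis ex_step : forall c i, ex c i + #|T| <= ex c (i + p.-1).

(* Each colour c : T offers items 0, 1, 2, ... priced at p ^ ex c 0, p ^ ex c 1,
   ...; buying n of them costs least when the first n are taken. *)
Definition cheapest c n := \sum_(i < n) p ^ ex c i.

Lemma cheapestD c n k :
  cheapest c (n + k) = cheapest c n + \sum_(i < k) p ^ ex c (n + i).
Proof. by rewrite /cheapest big_split_ord. Qed.

Lemma leq_cheapest c n n' : n <= n' -> cheapest c n <= cheapest c n'.
Proof. by move=> /subnKC <-; rewrite cheapestD leq_addr. Qed.

Lemma cheapest_convex c l x y u : l <= x -> l <= y -> x + y = l + u ->
  cheapest c x + cheapest c y <= cheapest c l + cheapest c u.
Proof.
move=> /subnKC <- ly; set k := x - l => e.
have -> : u = y + k by lia.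
rewrite !cheapestD.
have : \sum_(i < k) p ^ ex c (l + i) <= \sum_(i < k) p ^ ex c (y + i).
  by apply: leq_sum => i _; rewrite leq_exp2l //; apply: ex_mono; lia.
lia.
Qed.

(** Each exponent occurs in one colour ([ex_col]) and for at most p - 1 items ([ex_step]), so the
    light items form a base-p expansion with admissible digits. *)
Lemma light_items_lt (n : T -> nat) t :
  \sum_c \sum_(i < n c | ex c i < t) p ^ ex c i < p ^ t.
Proof.
elim: t => [|t IHt]; first by rewrite big1 ?expn0 // => c _; rewrite big_pred0.
have split_sum c : \sum_(i < n c | ex c i < t.+1) p ^ ex c i =
    \sum_(i < n c | ex c i < t) p ^ ex c i + \sum_(i < n c | ex c i == t) p ^ t.
  rewrite (bigID (fun i : 'I__ => ex c i < t)) /=; congr (_ + _).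
    by apply: eq_bigl => i; lia.
  apply: eq_big => [i|i /andP[lt1 lt2]]; first lia.
  by congr (p ^ _); lia.
rewrite (eq_bigr _ (fun c _ => split_sum c)) big_split /=.
suff : \sum_c \sum_(i < n c | ex c i == t) p ^ t <= p ^ t * p.-1.
  rewrite expnS; move: IHt; set a := \sum_c _; set b := \sum_c _.
  have -> : p * p ^ t = p ^ t + p ^ t * p.-1 by rewrite -mulnS mulnC prednK // ltnW.
  lia.
case: (pselect (exists c i, ex c i = t)) => [[c0 ex0]|none]; last first.
  rewrite big1 // => c _; rewrite big_pred0 // => i.
  by apply/eqP => e; apply: none; exists c, i.
have ex0' : exists i, ex c0 i == t by case: ex0 => i e; exists i; apply/eqP.
case: (ex_minnP ex0') => i0 /eqP ei0 min0.
rewrite (bigD1 c0) //= [X in _ + X]big1 ?addn0 => [|c /eqP nc].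
  rewrite (eq_bigr (fun=> p ^ t * 1)) => [|i _]; last exact/esym/muln1.
  rewrite -big_distrr leq_pmul2l ?expn_gt0; last lia.
  apply: (@count_window _ i0 _ (fun i => ex c0 i == t)) => i /eqP ei.
  have T_gt0 : 0 < #|T| by apply/card_gt0P; exists c0.
  rewrite min0 ?ei //= ltnNge; apply/negP => le; move: (ex_mono c0 le).
  move: (ex_step c0 i0). lia.
rewrite big_pred0 // => i; apply/eqP => e; apply: nc.
by apply: (@ex_col c c0 i i0); rewrite e.
Qed.

Lemma cheapest_heavy c n t : cheapest c n =
  \sum_(i < n | t <= ex c i) p ^ ex c i + \sum_(i < n | ex c i < t) p ^ ex c i.
Proof.
rewrite /cheapest (bigID (fun i : 'I_n => t <= ex c i)) /=; congr (_ + _).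
by apply: eq_bigl => i; rewrite ltnNge.
Qed.

Lemma leq_heavy c t n n' : (forall i, n <= i < n' -> ex c i < t) ->
  \sum_(i < n' | t <= ex c i) p ^ ex c i <= \sum_(i < n | t <= ex c i) p ^ ex c i.
Proof.
move=> light; case: (leqP n' n) => [/subnKC <-|/ltnW lenn'].
  rewrite big_mkcond [leqRHS]big_mkcond big_split_ord /= leq_addr //.
rewrite -(subnKC lenn') big_mkcond [leqRHS]big_mkcond big_split_ord /=.
rewrite [X in _ + X]big1 ?addn0 // => i _.
by rewrite ifF //; have := light (n + i); move: (ltn_ord i); lia.
Qed.

(** [N] has an item of price at least p ^ t that [N'] lacks, the excess of [N'] is lighter, and all
    light items of [N'] together stay below p ^ t. *)
Lemma ltn_of_heavier (N N' : T -> nat) t :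
    (forall c i, N c <= i < N' c -> ex c i < t) ->
    (exists c i, N' c <= i < N c /\ t <= ex c i) ->
  \sum_c cheapest c (N' c) < \sum_c cheapest c (N c).
Proof.
move=> light [c0 [i0 [/andP[le0 lt0] ti0]]].
rewrite (eq_bigr _ (fun c _ => cheapest_heavy c (N' c) t)).
rewrite [ltnRHS](eq_bigr _ (fun c _ => cheapest_heavy c (N c) t)).
rewrite !big_split /=.
set H' := \sum_c _; set L' := (X in _ + X < _); set H := (X in _ < X + _).
have L'lt : L' < p ^ t := light_items_lt N' t.
suff : H' + p ^ t <= H by lia.
rewrite /H' /H (bigD1 c0) //= [leqRHS](bigD1 c0) //= addnAC leq_add //; last first.
  by apply: leq_sum => c _; apply: leq_heavy => i; apply: light.
have -> : N c0 = N' c0 + (N c0 - N' c0) by lia.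
rewrite [leqRHS]big_mkcond big_split_ord /= -big_mkcond leq_add2l.
have lt1 : i0 - N' c0 < N c0 - N' c0 by lia.
rewrite (bigD1 (Ordinal lt1)) //= subnKC // ti0.
by rewrite (leq_trans _ (leq_addr _ _)) // leq_exp2l.
Qed.

Definition differ (N N' : T -> nat) c i := minn (N c) (N' c) <= i < maxn (N c) (N' c).

Lemma top_difference (N N' : T -> nat) : (exists c, N c <> N' c) ->
  exists2 c, N c <> N' c &
    forall c' i, differ N N' c' i -> ex c' i <= ex c (maxn (N c) (N' c)).-1.
Proof.
case=> c0 /eqP nc0.
case: (@arg_maxnP _ c0 (fun c => N c != N' c) (fun c => ex c (maxn (N c) (N' c)).-1) nc0).
move=> c /eqP nc cmax; exists c => // c' i d.
apply: leq_trans (ex_mono c' _) (cmax c' _); first by move: d; rewrite /differ; lia.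
by apply/eqP => e; move: d; rewrite /differ e minnn maxnn; lia.
Qed.

Lemma top_difference_lt (N N' : T -> nat) c : N c < N' c ->
    (forall c' i, differ N N' c' i -> ex c' i <= ex c (maxn (N c) (N' c)).-1) ->
  \sum_c cheapest c (N c) < \sum_c cheapest c (N' c).
Proof.
move=> lt top; apply: (@ltn_of_heavier _ _ (ex c (N' c).-1)).
  move=> c' i d; have le : ex c' i <= ex c (N' c).-1.
    apply: leq_trans (top c' i _) _; first by rewrite /differ; lia.
    by apply: ex_mono; lia.
  rewrite ltn_neqAle le andbT; apply/eqP => e.
  by move: d; rewrite (ex_col e); lia.
by exists c, (N' c).-1; split; lia.
Qed.

(** Uniqueness of base-p digits: the item of largest exponent on which two purchases disagree
    decides which one is dearer. *)
Lemma cheapest_sum_inj (N N' : T -> nat) :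
  \sum_c cheapest c (N c) = \sum_c cheapest c (N' c) -> forall c, N c = N' c.
Proof.
move=> e c0; apply: contrapT => nc0.
have [c nc top] := top_difference (ex_intro _ c0 nc0).
case: (ltngtP (N c) (N' c)) => // lt.
  by move: (top_difference_lt lt top); rewrite e ltnn.
suff: \sum_c cheapest c (N' c) < \sum_c cheapest c (N c) by rewrite e ltnn.
apply: (top_difference_lt lt) => c' i.
by rewrite /differ minnC maxnC [maxn _ (N c)]maxnC => /top.
Qed.

(** The worst case uses the exponents just below t; adding the lowest of these powers once more and
    applying 2 p ^ j <= p ^ (j + 1) repeatedly climbs to p ^ t. *)
Lemma sum_distinct_powers (s : seq nat) t : uniq s -> all (gtn t) s ->
  \sum_(j <- s) p ^ j + p ^ (t - size s) <= p ^ t.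
Proof.
elim: t s => [|t IHt] s us lt_s.
  by case: s lt_s us => //= _ _; rewrite big_nil.
have [ts|nts] := boolP (t \in s).
  have us' := rem_uniq t us; have lt_s' : all (gtn t) (rem t s).
    apply/allP => j; rewrite mem_rem_uniq // !inE => /andP[nj js].
    by move/allP: lt_s => /(_ j js) /=; move: nj; lia.
  rewrite (perm_big _ (perm_to_rem ts)) big_cons (perm_size (perm_to_rem ts)) /=.
  move: (IHt _ us' lt_s'); rewrite subSS expnS.
  have : p ^ t + p ^ t <= p * p ^ t by rewrite addnn -mul2n leq_mul2r p_gt1 orbT.
  lia.
have lt_s' : all (gtn t) s.
  apply/allP => j js; move/allP: lt_s => /(_ j js) /=; rewrite ltnS leq_eqVlt.
  by case/predU1P => // ej; rewrite -ej js in nts.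
have size_s : size s <= t.
  rewrite -[leqRHS](size_iota 0); apply: uniq_leq_size => // j /(allP lt_s').
  by rewrite mem_iota.
move: (IHt s us lt_s'); rewrite subSn // !expnS.
move: (\sum_(_ <- _) _) (p ^ (t - _)) (p ^ t) => A B C; nia.
Qed.

Lemma cheapest_drop (N N' : T -> nat) : (forall c, N c <= (N' c).+1) ->
  \sum_c cheapest c (N c) <=
  \sum_c cheapest c (N' c) + \sum_(c | N' c < N c) p ^ ex c (N' c).
Proof.
move=> drop; rewrite [X in _ + X]big_mkcond -big_split /=; apply: leq_sum => c _.
case: ltnP => [lt|le]; last by rewrite addn0 leq_cheapest.
have -> : N c = N' c + 1 by move: (drop c); lia.
by rewrite cheapestD big_ord1 addn0.
Qed.

Lemma sum_dropped (N N' : T -> nat) t : (forall c, N c <= (N' c).+1) ->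
    (forall c, N' c < N c -> ex c (N' c) < t) ->
  \sum_(c | N' c < N c) p ^ ex c (N' c) + p ^ (t - #|[pred c | N' c < N c]|) <= p ^ t.
Proof.
move=> drop lt_t; set D := [pred c | _]; pose s := [seq ex c (N' c) | c in D].
have := @sum_distinct_powers s t; rewrite /s size_image big_image /=.
apply; first by rewrite map_inj_uniq ?enum_uniq // => c c' /ex_col.
by apply/allP => j /fintype.imageP[c /lt_t ? ->].
Qed.

(** At most #|T| items are lost, at distinct exponents up to t, so the saving misses p ^ (t + 1) by
    a definite margin. In the induction over rows this margin absorbs what the lower rows have
    saved. *)
Lemma cheapest_loss_le (N N' : T -> nat) t : (forall c, N c <= (N' c).+1) ->
    (forall c i, differ N N' c i -> ex c i <= t) ->
  \sum_c cheapest c (N c) + p ^ (t.+1 - #|T|) <= \sum_c cheapest c (N' c) + p ^ t.+1.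
Proof.
move=> drop top; have dropped := @sum_dropped N N' t.+1 drop.
have le := cheapest_drop drop.
have lt_t c : N' c < N c -> ex c (N' c) < t.+1.
  by move=> lt; rewrite ltnS top // /differ; lia.
have := dropped lt_t.
have : p ^ (t.+1 - #|T|) <= p ^ (t.+1 - #|[pred c | N' c < N c]|).
  by rewrite leq_exp2l // leq_sub2l // max_card.
lia.
Qed.

(** Colour e gains the top item, so at most #|T| - 1 colours lose an item, at distinct exponents
    below t; a net increase remains. *)
Lemma cheapest_gain_ge (N N' : T -> nat) e : (forall c, N c <= (N' c).+1) ->
    N e < N' e -> let t := ex e (N' e).-1 in
    (forall c i, differ N N' c i -> ex c i <= t) ->
  \sum_c cheapest c (N c) + p ^ (t - #|T|.-1) <= \sum_c cheapest c (N' c).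
Proof.
move=> drop lte t top.
have lt_t c : N' c < N c -> ex c (N' c) < t.
  move=> lt; rewrite ltn_neqAle top ?andbT; last by rewrite /differ; lia.
  by apply/eqP => /ex_col ce; move: lt; rewrite ce; lia.
have dropped := sum_dropped drop lt_t.
have : p ^ (t - #|T|.-1) <= p ^ (t - #|[pred c | N' c < N c]|).
  rewrite leq_exp2l // leq_sub2l //.
  have : #|[pred c | N' c < N c]| < #|T|.
    rewrite -(cardC [pred c | N' c < N c]) -[ltnLHS]addn0 ltn_add2l.
    by apply/card_gt0P; exists e; rewrite !inE -leqNgt ltnW.
  lia.
suff : \sum_c cheapest c (N c) + p ^ t <=
   \sum_c cheapest c (N' c) + \sum_(c | N' c < N c) p ^ ex c (N' c) by lia.
have e1 : \sum_c cheapest c (N c) + p ^ t <=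
   \sum_(c | c != e) cheapest c (N c) + cheapest e (N' e).
  rewrite (bigD1 e) //= addnAC addnC leq_add2l.
  have -> : N' e = (N' e).-1 + 1 by lia.
  by rewrite cheapestD big_ord1 addn0 leq_add // leq_cheapest; lia.
apply: leq_trans e1 _.
have -> : \sum_c cheapest c (N' c) =
  cheapest e (N' e) + \sum_(c | c != e) cheapest c (N' c) by rewrite (bigD1 e).
have -> : \sum_(c | N' c < N c) p ^ ex c (N' c) =
    \sum_(c | c != e) if N' c < N c then p ^ ex c (N' c) else 0.
  by rewrite big_mkcond (bigD1 e) //= ltnNge (ltnW lte).
rewrite addnC -addnA leq_add2l -big_split /=; apply: leq_sum => c _.
case: ltnP => [lt|le]; last by rewrite addn0 leq_cheapest.
have -> : N c = N' c + 1 by move: (drop c); lia.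
by rewrite cheapestD big_ord1 addn0.
Qed.

(** * Rows, their needs, and exchanges between two rows *)

Variable sg : T -> T.
Hypothesis sg_inj : injective sg.

Implicit Types a b z Y B : T -> nat.

Definition need B c := p * B (sg c) - B c.
Definition valid B := forall c, B c <= p * B (sg c).
Definition price B := \sum_c cheapest c (need B c).

(** Where the distance d of the two rows is largest, say at [sg c1], equal needs give p * d (sg c1)
    = d c1 <= d (sg c1), so d is 0. *)
Lemma need_inj a b : valid a -> valid b -> need a =1 need b -> a =1 b.
Proof.
move=> va vb eN c0; pose d c := (a c - b c) + (b c - a c).
have [c _ dmax] := @arg_maxnP _ c0 predT d isT.
have [c1 ec] : exists c1, c = sg c1 by exists (invF sg_inj c); rewrite f_invF.
have := dmax c0 isT; have := dmax c1 isT; have := eN c1; rewrite /need /d ec.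
move: (va c1) (vb c1); set A := a (sg c1); set C := b (sg c1).
have pA X : p * X = X + p.-1 * X by rewrite -mulSn prednK // ltnW.
case: (leqP A C) => [/subnKC <-|/ltnW/subnKC <-]; rewrite mulnDr.
  by rewrite [p * (C - A)]pA; move: (C - A) p_gt1 => k; nia.
by rewrite [p * (A - C)]pA; move: (A - C) p_gt1 => k; nia.
Qed.

Lemma price_inj a b : valid a -> valid b -> price a = price b -> a =1 b.
Proof. by move=> va vb /cheapest_sum_inj /need_inj; apply. Qed.

Lemma eq_price a b : a =1 b -> price a = price b.
Proof. by move=> e; apply: eq_bigr => c _; rewrite /need !e. Qed.

Definition meetv a b c := minn (a c) (b c).
Definition joinv a b c := maxn (a c) (b c).

Lemma valid_meet a b : valid a -> valid b -> valid (meetv a b).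
Proof. by move=> va vb c; move: (va c) (vb c); rewrite /meetv minnMr; lia. Qed.

Lemma valid_join a b : valid a -> valid b -> valid (joinv a b).
Proof. by move=> va vb c; move: (va c) (vb c); rewrite /joinv maxnMr; lia. Qed.

(** If a and b are ordered the same way at c and at [sg c], the two needs are merely permuted.
    Otherwise the needs of meet and join lie between those of a and b with the same sum, and
    [cheapest] is convex. *)
Lemma price_meet_join a b : valid a -> valid b ->
  price (meetv a b) + price (joinv a b) <= price a + price b.
Proof.
move=> va vb; rewrite -!big_split /=; apply: leq_sum => c _.
rewrite /need /meetv /joinv minnMr maxnMr; move: (va c) (vb c).
move: (p * a _) (p * b _) (a c) (b c) => A B x y le1 le2.
case: (leqP A B) => leAB; case: (leqP x y) => lexy //; last by rewrite addnC.
  by apply: cheapest_convex; lia.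
by rewrite [leqRHS]addnC; apply: cheapest_convex; lia.
Qed.

(* The smallest solution of the constraints that [g %/ k] satisfies: every
   coordinate other than c0 and sg c0 is then as small as its successor allows. *)
Lemma split_gap (g : T -> nat) c0 : g (sg c0) < g c0 ->
  exists x : T -> nat, [/\ x c0 = 1, x (sg c0) = 0, forall c, g c0 * x c <= g c
    & forall c, c != c0 -> x c <= p * x (sg c) <= x c + (p * g (sg c) - g c)].
Proof.
set k := g c0 => gk; have k_gt0 : 0 < k by lia.
pose S (x : T -> nat) := [/\ 1 <= x c0, forall c, k * x c <= g c &
  forall c, c != c0 -> p * x (sg c) <= x c + (p * g (sg c) - g c)].
have [x [[x1 xk] xS] xmin] : exists2 x, S x & forall y, S y ->
    \sum_c x c <= \sum_c y c.
  apply: ex_argmin; exists (fun c => g c %/ k); split=> [|c|c _].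
  - by rewrite divnn k_gt0.
  - by rewrite mulnC leq_divM.
  - have := leq_divM (g (sg c)) k; have := ltn_ceil (g c) k_gt0.
    move: (g (sg c)) (g c) (g (sg c) %/ k) (g c %/ k) => g' g0 A B h1 h2.
    rewrite leqNgt; apply/negP => h3.
    case: (leqP g0 (p * g')) => h4.
      have : k * (B + (p * g' - g0)).+1 <= k * (p * A) by rewrite leq_mul2l h3 orbT.
      have : p * (A * k) <= p * g' by rewrite leq_mul2l h2 orbT.
      by move: (p * g' - g0) (subnKC h4) => d <-; nia.
    have : p * (A * k) <= p * g' by rewrite leq_mul2l h2 orbT.
    have : k * B.+1 <= k * (p * A) by rewrite leq_mul2l (leq_trans _ h3) ?orbT //; lia.
    by nia.
exists x; split=> //.
- by have := xk c0; rewrite -/k -[leqRHS]muln1 leq_pmul2l //; lia.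
- by have := xk (sg c0); case: (x _) => // n; rewrite mulnS; lia.
(* If x c exceeded p * x (sg c), it could be lowered by one inside [S], against minimality. *)
move=> c nc; rewrite xS // andbT leqNgt; apply/negP => lt_x.
have ncs : sg c != c by apply/eqP => e; move: lt_x; rewrite e; nia.
pose y c' := if c' == c then (x c).-1 else x c'.
have /xmin : S y.
  split=> [|c'|c' nc']; rewrite /y.
  - by rewrite eq_sym (negPf nc).
  - case: eqP => [->|_] //; apply: leq_trans (xk c).
    by rewrite leq_mul2l leq_pred orbT.
  - case: (eqVneq c' c) => [->|_]; first by rewrite (negPf ncs); lia.
    case: eqP => [e|_]; last exact: xS.
    have := xS c' nc'; rewrite e; have : p * (x c).-1 <= p * x c.
      by rewrite leq_mul2l leq_pred orbT.
    by lia.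
rewrite (bigD1 c) //= [leqRHS](bigD1 c) //= {1}/y eqxx.
rewrite [X in _ <= _ + X](eq_bigr x) => [|c' /negPf]; last by rewrite /y => ->.
by lia.
Qed.

(** A competitor [Y] is pushed from a towards b while staying strictly below z. Where it stops short
    of its cap, its need is the smaller of the two needs; where it reaches the cap, its need is at
    most that of b, or one more at a contact b f = z f with free successor. Were every such contact
    light, [Y] would drop the top item of a and gain only lighter ones, against optimality. *)
Lemma contact_of_descent a b z e : valid a -> valid b ->
    (forall c, a c <= b c) -> (forall c, a c < z c) -> (forall c, b c <= z c) ->
    (forall Y, valid Y -> (forall c, a c <= Y c) -> (forall c, Y c < z c) ->
       price a <= price Y) ->
    need b e < need a e ->
    (forall c i, differ (need a) (need b) c i -> ex c i <= ex e (need a e).-1) ->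
  exists f, [/\ b f = z f, b (sg f) < z (sg f) & ex e (need a e).-1 <= ex f (need b f)].
Proof.
set t := ex e _ => va vb leab ltaz lebz opt lte top; apply: contrapT => none.
pose cap c := minn (b c) (z c).-1.
pose S (Y : T -> nat) := [/\ forall c, a c <= Y c, forall c, Y c <= cap c &
  forall c, Y c + minn (need a c) (need b c) <= p * Y (sg c)].
have Sa : S a.
  split=> // c; first by move: (leab c) (ltaz c); rewrite /cap; lia.
  by move: (va c); rewrite /need; lia.
have [Y [aY Ycap Ylow] Ymax] : exists2 Y, S Y & forall Y', S Y' ->
    \sum_c Y' c <= \sum_c Y c.
  apply: (ex_argmax (K := \sum_c cap c)); first by exists a.
  by move=> Y [_ Ycap _]; apply: leq_sum.
have vY : valid Y by move=> c; move: (Ylow c); lia.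
have ltYz c : Y c < z c by move: (Ycap c) (ltaz c); rewrite /cap; lia.
have tight c : Y c < cap c -> need Y c = minn (need a c) (need b c).
  move=> ltY; apply/eqP; rewrite eqn_leq; have := Ylow c; rewrite /need => low.
  apply/andP; split; last by lia.
  rewrite leqNgt; apply/negP => ltN.
  pose Y' c' := if c' == c then (Y c).+1 else Y c'.
  have /Ymax : S Y'.
    split=> c'; rewrite /Y'; case: (eqVneq c' c) => [->|nc'] //.
    - exact: leq_trans (aY c) (leqnSn _).
    - case: eqP => [e'|_]; last by move: ltN; rewrite /need; lia.
      by move: ltN; rewrite /need e' mulnS; lia.
    - case: eqP => [e'|_]; last exact: Ylow.
      by have := Ylow c'; rewrite e' mulnS; lia.
  rewrite (bigD1 c) //= [leqRHS](bigD1 c) //= {1}/Y' eqxx.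
  rewrite [X in _ + X <= _](eq_bigr Y) => [|c' /negPf]; last by rewrite /Y' => ->.
  by lia.
have bound c : need Y c <= need b c \/
    need Y c = (need b c).+1 /\ ex c (need b c) < t.
  case: (ltnP (Y c) (cap c)) => [/tight ->|capY]; first by left; lia.
  have eY : Y c = cap c by move: (Ycap c); lia.
  have leY := Ycap (sg c).
  have leYb : p * Y (sg c) <= p * b (sg c).
    by rewrite leq_mul2l; apply/orP; right; move: leY; rewrite /cap; lia.
  case: (ltnP (b c) (z c)) => [ltbz|gebz].
    by left; rewrite /need eY /cap; lia.
  have eb : b c = z c by move: (lebz c); lia.
  case: (ltnP (Y (sg c)) (b (sg c))) => [ltYb|geYb].
    left; have : p * (Y (sg c)).+1 <= p * b (sg c) by rewrite leq_mul2l ltYb orbT.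
    by rewrite /need eY /cap mulnS; lia.
  have ltbz : b (sg c) < z (sg c) by move: leY (ltaz (sg c)); rewrite /cap; lia.
  have eYb : Y (sg c) = b (sg c) by move: leY; rewrite /cap; lia.
  right; split.
    by have := vb c; have := ltaz c; rewrite /need eY eYb /cap; lia.
  by rewrite ltnNge; apply/negP => let_; apply: none; exists c.
have ltbt c i : need a c <= i < need b c -> ex c i < t.
  move=> ?; rewrite ltn_neqAle top ?andbT; last by rewrite /differ; lia.
  by apply/eqP => /ex_col ce; subst c; lia.
suff : price Y < price a by rewrite ltnNge opt.
apply: (@ltn_of_heavier _ _ t) => [c i /andP[lei ltY]|].
  case: (bound c) => [le|[eN lt]]; first by apply: ltbt; lia.
  case: (ltnP i (need b c)) => [?|?]; first by apply: ltbt; lia.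
  by have -> : i = need b c by lia.
exists e, (need a e).-1; split => //.
case: (bound e) => [le|[eN lt]]; first lia.
case: (ltngtP (need Y e) (need a e)) => // [|ltn|eYa]; [lia|lia|].
by move: lt; rewrite /t -eYa eN ltnn.
Qed.

(** The vector x of [split_gap] for b - a plays the part of the integral quotient of b - a by its
    value at c0. Adding x to a and removing it from b never moves the needs apart; at c0, where x is
    1 and its successor value is 0, the need of a drops by one. *)
Lemma partial_raise a b c0 : valid a -> valid b -> (forall c, a c <= b c) ->
    b (sg c0) - a (sg c0) < b c0 - a c0 -> 0 < need a c0 ->
  exists x : T -> nat, [/\ x c0 = 1 /\ forall c, (b c0 - a c0) * x c <= b c - a c,
    valid (fun c => a c + x c), need (fun c => a c + x c) c0 < need a c0,
    forall c, c != c0 -> need (fun c => a c + x c) c <= maxn (need a c) (need b c)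
  & need b c0 < need a c0 -> valid (fun c => b c - x c) /\
    price (fun c => a c + x c) + price (fun c => b c - x c) <= price a + price b].
Proof.
move=> va vb leab gap N_gt0.
have [x [x1 x0 xk xS]] := @split_gap (fun c => b c - a c) c0 gap.
have leq_p m n : m <= n -> p * m <= p * n by move=> h; rewrite leq_mul2l h orbT.
have lexb c : a c + x c <= b c.
  have : x c <= (b c0 - a c0) * x c by rewrite leq_pmull //; lia.
  by move: (xk c) (leab c) => /=; lia.
have facts c : c != c0 -> [/\ a c + x c <= p * (a (sg c) + x (sg c)),
    p * (a (sg c) + x (sg c)) - (a c + x c) <= maxn (need a c) (need b c),
    b c - x c <= p * (b (sg c) - x (sg c)) &
    cheapest c (p * (a (sg c) + x (sg c)) - (a c + x c)) +
    cheapest c (p * (b (sg c) - x (sg c)) - (b c - x c)) <=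
    cheapest c (need a c) + cheapest c (need b c)].
  move=> /xS /= /andP[]; move: (va c) (vb c) (lexb c) (leq_p _ _ (lexb (sg c))).
  move: (leab c) (leq_p _ _ (leab (sg c))).
  rewrite /need !mulnDr !mulnBr => h1 h2 h3 h4 h5 h6 h7 h8.
  split; [lia|lia|lia|].
  case: (leqP (p * a (sg c) - a c) (p * b (sg c) - b c)) => [le|lt].
    by apply: cheapest_convex; lia.
  rewrite [leqRHS]addnC; apply: cheapest_convex; lia.
exists x; split=> // [c||c /facts[]//|lt].
- case: (eqVneq c c0) => [->|/facts[] //].
  by rewrite x1 x0 addn0; move: N_gt0; rewrite /need; lia.
- by rewrite /need x1 x0 addn0; move: N_gt0; rewrite /need; lia.
have facts0 : b c0 - 1 <= p * b (sg c0) by move: (vb c0); lia.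
split=> [c|]; first by case: (eqVneq c c0) => [->|/facts[] //]; rewrite x1 x0 subn0.
rewrite -!big_split /=; apply: leq_sum => c _.
case: (eqVneq c c0) => [->|/facts[] //].
move: lt gap (va c0) (vb c0) (leab c0) (leab (sg c0)).
rewrite /need x1 x0 addn0 subn0 => *.
rewrite [leqRHS]addnC; apply: cheapest_convex; lia.
Qed.

(** When the gap at c is 1 the drop is exactly one. When it is at least 2, the rows a + x and b - x
    with 2 x <= b - a still compete in the two optimality hypotheses; both then keep their price,
    and [price_inj] contradicts x c = 1. *)
Lemma drop_at_most_one a b lo z c : valid a -> valid b -> (forall c, a c <= b c) ->
    (forall c, a c < z c) -> (forall c, b c <= z c) ->
    (forall c, lo c <= a c) -> (forall c, lo c < b c) ->
    (forall Y, valid Y -> (forall c, a c <= Y c) -> (forall c, Y c < z c) ->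
       price a <= price Y) ->
    (forall Y, valid Y -> (forall c, lo c < Y c) -> (forall c, Y c <= b c) ->
       price b <= price Y) ->
  need a c <= (need b c).+1.
Proof.
move=> va vb leab ltaz lebz leloa ltlob opta optb.
case: (leqP (need a c) (need b c)) => [|lt]; first lia.
have leq_p m n : m <= n -> p * m <= p * n by move=> h; rewrite leq_mul2l h orbT.
have gapc : b (sg c) - a (sg c) < b c - a c.
  move: lt (va c) (vb c) (leab c) (leab (sg c)).
  rewrite /need; move: (a (sg c)) (b (sg c)) (a c) (b c) => a' b' a0 b0.
  move=> h1 h2 h3 h4 /subnKC e; move: h1 h3; rewrite -e mulnDr.
  by have := leq_pmull (b' - a') (ltnW p_gt1); lia.
case: (ltnP (b c - a c) 2) => [small|big].
  move: small gapc lt (va c) (vb c) (leab c) (leab (sg c)); rewrite /need.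
  move=> h1 h2 h3 h4 h5 h6 h7; have e : b (sg c) = a (sg c) by lia.
  by move: h3 h4 h5; rewrite e; lia.
have [x [[x1 xk] vax _ _]] := partial_raise va vb leab gapc (leq_ltn_trans (leq0n _) lt).
case/(_ lt) => vbx le.
have x2 d : 2 * x d <= b d - a d.
  by apply: leq_trans (xk d); rewrite leq_mul2r big orbT.
have le1 : price a <= price (fun c => a c + x c).
  by apply: opta => // d; move: (x2 d) (ltaz d) (lebz d) (leab d); lia.
have le2 : price b <= price (fun c => b c - x c).
  by apply: optb => // d; move: (x2 d) (leloa d) (ltlob d) (leab d); lia.
have e : price a = price (fun c => a c + x c) by lia.
by have := price_inj va vax e c; lia.
Qed.

(** Otherwise the needs agree at f, so the gap z' - z at f is p times the gap at [sg f], hence at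
    least 2. Raising z by the x of [partial_raise] sheds the last item at f and gains only lighter
    ones, against optimality. *)
Lemma difference_above z z' w f : valid z -> valid z' -> (forall c, z c <= z' c) ->
    (forall c, z c < w c) -> (forall c, z' c <= w c) ->
    (forall Y, valid Y -> (forall c, z c <= Y c) -> (forall c, Y c < w c) ->
       price z <= price Y) ->
    z f < z' f -> 0 < need z f ->
  exists c i, differ (need z) (need z') c i /\ ex f (need z f).-1 <= ex c i.
Proof.
move=> vz vz' lezz' ltzw lez'w opt ltf N_gt0; apply: contrapT => none.
have low c i : differ (need z) (need z') c i -> ex c i < ex f (need z f).-1.
  by move=> d; rewrite ltnNge; apply/negP => le; apply: none; exists c, i.
have eN : need z' f = need z f.
  apply/eqP/negPn/negP => ne.
  have := low f (maxn (need z f) (need z' f)).-1; rewrite /differ.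
  have : ex f (need z f).-1 <= ex f (maxn (need z f) (need z' f)).-1 by apply: ex_mono; lia.
  by move: ne; lia.
have leq_p m n : m <= n -> p * m <= p * n by move=> h; rewrite leq_mul2l h orbT.
have [gapf big] : z' (sg f) - z (sg f) < z' f - z f /\ 2 <= z' f - z f.
  move: eN (vz f) (vz' f) (lezz' (sg f)) ltf.
  rewrite /need; move: (z (sg f)) (z' (sg f)) (z f) (z' f) => a' b' a0 b0.
  move=> h1 h2 h3 /subnKC e h4; move: h1 h3; rewrite -e mulnDr addKn.
  move: (b' - a') => d h1 h3; have h5 : 2 * d <= p * d by rewrite leq_mul2r p_gt1 orbT.
  by case: (posnP d) h1 h3 h5 => [->|]; rewrite ?muln0; split; lia.
have [x [[x1 xk] vzx ltN leN _]] := partial_raise vz vz' lezz' gapf N_gt0.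
have x2 d : 2 * x d <= z' d - z d.
  by apply: leq_trans (xk d); rewrite leq_mul2r big orbT.
suff : price (fun c => z c + x c) < price z.
  by rewrite ltnNge opt // => d; move: (x2 d) (ltzw d) (lez'w d) (lezz' d); lia.
apply: (@ltn_of_heavier (need z) (need (fun c => z c + x c)) (ex f (need z f).-1)).
  move=> c i /andP[i1 i2].
  case: (eqVneq c f) => [e|/leN le]; first by move: i1 i2 ltN; rewrite e; lia.
  apply: low; rewrite /differ (leq_trans _ i1) ?geq_minl //.
  exact: leq_trans i2 le.
by exists f, (need z f).-1; split=> //; lia.
Qed.

(** * Towers and uniqueness of the optimum *)

Implicit Types (O : nat -> T -> nat) (m r : nat).

Definition tower m O :=
  [/\ forall c, O 0 c = 0, forall r, r < m -> forall c, O r c < O r.+1 c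
    & forall r, r <= m -> valid (O r)].

Definition total_price m O := \sum_(r < m) price (O r.+1).

Definition optimal m O :=
  tower m O /\ forall O', tower m O' -> total_price m O <= total_price m O'.

Definition update O r Y i : T -> nat := if i == r then Y else O i.

Lemma tower_update m O r Y : tower m O -> r < m -> valid Y ->
    (forall c, O r c < Y c) -> (r.+1 < m -> forall c, Y c < O r.+2 c) ->
  tower m (update O r.+1 Y).
Proof.
move=> [O0 Olt Ov] ltrm vY ltOY ltYO; rewrite /update; split=> [c|i ltim c|i leim].
- exact: O0.
- case: (eqVneq i r.+1) => [ei|ni].
    by rewrite ei eqn_leq ltnn ltYO // -ei.
  by case: eqP => [[->]|_]; [apply: ltOY | apply: Olt].
- by case: eqP => // _; apply: Ov.
Qed.

Lemma total_update m O r Y : r < m ->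
  total_price m (update O r.+1 Y) + price (O r.+1) = total_price m O + price Y.
Proof.
move=> ltrm; rewrite /total_price (bigD1 (Ordinal ltrm)) //= [in RHS](bigD1 (Ordinal ltrm)) //=.
rewrite (eq_bigr (fun i : 'I_m => price (O i.+1))) => [|i].
  by rewrite /update eqxx; lia.
by rewrite -val_eqE /update eqSS /= => /negPf ->.
Qed.

Lemma optimal_row m O r Y : optimal m O -> r < m -> valid Y ->
    (forall c, O r c < Y c) -> (r.+1 < m -> forall c, Y c < O r.+2 c) ->
  price (O r.+1) <= price Y.
Proof.
move=> [fO opt] ltrm vY h1 h2; have := opt _ (tower_update fO ltrm vY h1 h2).
by have := @total_update m O r Y ltrm; lia.
Qed.

(** Since O lies below O', the first R rows of O can be grafted under the remaining rows of O'. *)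
Lemma prefix_le m O O' R : optimal m O' -> tower m O -> R <= m ->
    (forall r c, r < m -> O r.+1 c <= O' r.+1 c) ->
  \sum_(r < R) price (O' r.+1) <= \sum_(r < R) price (O r.+1).
Proof.
move=> [fO' opt] fO leRm leOO'.
pose M i := if i <= R then O i else O' i.
have fM : tower m M.
  case: fO fO' => O0 Olt Ov [O'0 O'lt O'v]; rewrite /M; split=> [c|i ltim c|i leim].
  - exact: O0.
  - case: (ltngtP i R) => [ltiR|ltRi|ei].
    + by apply: Olt.
    + by apply: O'lt.
    + exact: leq_trans (Olt i ltim c) (leOO' _ _ ltim).
  - by case: ifP => _; [apply: Ov | apply: O'v].
have splitR X : total_price m X = \sum_(r < R) price (X r.+1) +
    \sum_(r < m - R) price (X (R + r).+1).
  by rewrite /total_price -[in LHS](subnKC leRm) big_split_ord.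
have := opt _ fM; rewrite !splitR [X in _ <= X + _](eq_bigr (fun r : 'I_R => price (O r.+1))).
  rewrite [X in _ <= _ + X](eq_bigr (fun r : 'I_(m - R) => price (O' (R + r).+1))).
    by rewrite leq_add2r.
  by move=> i _; rewrite /M /= ifF //; lia.
by move=> i _; rewrite /M /= ltn_ord.
Qed.

(* Let r be the lowest row where O and O' differ.  Prefix sums show that O' is
   cheaper there, so contact_of_descent and difference_above propagate a
   difference to the next row, at an exponent higher by at least #|T|.  As long
   as O' stays cheaper the accumulated saving is below p ^ (top exponent + 1),
   while a row where O' is dearer would outweigh it.  Hence O' is cheaper in all
   higher rows, which is absurd at the top row, where nothing obstructs. *)
Lemma interlaced_optimal_eq m O O' : optimal m O -> optimal m O' ->
    (forall r c, r < m -> O r.+1 c <= O' r.+1 c) ->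
    (forall r c, r.+1 < m -> O' r.+1 c <= O r.+2 c) ->
  forall r, r < m -> O r.+1 =1 O' r.+1.
Proof.
move=> optO optO' leOO' leO'O.
have [fO _] := optO; have [fO' _] := optO'.
case: (fO) (fO') => O0 Olt Ov [O'0 O'lt O'v].
(* The top row has no successor; O' plus one serves as a ceiling that O' never touches, which rules
   out a contact there. *)
pose next r c := if r.+1 < m then O r.+2 c else (O' r.+1 c).+1.
have optRow r Y : r < m -> valid Y -> (forall c, O r.+1 c <= Y c) ->
    (forall c, Y c < next r c) -> price (O r.+1) <= price Y.
  move=> ltrm vY leY ltY; apply: (optimal_row optO) => // [c|lt c].
    exact: leq_trans (Olt r ltrm c) (leY c).
  by have := ltY c; rewrite /next lt.
have optRow' r Y : r < m -> valid Y -> (forall c, O' r c < Y c) ->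
    (forall c, Y c <= O' r.+1 c) -> price (O' r.+1) <= price Y.
  move=> ltrm vY ltY leY; apply: (optimal_row optO') => // lt c.
  exact: leq_ltn_trans (leY c) (O'lt _ lt c).
have lt_next r c : r < m -> O r.+1 c < next r c.
  by move=> ltrm; rewrite /next; case: ifP => [/Olt //|_]; rewrite ltnS leOO'.
have le_next r c : r < m -> O' r.+1 c <= next r c.
  by move=> ltrm; rewrite /next; case: ifP => [/leO'O|].
have le_prev r c : r < m -> O' r c <= O r.+1 c.
  by case: r => [|r] ltrm; [rewrite O'0 | apply: leO'O].
have drop r c : r < m -> need (O r.+1) c <= (need (O' r.+1) c).+1.
  move=> ltrm; apply: (@drop_at_most_one _ _ (O' r) (next r)).
  - exact: Ov.
  - exact: O'v.
  - by move=> ?; apply: leOO'.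
  - by move=> ?; apply: lt_next.
  - by move=> ?; apply: le_next.
  - by move=> ?; apply: le_prev.
  - exact: O'lt.
  - by move=> Y; apply: optRow.
  - by move=> Y; apply: optRow'.
pose sum X r := \sum_(i < r) price (X i.+1).
have le_sum r : r <= m -> sum O' r <= sum O r.
  by move=> lerm; apply: (prefix_le optO').
(* The invariant: O' omits the top differing item of this row, of exponent t, and the total saved up
   to this row is below p ^ (t + 1). *)
pose P r := r < m /\ exists e, let t := ex e (need (O r.+1) e).-1 in
  [/\ need (O' r.+1) e < need (O r.+1) e,
      forall c i, differ (need (O r.+1)) (need (O' r.+1)) c i -> ex c i <= t
    & sum O r.+1 < sum O' r.+1 + p ^ t.+1].
have differ_row r : r < m -> (exists c, need (O r.+1) c <> need (O' r.+1) c) ->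
    (exists e, let t := ex e (need (O r.+1) e).-1 in
      [/\ need (O' r.+1) e < need (O r.+1) e,
      forall c i, differ (need (O r.+1)) (need (O' r.+1)) c i -> ex c i <= t &
      price (O r.+1) + p ^ (t.+1 - #|T|) <= price (O' r.+1) + p ^ t.+1]) \/
    (exists e, let t := ex e (need (O' r.+1) e).-1 in
      (forall c i, differ (need (O r.+1)) (need (O' r.+1)) c i -> ex c i <= t) /\
      price (O r.+1) + p ^ (t - #|T|.-1) <= price (O' r.+1)).
  move=> ltrm /top_difference[e ne top].
  have dropr c : need (O r.+1) c <= (need (O' r.+1) c).+1 by apply: drop.
  case: (ltngtP (need (O r.+1) e) (need (O' r.+1) e)) ne top => // lt _ top.
    by right; exists e; split=> //; apply: cheapest_gain_ge.
  by left; exists e; split=> //; apply: cheapest_loss_le.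
have sumS X r : sum X r.+1 = sum X r + price (X r.+1) by rewrite /sum big_ord_recr.
have step r : P r -> P r.+1.
  case=> ltrm [e [lte top lt_sum]]; set t := ex e _ in top lt_sum.
  have [f [ef ltf let_]] := contact_of_descent (Ov _ ltrm) (O'v _ ltrm)
    (fun c => leOO' r c ltrm) (fun c => lt_next r c ltrm) (fun c => le_next r c ltrm)
    (fun Y => @optRow r Y ltrm) lte top.
  have ltr1 : r.+1 < m.
    by rewrite ltnNge; apply/negP => le; move: ef; rewrite /next ltnNge le /=; lia.
  rewrite /next ltr1 in ef ltf.
  (* Contact at f with a free successor makes the need jump by at least p. So p - 1 further items
     lie between the contact exponent and the last item of the upper row, and [ex_step] turns them
     into #|T| more in the exponent. *)
  have needf : need (O' r.+1) f + p <= need (O r.+2) f.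
    have : p * (O' r.+1 (sg f)).+1 <= p * O r.+2 (sg f) by rewrite leq_mul2l ltf orbT.
    by rewrite /need ef mulnS; have := O'v _ ltrm f; rewrite ef; lia.
  have [c [i [dci leE]]] : exists c i, differ (need (O r.+2)) (need (O' r.+2)) c i /\
      ex f (need (O r.+2) f).-1 <= ex c i.
    apply: (@difference_above _ _ (next r.+1)).
    - exact: Ov.
    - exact: O'v.
    - by move=> ?; apply: leOO'.
    - by move=> ?; apply: lt_next.
    - by move=> ?; apply: le_next.
    - by move=> Y; apply: optRow.
    - by rewrite -ef; apply: O'lt.
    - by move: needf p_gt1; lia.
  have letE : t + #|T| <= ex c i.
    apply: leq_trans leE; apply: (@leq_trans (ex f (need (O' r.+1) f) + #|T|)).
      by rewrite leq_add2r.
    by apply: leq_trans (ex_step _ _) (ex_mono _ _); move: needf p_gt1; lia.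
  have [||] := differ_row r.+1 ltr1.
  - by exists c => ec; move: dci; rewrite /differ ec minnn maxnn; lia.
  - case=> e' [lte' top' le']; split=> //; exists e'; split=> //.
    set t' := ex e' _ in top' le' *.
    have := top' _ _ dci => let'.
    have : p ^ t.+1 <= p ^ (t'.+1 - #|T|) by rewrite leq_exp2l //; lia.
    by move: lt_sum; rewrite !(sumS _ r.+1); lia.
  (* O' is dearer in this row, by at least p ^ (t + 1) since t' >= t + #|T|; this exceeds the
     earlier saving and contradicts the comparison of prefixes. *)
  case=> e' [top' le']; set t' := ex e' _ in top' le'.
  have := top' _ _ dci => let'.
  have T_gt0 : 0 < #|T| by apply/card_gt0P; exists c.
  have : p ^ t.+1 <= p ^ (t' - #|T|.-1) by rewrite leq_exp2l //; lia.
  by have := le_sum _ ltr1; move: lt_sum; rewrite !(sumS _ r.+1); lia.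
have noP r : ~ P r.
  move=> Pr; have PD k : P (r + k).
    by elim: k => [|k IHk]; rewrite ?addn0 // addnS; apply: step.
  by case: (PD m); rewrite ltnNge leq_addl.
suff main r : r <= m -> forall i, i < r -> O i.+1 =1 O' i.+1.
  by move=> r; apply: (main m).
elim: r => // r IHr ltrm i; rewrite ltnS leq_eqVlt => /predU1P[-> {i}|]; last first.
  by apply: IHr; apply: ltnW.
have eq_sum : sum O r = sum O' r.
  by apply: eq_bigr => j _; apply: eq_price; apply: IHr => //; apply: ltnW.
apply: need_inj; [exact: Ov | exact: O'v |] => c0; apply: contrapT => nc0.
have le_row : price (O' r.+1) <= price (O r.+1).
  by have := le_sum _ ltrm; rewrite !(sumS _ r) eq_sum leq_add2l.
case: (differ_row r ltrm (ex_intro _ c0 nc0)) => [[e [lte top le]]|[e [top le]]].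
  apply: (noP r); split=> //; exists e; split=> //.
  rewrite !(sumS _ r) eq_sum -addnA ltn_add2l.
  by apply: leq_trans le; rewrite -[ltnLHS]addn0 ltn_add2l expn_gt0 (ltnW p_gt1).
by move: le le_row; have := @expn_gt0 p (ex e (need (O' r.+1) e).-1 - #|T|.-1);
  rewrite (ltnW p_gt1); lia.
Qed.

Lemma optimal_of_sum m O O' A D : optimal m O -> optimal m O' ->
    tower m A -> tower m D ->
    total_price m A + total_price m D <= total_price m O + total_price m O' ->
  optimal m A /\ optimal m D.
Proof.
move=> [fO optO] [fO' optO'] fA fD le.
have := optO _ fA; have := optO' _ fA; have := optO _ fD; have := optO' _ fD.
move=> *; split; split=> // X fX; have := optO _ fX; have := optO' _ fX; lia.
Qed.

(** Induction on the total gap. Uncrossing O' with O shifted by one row gives an optimal [E] with O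
    <= E <= O'. If E = O', the towers interlace. Otherwise O = E by induction, and as O r < O (r +
    1) the minimum defining [E] is attained by O' r, so O' = O. *)
Lemma comparable_optimal_eq m O O' : optimal m O -> optimal m O' ->
    (forall r c, r < m -> O r.+1 c <= O' r.+1 c) ->
  forall r, r < m -> O r.+1 =1 O' r.+1.
Proof.
case: m => // m; have [n] := ubnP (\sum_(r < m.+1) \sum_c (O' r.+1 c - O r.+1 c)).
elim: n O' => // n IHn O' lt_n optO optO' leOO'.
have [fO _] := optO; have [fO' _] := optO'.
case: (fO) (fO') => O0 Olt Ov [O'0 O'lt O'v].
(* The two rows left without partner, the top row of O' and the bottom row of O, are kept unchanged
   in [E] and [D]. *)
pose E i := if 0 < i <= m then meetv (O' i) (O i.+1) else O' i.
pose D i := if 1 < i then joinv (O' i.-1) (O i) else O i.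
have leOO'0 r c : r <= m.+1 -> O r c <= O' r c.
  by case: r => [|r]; [rewrite O0 O'0 | move/(leOO' _ c)].
have fE : tower m.+1 E.
  split=> [c|r ltrm c|r lerm]; rewrite /E.
  - exact: O'0.
  - have := O'lt r ltrm c; have := Olt r ltrm c; have := leOO'0 r.+1 c ltrm.
    have := O'0 c; have := O0 c.
    have /predU1P[->|lt] : (r == m) || (r < m) by rewrite -leq_eqVlt -ltnS.
      by rewrite ltnn leqnn andbF andbT; case: (posnP m) => [->|m_gt0]; rewrite ?m_gt0 /meetv; lia.
    have := Olt r.+1 lt c; rewrite lt (ltnW lt) /= andbT.
    by case: (posnP r) => [->|r_gt0] /=; rewrite ?r_gt0 /meetv; lia.
  - case: ifP => [/andP[_ le]|_]; last exact: O'v.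
    by apply: valid_meet; [apply: O'v | apply: Ov].
have fD : tower m.+1 D.
  split=> [c|r ltrm c|r lerm]; rewrite /D.
  - exact: O0.
  - have := Olt r ltrm c; have := leOO'0 r c (ltnW ltrm); have := O0 c; have := O'0 c.
    case: r ltrm => [|r] ltrm //=; have := O'lt r (ltnW ltrm) c.
    by case: r ltrm => [|r] ltrm /=; rewrite /joinv; lia.
  - case: ifP => [le|_]; last exact: Ov.
    by apply: valid_join; [apply: O'v; lia | apply: Ov].
have le_tot : total_price m.+1 E + total_price m.+1 D <= total_price m.+1 O + total_price m.+1 O'.
  rewrite /total_price big_ord_recr [\sum_(r < m.+1) price (D _)]big_ord_recl.
  rewrite [X in _ <= X + _]big_ord_recl [X in _ <= _ + X]big_ord_recr /=.
  have -> : E m.+1 = O' m.+1 by rewrite /E ltnn andbF.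
  have -> : D 1 = O 1 by [].
  suff : \sum_(r < m) price (E r.+1) + \sum_(r < m) price (D r.+2) <=
    \sum_(r < m) price (O' r.+1) + \sum_(r < m) price (O r.+2).
    have -> : \sum_(r < m) price (O (bump 0 r).+1) = \sum_(r < m) price (O r.+2) by [].
    have -> : \sum_(r < m) price (D (bump 0 r).+1) = \sum_(r < m) price (D r.+2) by [].
    move: (\sum_(r < m) price (D r.+2)) (\sum_(r < m) price (O r.+2)) => d o.
    move: (\sum_(r < m) price (E r.+1)) (\sum_(r < m) price (O' r.+1)) => e o'.
    by move: (price (O 1)) (price (O' m.+1)) => x y; lia.
  rewrite -!big_split; apply: leq_sum => r _ /=.
  rewrite /E /D /= ltn_ord; apply: price_meet_join; [apply: O'v|apply: Ov]; have := ltn_ord r; lia.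
have [optE _] := optimal_of_sum optO optO' fE fD le_tot.
have leOE r c : r < m.+1 -> O r.+1 c <= E r.+1 c.
  rewrite /E ltnS leq_eqVlt => /predU1P[->|ltrm]; first by rewrite ltnn leOO'.
  rewrite ltrm /meetv leq_min leOO' /=; last exact: ltnW.
  by rewrite ltnW // Olt.
have leEO' r c : r < m.+1 -> E r.+1 c <= O' r.+1 c.
  by rewrite /E /meetv; case: ifP => // _ _; apply: geq_minl.
case: (pselect (forall r c, r < m.+1 -> E r.+1 c = O' r.+1 c)) => [eE|neE].
  apply: interlaced_optimal_eq => // r c ltr.
  by rewrite -(eE r c (ltnW ltr)) /E /= ifT //; apply: geq_minr.
have {}IHn : forall r, r < m.+1 -> O r.+1 =1 E r.+1.
  apply: IHn => //; rewrite ltnS in lt_n; apply: leq_trans lt_n.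
  rewrite ltn_neqAle; apply/andP; split.
    apply/eqP => eqS; apply: neE => r c ltr.
    have leS (i : 'I_m.+1) : \sum_c (E i.+1 c - O i.+1 c) <= \sum_c (O' i.+1 c - O i.+1 c).
      by apply: leq_sum => c' _; apply: leq_sub2r; apply: leEO'.
    move: eqS; rewrite (bigD1 (Ordinal ltr)) //= [in RHS](bigD1 (Ordinal ltr)) //=.
    rewrite (bigD1 c) //= [in X in _ = X + _](bigD1 c) //=.
    have : \sum_(i < m.+1 | i != Ordinal ltr) \sum_c (E i.+1 c - O i.+1 c) <=
      \sum_(i < m.+1 | i != Ordinal ltr) \sum_c (O' i.+1 c - O i.+1 c).
      by apply: leq_sum => i _; apply: leS.
    have : \sum_(i | i != c) (E r.+1 i - O r.+1 i) <= \sum_(i | i != c) (O' r.+1 i - O r.+1 i).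
      by apply: leq_sum => i _; apply: leq_sub2r; apply: leEO'.
    have := leEO' r c ltr; have := leOE r c ltr.
    move: (\sum_(i | i != c) (E r.+1 i - O r.+1 i)) => e.
    move: (\sum_(i | i != c) (O' r.+1 i - O r.+1 i)) => o.
    move: (\sum_(i < m.+1 | i != Ordinal ltr) \sum_c0 (E i.+1 c0 - O i.+1 c0)) => x.
    move: (\sum_(i < m.+1 | i != Ordinal ltr) \sum_c0 (O' i.+1 c0 - O i.+1 c0)) => y.
    lia.
  apply: leq_sum => i _; apply: leq_sum => c _; apply: leq_sub2r; exact: leEO'.
move=> r ltr c; move: (IHn r ltr c); rewrite /E; case: ifP => [/andP[_ lt]|//].
rewrite /meetv; have := Olt r.+1 lt c; have := leOO' r c ltr; lia.
Qed.

(** Meet and join of two optimal towers are again optimal, and comparable, hence equal. *)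
Lemma optimal_unique m O O' : optimal m O -> optimal m O' ->
  forall r, r < m -> O r.+1 =1 O' r.+1.
Proof.
move=> optO optO'; have [fO _] := optO; have [fO' _] := optO'.
case: (fO) (fO') => O0 Olt Ov [O'0 O'lt O'v].
pose A r := meetv (O r) (O' r); pose D r := joinv (O r) (O' r).
have fA : tower m A.
  split=> [c|r ltrm c|r lerm]; last by apply: valid_meet; [apply: Ov|apply: O'v].
    by rewrite /A /meetv O0 min0n.
  by rewrite /A /meetv; have := Olt r ltrm c; have := O'lt r ltrm c; lia.
have fD : tower m D.
  split=> [c|r ltrm c|r lerm]; last by apply: valid_join; [apply: Ov|apply: O'v].
    by rewrite /D /joinv O0 O'0.
  by rewrite /D /joinv; have := Olt r ltrm c; have := O'lt r ltrm c; lia.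
have [|optA optD] := optimal_of_sum optO optO' fA fD.
  rewrite -!big_split; apply: leq_sum => r _.
  by apply: price_meet_join; [apply: Ov | apply: O'v]; apply: ltn_ord.
move=> r ltrm c.
have := comparable_optimal_eq optA optD _ ltrm; rewrite /A /D /meetv /joinv.
by move/(_ (fun _ _ _ => leq_trans (geq_minl _ _) (leq_maxl _ _)) c); lia.
Qed.

Lemma exists_optimal m : exists O, optimal m O.
Proof.
have [O fO min] : exists2 O, tower m O & forall O', tower m O' -> total_price m O <= total_price m O'.
  apply: ex_argmin; exists (fun r _ => r); split=> // r _ c.
  by rewrite leq_pmull // ltnW.
by exists O.
Qed.

(** A drop in need opens a gap of at least 3 at c, because the rows are strictly ordered at [sg c]
    too. Shifting the rows towards each other by x with 3 x <= gap keeps them strictly ordered and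
    does not raise the total: a second optimal tower. *)
Lemma optimal_nested m O r c : optimal m O -> r < m -> need (O r) c <= need (O r.+1) c.
Proof.
move=> optO; have [fO minO] := optO; case: (fO) => O0 Olt Ov.
case: r => [|r] ltrm; first by rewrite /need O0 muln0.
set a := O r.+1; set b := O r.+2; rewrite leqNgt; apply/negP => lt.
have va : valid a by apply: Ov; apply: ltnW.
have vb : valid b by apply: Ov.
have ltab d : a d < b d by apply: Olt.
have [gapc big] : b (sg c) - a (sg c) < b c - a c /\ 3 <= b c - a c.
  move: lt (va c) (vb c) (ltab c) (ltab (sg c)).
  rewrite /need; move: (a (sg c)) (b (sg c)) (a c) (b c) => a' b' a0 b0.
  move=> h1 h2 h3 h4 h5; move: h1 h3; rewrite -(subnKC (ltnW h5)) mulnDr addKn.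
  have : 2 * (b' - a') <= p * (b' - a') by rewrite leq_mul2r p_gt1 orbT.
  by lia.
have [x [[x1 xk] vax _ _ H]] :=
  partial_raise va vb (fun d => ltnW (ltab d)) gapc (leq_ltn_trans (leq0n _) lt).
have {H} [vbx le] := H lt.
have x3 d : 3 * x d <= b d - a d.
  by apply: leq_trans (xk d); rewrite leq_mul2r big orbT.
pose O1 := update O r.+1 (fun d => a d + x d).
have fO1 : tower m O1.
  apply: tower_update => // [|d|_ d]; first exact: ltnW.
    by have := Olt r (ltnW ltrm) d; rewrite -/a; lia.
  by have := x3 d; have := ltab d; rewrite -/b; lia.
pose O2 := update O1 r.+2 (fun d => b d - x d).
have fO2 : tower m O2.
  apply: tower_update => // [d|lt3 d].
    by rewrite /O1 /update eqxx; have := x3 d; have := ltab d; lia.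
  rewrite /O1 /update (_ : (r.+3 == r.+1) = false); last lia.
  by have := Olt _ lt3 d; rewrite -/b; lia.
have optO2 : optimal m O2.
  split=> // X /minO; have := @total_update m O1 r.+1 (fun d => b d - x d) ltrm.
  have := @total_update m O r (fun d => a d + x d) (ltnW ltrm).
  have -> : price (O1 r.+2) = price b.
    by rewrite /O1 /update eqn_leq ltnn.
  by rewrite -/O1 -/O2 -/a; lia.
have := optimal_unique optO optO2 (ltnW ltrm) c.
by rewrite /O2 /O1 /update eqn_leq ltnn andbF eqxx -/a; lia.
Qed.

(** Uncrossing P with Q shifted by one row yields two towers of height m + 1. Without strictness
    both would be optimal, hence equal; going down from the top this gives Q i = P (i + 2), and
    finally 0 = P 2. *)
Lemma total_strictly_convex m Q M P : 0 < #|T| ->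
    optimal m Q -> optimal m.+1 M -> optimal m.+2 P ->
  2 * total_price m.+1 M < total_price m Q + total_price m.+2 P.
Proof.
move=> /card_gt0P[c0 _] [fQ _] optM [fP _]; case: fQ fP => Q0 Qlt Qv [P0 Plt Pv].
pose A i := joinv (P i) (Q i.-1).
pose C i := if i <= m then meetv (P i.+1) (Q i) else P i.+1.
have fA : tower m.+1 A.
  split=> [c|r ltrm c|r lerm].
  - by rewrite /A /joinv P0 Q0.
  - have := Plt r (ltnW ltrm) c; rewrite /A /joinv; have := Q0 c.
    case: r ltrm => [|r] ltrm /=; first by lia.
    by have := Qlt r ltrm c; lia.
  - by apply: valid_join; [apply: Pv | apply: Qv]; lia.
have fC : tower m.+1 C.
  split=> [c|r ltrm c|r lerm]; rewrite /C.
  - by rewrite /= /meetv Q0 minn0.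
  - have := Plt r.+1 ltrm c; rewrite (ltnSE ltrm) /meetv.
    by case: (ltnP r m) => [lt|_]; [have := Qlt r lt c|]; lia.
  - case: ifP => lt; last exact: Pv.
    by apply: valid_meet; [apply: Pv | apply: Qv].
have le_tot : total_price m.+1 A + total_price m.+1 C <= total_price m Q + total_price m.+2 P.
  rewrite /total_price [X in X + _ <= _]big_ord_recl [X in _ + X <= _]big_ord_recr.
  rewrite [X in _ <= _ + X]big_ord_recr [X in _ <= _ + (X + _)]big_ord_recl /=.
  have -> : price (A 1) = price (P 1).
    by apply: eq_price => c; rewrite /A /joinv /= Q0 maxn0.
  have -> : C m.+1 = P m.+2 by rewrite /C ltnn.
  suff : \sum_(r < m) price (C r.+1) + \sum_(r < m) price (A r.+2) <=
    \sum_(r < m) price (P r.+2) + \sum_(r < m) price (Q r.+1).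
    have -> : \sum_(r < m) price (P (bump 0 r).+1) = \sum_(r < m) price (P r.+2) by [].
    have -> : \sum_(r < m) price (A (bump 0 r).+1) = \sum_(r < m) price (A r.+2) by [].
    move: (\sum_(r < m) price (P r.+2)) (\sum_(r < m) price (A r.+2)) => x a.
    move: (\sum_(r < m) price (C r.+1)) (\sum_(r < m) price (Q r.+1)) => e q; lia.
  rewrite -!big_split; apply: leq_sum => r _ /=; rewrite /C ltn_ord.
  by apply: price_meet_join; [apply: Pv | apply: Qv]; have := ltn_ord r; lia.
rewrite ltnNge; apply/negP => ge.
have [|optA optC] := optimal_of_sum optM optM fA fC; first lia.
have eqAC := optimal_unique optA optC.
have QP k : k <= m -> Q (m - k) c0 = P (m - k).+2 c0.
  elim: k => [|k IHk] lek.
    have := eqAC m (ltnSn m) c0; rewrite subn0 /A /C ltnn /joinv /=.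
    by have := Plt m.+1 (ltnSn _) c0; lia.
  have lt : m - k.+1 < m by lia.
  have := eqAC _ (ltnW lt) c0; rewrite /A /C lt /joinv /meetv /=.
  have eS : (m - k.+1).+1 = m - k by lia.
  rewrite eS (IHk (ltnW lek)).
  have := Plt (m - k) ltac:(lia) c0; have := Plt (m - k).+1 ltac:(lia) c0.
  by lia.
have := QP m (leqnn m); rewrite subnn Q0.
by have := Plt 1 isT c0; lia.
Qed.

End Staircase.

(** * Items priced by base-p digits *)

Lemma leqif_cross a b x y : a < b -> x <= y ->
  a * y + b * x <= a * x + b * y ?= iff (x == y).
Proof.
move=> ltab /subnKC <-; move: (y - x) => k; rewrite !mulnDr addnAC addnA.
split; first by rewrite leq_add2l leq_mul2r ltnW ?orbT.
by rewrite eqn_add2l eqn_mul2r (ltn_eqF ltab) orbF -[X in X == _ + _]addn0 eqn_add2l eq_sym.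
Qed.

Section DigitItems.
Variables (p s L : nat) (dg : nat -> nat).
Hypotheses (p_gt1 : 1 < p) (s_gt0 : 0 < s).
Hypothesis dg_small : forall j, dg j <= p.-1.
Hypothesis dg_gt0 : forall j, L <= j -> 0 < dg j.

(* The digit dg j stands for dg j items of price p ^ j, of colour j mod s. *)
Definition color j : 'I_s := Ordinal (ltn_pmod j s_gt0).

Definition supply (c : 'I_s) J := \sum_(j < J | color j == c) dg j.

Lemma supplyS c J : supply c J.+1 = supply c J + (color J == c) * dg J.
Proof.
rewrite /supply big_mkcond big_ord_recr -big_mkcond /=.
by case: eqP; rewrite ?mul1n ?mul0n.
Qed.

Lemma leq_supply c J J' : J <= J' -> supply c J <= supply c J'.
Proof.
move=> /subnKC <-; elim: (J' - J) => [|k IHk]; first by rewrite addn0.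
by rewrite addnS supplyS; apply: leq_trans IHk (leq_addr _ _).
Qed.

Lemma supply_unbounded c n : exists J, n < supply c J.+1.
Proof.
elim: n => [|n [J ltn]].
  exists (s * L + c); rewrite supplyS (_ : color _ = c); last first.
    by apply: val_inj; rewrite /= mulnC modnMDl modn_small.
  by rewrite eqxx mul1n ltn_addl // dg_gt0 // (leq_trans _ (leq_addr _ _)) // leq_pmull.
pose J' := maxn J.+1 L; exists (s * J' + c).
have leJ' : J' <= s * J' + c by rewrite (leq_trans _ (leq_addr _ _)) // leq_pmull.
rewrite supplyS (_ : color _ = c); last first.
  by apply: val_inj; rewrite /= mulnC modnMDl modn_small.
have := dg_gt0 (leq_trans (leq_maxr J.+1 L) leJ').
have : supply c J.+1 <= supply c (s * J' + c).
  by apply: leq_supply; apply: leq_trans (leq_maxl _ _) leJ'.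
rewrite eqxx mul1n; lia.
Qed.

(** The stock of colour c is listed by increasing price; this is the exponent of the item numbered
    n, counting from 0. *)
Definition item_exp c n := ex_minn (supply_unbounded c n).

Lemma item_expP c n : supply c (item_exp c n) <= n < supply c (item_exp c n).+1.
Proof.
rewrite /item_exp; case: ex_minnP => J -> min; rewrite andbT leqNgt; apply/negP => lt.
by case: J min lt => [_|J min /min]; rewrite ?ltnn // /supply big_ord0.
Qed.

Lemma item_exp_eq c n J : supply c J <= n < supply c J.+1 -> item_exp c n = J.
Proof.
move=> /andP[leJ ltJ]; have /andP[le lt] := item_expP c n.
have := @leq_supply c (item_exp c n).+1 J; have := @leq_supply c J.+1 (item_exp c n).
lia.
Qed.

Lemma item_exp_color c n : color (item_exp c n) = c.
Proof.
apply/eqP; have := item_expP c n; rewrite supplyS; case: eqP => // _.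
by rewrite mul0n addn0; lia.
Qed.

Lemma item_exp_mono c i j : i <= j -> item_exp c i <= item_exp c j.
Proof.
move=> leij; have /andP[le _] := item_expP c i; have /andP[_ lt] := item_expP c j.
have := @leq_supply c (item_exp c j).+1 (item_exp c i); lia.
Qed.

Lemma item_exp_col c c' i j : item_exp c i = item_exp c' j -> c = c'.
Proof. by move=> e; rewrite -(item_exp_color c i) e item_exp_color. Qed.

(** A digit supplies at most p - 1 items, so p - 1 steps leave it, and the next exponent of the same
    colour is s further. *)
Lemma item_exp_step c i : item_exp c i + #|'I_s| <= item_exp c (i + p.-1).
Proof.
rewrite card_ord; have /andP[le lt] := item_expP c i; set J := item_exp c i in le lt *.
have eJ : color J = c := item_exp_color c i.
have supJ k : k < s -> supply c (J.+1 + k) = supply c J.+1.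
  elim: k => [|k IHk] ltk; rewrite ?addn0 // addnS supplyS IHk; last exact: ltnW.
  have -> : (color (J.+1 + k) == c) = false; last by rewrite mul0n addn0.
  rewrite -eJ; apply/negP => /eqP/(congr1 val)/eqP /=.
  by rewrite addSnnS -[X in _ == X %% _]addn0 eqn_modDl mod0n modn_small.
rewrite leqNgt; apply/negP => ltn; have /andP[_] := item_expP c (i + p.-1).
have := @leq_supply c (item_exp c (i + p.-1)).+1 (J.+1 + s.-1) ltac:(lia).
rewrite supJ ?prednK // (supplyS c J) eJ eqxx mul1n.
by have := dg_small J; lia.
Qed.

Local Notation cheap := (cheapest p item_exp).

Definition cheap_digit c n j := minn (dg j) (n - supply c j).

Lemma sum_cheap_digit c n J :
  \sum_(j < J | color j == c) cheap_digit c n j = minn n (supply c J).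
Proof.
elim: J => [|J IHJ]; first by rewrite /supply !big_ord0 minn0.
rewrite big_mkcond big_ord_recr -big_mkcond /= IHJ supplyS /cheap_digit.
by case: eqP => _; lia.
Qed.

Lemma cheapest_digits c n J :
  cheap c (minn n (supply c J)) = \sum_(j < J | color j == c) p ^ j * cheap_digit c n j.
Proof.
elim: J => [|J IHJ]; first by rewrite /supply !big_ord0 minn0 /cheapest big_ord0.
rewrite [RHS]big_mkcond big_ord_recr -big_mkcond /= -IHJ supplyS /cheap_digit.
case: (eqVneq (color J) c) => [eJ|_]; last by rewrite mul0n !addn0.
rewrite mul1n (_ : minn n _ = minn n (supply c J) + minn (dg J) (n - supply c J)); last lia.
rewrite cheapestD; congr (_ + _).
rewrite (eq_bigr (fun=> p ^ J)) ?sum_nat_const ?card_ord 1?mulnC // => i _.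
congr (p ^ _); apply: item_exp_eq; rewrite supplyS eJ eqxx; have := ltn_ord i; lia.
Qed.

(** Rearrangement around the exponent [J0] of the last greedy item: the greedy choice takes all of
    each digit below [J0] and nothing above, and the common total N cancels after summation. *)
Lemma cheapest_leq_digits c (nu : nat -> nat) J (N := \sum_(j < J | color j == c) nu j) :
    (forall j, j < J -> nu j <= dg j) ->
  cheap c N <= \sum_(j < J | color j == c) p ^ j * nu j
    ?= iff [forall (j : 'I_J | color j == c), nu j == cheap_digit c N j].
Proof.
move=> nu_dg.
have leN : N <= supply c J by apply: leq_sum => j _; apply: nu_dg.
have [N0|N_gt0] := posnP N.
  have nu0 (j : 'I_J) : color j == c -> nu j = 0.
    by move=> cj; apply/eqP; move: N0; rewrite /N (bigD1 j) //=; lia.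
  rewrite N0 /cheapest big_ord0 big1 => [|j cj]; last by rewrite nu0 ?muln0.
  split=> //; rewrite eqxx; apply/esym/forallP => j; apply/implyP => cj.
  by rewrite nu0 // /cheap_digit sub0n minn0.
pose J0 := item_exp c N.-1; have /andP[J0le J0lt] := item_expP c N.-1.
have sumN : \sum_(j < J | color j == c) cheap_digit c N j = N.
  by rewrite sum_cheap_digit; apply/minn_idPl.
have -> : cheap c N = \sum_(j < J | color j == c) p ^ j * cheap_digit c N j.
  by rewrite -cheapest_digits (minn_idPl leN).
have termwise (j : 'I_J) : color j == c ->
    p ^ j * cheap_digit c N j + p ^ J0 * nu j <=
    p ^ j * nu j + p ^ J0 * cheap_digit c N j
      ?= iff ((j == J0 :> nat) || (nu j == cheap_digit c N j)).
  move=> cj; have := nu_dg j (ltn_ord j).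
  case: (ltngtP j J0) => [ltj|gtj|->] lej /=; last by split; [rewrite addnC|rewrite addnC eqxx].
    have -> : cheap_digit c N j = dg j.
      apply/minn_idPl; have := @leq_supply c j.+1 J0 ltj; rewrite supplyS cj mul1n.
      by move: J0le; rewrite -/J0; lia.
    by apply: leqif_cross => //; rewrite ltn_exp2l.
  have -> : cheap_digit c N j = 0.
    rewrite /cheap_digit (_ : N - _ = 0) ?minn0 //; have := @leq_supply c J0.+1 j gtj.
    by move: J0lt; rewrite -/J0; lia.
  by rewrite addnC [X in _ <= X ?= iff _]addnC eq_sym; apply: leqif_cross; rewrite ?ltn_exp2l.
have [le eq_iff] := leqif_sum termwise.
move: le eq_iff; rewrite !big_split -!big_distrr /= sumN -/N leq_add2r => le.
rewrite eqn_add2r => eq_iff; split=> //; rewrite eq_iff.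
apply/forall_inP/forall_inP => eq_nu j cj; last by rewrite eq_nu ?orbT.
(* The termwise inequality says nothing at [J0]; there nu is forced by the common total. *)
case: (eqVneq (j : nat) J0) => [ej|nej]; last by have := eq_nu j cj; rewrite (negPf nej).
move: sumN; rewrite {2}/N (bigD1 j) //= [RHS](bigD1 j) //=.
rewrite [X in _ + X](eq_bigr (fun j : 'I_J => nu j)) => [/addIn ->//|i /andP[ci nij]].
rewrite -val_eqE in nij; have := eq_nu i ci; rewrite -ej (negPf nij) /= => /eqP -> //.
Qed.

(** * Powers of p modulo q - 1, and the passage between configurations and towers *)

Lemma expn_modP a b : a = b %[mod s] -> p ^ a = p ^ b %[mod (p ^ s).-1].
Proof.
move=> eab; suff red n : p ^ n = p ^ (n %% s) %[mod (p ^ s).-1] by rewrite red eab -red.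
rewrite [in LHS](divn_eq n s) expnD mulnC mulnC [(_ %/ _) * s]mulnC expnM -modnMml -modnXm.
have e : p ^ s = (p ^ s).-1 + 1 by rewrite addn1 prednK // expn_gt0 ltnW.
by rewrite {1}e modnDl modnXm exp1n modnMml mul1n.
Qed.

Definition rot (c : 'I_s) j := (j + (s - c)) %% s.

Lemma rot_eq0 c j : (rot c j == 0) = (color j == c).
Proof.
rewrite -val_eqE /= /rot -[X in _ = (_ == X)](modn_small (ltn_ord c)).
rewrite -[RHS](eqn_modDr (s - c)) subnKC ?modnn //; exact: ltnW.
Qed.

Lemma rot_ordS c j : rot c j = (rot (ordS c) j).+1 %% s.
Proof.
rewrite /rot -[in RHS]addn1 modnDml /=; have := ltn_ord c; rewrite leq_eqVlt.
case/predU1P => [e|lt]; last by rewrite (modn_small lt); congr (_ %% _); lia.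
rewrite e modnn subn0 (_ : j + s + 1 = j + (s - c) + s) ?modnDr //; lia.
Qed.

(** Moving from c to c + 1 lowers the rotated exponent by one, unless j has colour c: then it wraps
    from 0 to s - 1, and p * p ^ (s - 1) exceeds 1 by q - 1. *)
Lemma expn_rot c j : p * p ^ rot (ordS c) j = p ^ rot c j + (color j == c) * (p ^ s).-1.
Proof.
have ltx : rot (ordS c) j < s by rewrite ltn_mod.
rewrite -rot_eq0 (rot_ordS c) -expnS; move: ltx; rewrite leq_eqVlt => /predU1P[->|lt].
  by rewrite modnn eqxx expn0 mul1n add1n prednK // expn_gt0 (ltnW p_gt1).
by rewrite modn_small // mul0n addn0.
Qed.

Section Configurations.
Implicit Types (cnt : nat -> nat -> nat) (c : 'I_s) (m l : nat).

Definition level_sum cnt l := \sum_(j < L) p ^ j * cnt j l.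
Definition level_rot cnt c l := \sum_(j < L) p ^ rot c j * cnt j l.
Definition level_count cnt c l := \sum_(j < L | color j == c) cnt j l.

Lemma level_rotS cnt c l :
  p * level_rot cnt (ordS c) l = level_rot cnt c l + (p ^ s).-1 * level_count cnt c l.
Proof.
rewrite /level_count /level_rot !big_distrr [X in _ + X]big_mkcond -big_split /=.
apply: eq_bigr => j _; rewrite mulnA expn_rot mulnDl; congr (_ + _).
case: eqP => _; rewrite ?mul1n ?mul0n //.
Qed.

Lemma level_rot_mod cnt c l :
  p ^ c * level_rot cnt c l = level_sum cnt l %[mod (p ^ s).-1].
Proof.
rewrite /level_rot /level_sum big_distrr /= -modn_summ -[in RHS]modn_summ; congr (_ %% _).
apply: eq_bigr => j _; rewrite mulnA -expnD -modnMml -[RHS]modnMml; congr ((_ * _) %% _).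
apply: expn_modP; rewrite modnDmr addnC -addnA subnK ?modnDr //; exact: ltnW.
Qed.

Lemma coprime_expn c : coprime (p ^ s).-1 (p ^ c).
Proof.
have := coprimePn (_ : 0 < p ^ s); rewrite coprime_pexpr // expn_gt0 (ltnW p_gt1).
by move=> /(_ isT); apply: coprimeXr.
Qed.

(* cnt j l is the number, among the dg j factors (1 + sum_i a_i u ^ i) ^ (p ^ j) of
   <n> ^ y, of those from which a term with i >= l is chosen.  The last clause says
   that the sum over a_l in F_q of the l-th part does not vanish. *)
Definition config m cnt :=
  [/\ forall j, j < L -> cnt j 0 = dg j,
      forall j l, j < L -> l <= m -> cnt j l.+1 <= cnt j l,
      forall j, j < L -> cnt j m.+1 = 0
    & forall l, 0 < l <= m -> level_sum cnt l.+1 < level_sum cnt l /\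
        (p ^ s).-1 %| level_sum cnt l - level_sum cnt l.+1].

Definition config_cost m cnt := \sum_(l < m) level_sum cnt l.+1.

Local Notation opt := (optimal p item_exp (@ordS s)).
Local Notation tower_cost := (total_price p item_exp (@ordS s)).
Local Notation needs := (need p (@ordS s)).
Local Notation prc := (price p item_exp (@ordS s)).

(* Divisibility by q - 1 of the sums sum_j p ^ j cnt j l and the identity
   p * p ^ rot (c + 1) j = p ^ rot c j + (q - 1) [j = c mod s] turn a
   configuration into a tower whose needs are the coloured counts. *)
Definition config_rows m cnt r c := level_rot cnt c (m.+1 - r) %/ (p ^ s).-1.

Let q1_gt0 : 0 < (p ^ s).-1.
Proof. by rewrite -subn1 subn_gt0 -(expn0 p) ltn_exp2l. Qed.

Section FromConfig.
Variables (m : nat) (cnt : nat -> nat -> nat).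
Hypothesis cfg : config m cnt.

Lemma config_le_dg j l : j < L -> l <= m.+1 -> cnt j l <= dg j.
Proof.
case: cfg => c0 cS _ _ ltj; elim: l => [|l IHl] lel; first by rewrite c0.
by apply: leq_trans (IHl (ltnW lel)); apply: cS.
Qed.

Lemma config_last l : level_sum cnt m.+1 = 0.
Proof. by case: cfg => _ _ cl _; apply: big1 => j _; rewrite cl ?muln0. Qed.

(** Level m + 1 is empty and consecutive differences are divisible, so divisibility descends from
    the top level. *)
Lemma config_dvd l : 0 < l <= m.+1 -> (p ^ s).-1 %| level_sum cnt l.
Proof.
case: cfg => _ _ _ cd; move=> /andP[l_gt0 lel]; rewrite -(subKn lel).
have : m.+1 - l < m.+1 by lia.
elim: (m.+1 - l) => [|k IHk] ltk; first by rewrite subn0 config_last.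
have [lt dv] := cd (m.+1 - k.+1) ltac:(lia).
have e : (m.+1 - k.+1).+1 = m.+1 - k by lia.
rewrite e in lt dv; rewrite -(subnK (ltnW lt)) dvdn_add //; apply: IHk; lia.
Qed.

Lemma config_dvd_rot c l : 0 < l <= m.+1 -> (p ^ s).-1 %| level_rot cnt c l.
Proof.
move=> /config_dvd; rewrite /dvdn -(level_rot_mod _ c) -/(dvdn _ _).
by rewrite Gauss_dvdr // coprime_expn.
Qed.

Lemma config_rowsE r c : r <= m -> config_rows m cnt r c * (p ^ s).-1 = level_rot cnt c (m.+1 - r).
Proof. by move=> ler; apply/divnK/config_dvd_rot; lia. Qed.

Lemma need_config_rows r c : r <= m ->
  p * config_rows m cnt r (ordS c) = config_rows m cnt r c + level_count cnt c (m.+1 - r).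
Proof.
move=> ler; apply/eqP; rewrite -(eqn_pmul2r q1_gt0) -mulnA config_rowsE //.
by rewrite level_rotS mulnDl config_rowsE // [level_count _ _ _ * _]mulnC.
Qed.

Lemma tower_config : tower p (@ordS s) m (config_rows m cnt).
Proof.
case: (cfg) => c0 cS cl cd; split=> [c|r ltr c|r ler c].
- rewrite /config_rows subn0 /level_rot big1 ?div0n // => j _.
  by rewrite cl ?muln0.
- rewrite -(ltn_pmul2r q1_gt0) !config_rowsE //; last exact: ltnW.
  have [l [el lel l_gt0]] : exists l, [/\ m.+1 - r = l.+1, l <= m & 0 < l].
    by exists (m - r); split; lia.
  rewrite el (_ : m.+1 - r.+1 = l); last lia.
  have [lt _] := cd l ltac:(lia).
  have /existsP[j0 ltj0] : [exists j : 'I_L, cnt j l.+1 < cnt j l].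
    apply: contraLR lt; rewrite negb_exists -leqNgt => /forallP ge.
    by apply: leq_sum => j _; rewrite leq_mul2l leqNgt ge orbT.
  rewrite /level_rot (bigD1 j0) //= [ltnRHS](bigD1 j0) //= -addSn leq_add //.
    by rewrite ltn_pmul2l // expn_gt0 ltnW.
  by apply: leq_sum => j _; rewrite leq_mul2l cS ?orbT.
- by rewrite need_config_rows // leq_addr.
Qed.

Lemma price_config_rows r : r <= m ->
  prc (config_rows m cnt r) <= level_sum cnt (m.+1 - r) ?= iff
    [forall c, forall (j : 'I_L | color j == c),
       cnt j (m.+1 - r) == cheap_digit c (needs (config_rows m cnt r) c) j].
Proof.
move=> ler; have eN c : needs (config_rows m cnt r) c = level_count cnt c (m.+1 - r).
  by rewrite /need need_config_rows // addKn.
rewrite /price (_ : level_sum _ _ = \sum_c \sum_(j < L | color j == c) p ^ j * cnt j (m.+1 - r)).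
  apply: leqif_sum => c _; rewrite eN.
  apply: (@cheapest_leq_digits c (fun j => cnt j (m.+1 - r))) => j ltj.
  by apply: config_le_dg => //; lia.
by rewrite /level_sum (partition_big (fun j : 'I_L => color j) predT).
Qed.

Lemma config_cost_rev : config_cost m cnt = \sum_(r < m) level_sum cnt (m.+1 - r.+1).
Proof.
rewrite /config_cost (reindex_inj rev_ord_inj) /=; apply: eq_bigr => r _.
by congr (level_sum _ _); have := ltn_ord r; lia.
Qed.

Lemma config_cost_ge : tower_cost m (config_rows m cnt) <= config_cost m cnt.
Proof.
rewrite config_cost_rev; apply: leq_sum => r _.
by have [] := @price_config_rows r.+1 (ltn_ord r).
Qed.

Lemma config_cost_opt_ge O : opt m O -> tower_cost m O <= config_cost m cnt.
Proof. by case=> _ /(_ _ tower_config) le; apply: leq_trans le config_cost_ge. Qed.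

Lemma config_of_optimal O : opt m O -> config_cost m cnt = tower_cost m O ->
  forall j r, j < L -> r < m ->
    cnt j (m.+1 - r.+1) = cheap_digit (color j) (needs (O r.+1) (color j)) j.
Proof.
move=> optO e.
have optC : opt m (config_rows m cnt).
  split=> [|X]; first exact: tower_config.
  by case: optO => _ h /h; apply: leq_trans; rewrite -e config_cost_ge.
have eq_rows := optimal_unique p_gt1 item_exp_mono item_exp_col item_exp_step
  (@ordS_inj s) optC optO.
have [_] := leqif_sum (fun (r : 'I_m) (_ : true) => price_config_rows (ltn_ord r)).
rewrite -config_cost_rev e (eq_bigr (fun r : 'I_m => prc (O r.+1))); last first.
  by move=> r _; apply: eq_price; apply: eq_rows.
rewrite eqxx => /esym/forallP all_rows j r ltj ltr.
have /forallP/(_ (color j))/forall_inP/(_ (Ordinal ltj) (eqxx _))/eqP /= -> :=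
  all_rows (Ordinal ltr).
by rewrite /need !eq_rows.
Qed.

End FromConfig.

(** An item of colour c costs p ^ c modulo q - 1. The price is thus congruent to the sum over the
    cycle of colours of p ^ (c + 1) B (c + 1) - p ^ c B c, which cancels because p ^ s is 1. *)
Lemma dvdn_price (B : 'I_s -> nat) : valid p (@ordS s) B -> (p ^ s).-1 %| prc B.
Proof.
move=> vB; set M := (p ^ s).-1.
have eq1 : prc B = \sum_c p ^ (c : 'I_s) * needs B c %[mod M].
  rewrite /price -modn_summ -[RHS]modn_summ; congr (_ %% _); apply: eq_bigr => c _.
  rewrite /cheapest -modn_summ (eq_bigr (fun=> p ^ c %% M)) => [|i _].
    by rewrite sum_nat_const card_ord modnMmr mulnC.
  by apply: expn_modP; rewrite -[in RHS](item_exp_color c i) /= modn_mod.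
have eq2 : \sum_(c < s) p ^ c * B c + \sum_(c < s) p ^ c * needs B c =
    \sum_(c < s) p ^ c * B c %[mod M].
  rewrite -big_split /= [in RHS](reindex_inj (@ordS_inj s)) /=.
  rewrite -modn_summ -[RHS]modn_summ; congr (_ %% _); apply: eq_bigr => c _.
  rewrite -mulnDr /need subnKC ?vB // mulnA -expnSr -modnMml -[RHS]modnMml.
  by congr ((_ * _) %% _); apply: expn_modP; rewrite modn_mod.
rewrite /dvdn eq1 -[X in _ == X](mod0n M).
by rewrite -(eqn_modDl (\sum_(c < s) p ^ c * B c)) eq2 addn0.
Qed.

Lemma price_le_supply m O r c : r < m -> tower_cost m O < p ^ L ->
  needs (O r.+1) c <= supply c L.
Proof.
move=> ltrm lt; rewrite leqNgt; apply/negP => ltN; move: lt; rewrite ltnNge => /negP; apply.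
have leL : L <= item_exp c (supply c L).
  rewrite leqNgt; apply/negP => ltL; have /andP[_] := item_expP c (supply c L).
  by rewrite ltnNge leq_supply.
apply: (@leq_trans (cheap c (needs (O r.+1) c))).
  rewrite /cheapest (bigD1 (Ordinal ltN)) //=.
  by apply: leq_trans (leq_addr _ _); rewrite leq_exp2l.
apply: (@leq_trans (prc (O r.+1))); first by rewrite /price (bigD1 c) //= leq_addr.
by rewrite /total_price (bigD1 (Ordinal ltrm)) //= leq_addr.
Qed.

(** The counts are the greedy ones of each row. They decrease in l by [optimal_nested], the level
    sums decrease strictly by [price_inj], and divisibility is [dvdn_price]. The bound p ^ L keeps
    every purchase within the first L digits. *)
Lemma optimal_config m O : opt m O -> tower_cost m O < p ^ L ->
  exists cnt, config m cnt /\ config_cost m cnt = tower_cost m O.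
Proof.
move=> optO lt_cost; have [[O0 Olt Ov] _] := optO.
pose cnt j l := if l == 0 then dg j
  else cheap_digit (color j) (needs (O (m.+1 - l)) (color j)) j.
have need0 c : needs (O 0) c = 0 by rewrite /need !O0 muln0.
have nested r c : r < m -> needs (O r) c <= needs (O r.+1) c.
  by apply: (optimal_nested p_gt1 item_exp_mono item_exp_col item_exp_step (@ordS_inj s)).
have sum_cnt l : 0 < l <= m.+1 -> level_sum cnt l = prc (O (m.+1 - l)).
  move=> /andP[l_gt0 lel]; rewrite /level_sum (partition_big (fun j : 'I_L => color j) predT) //=.
  apply: eq_bigr => c _; have leN : needs (O (m.+1 - l)) c <= supply c L.
    case e: (m.+1 - l) => [|r]; first by rewrite need0.
    by apply: (@price_le_supply m) => //; lia.
  rewrite -[in RHS](minn_idPl leN) cheapest_digits; apply: eq_bigr => j /eqP <-.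
  by rewrite /cnt -[l]prednK.
have row l : 0 < l <= m -> [/\ level_sum cnt l = prc (O (m - l).+1),
    level_sum cnt l.+1 = prc (O (m - l)) & m - l < m].
  by move=> /andP[l_gt0 lel]; split; rewrite ?sum_cnt; [congr (prc (O _)); lia|lia| |lia|lia].
exists cnt; split; last first.
  rewrite /config_cost /total_price [RHS](reindex_inj rev_ord_inj) /=.
  apply: eq_bigr => l _; have [->] := row l.+1 (ltn_ord l); rewrite //.
split=> [j ltj|j l ltj lel|j ltj|l lel].
- by rewrite /cnt eqxx.
- rewrite /cnt /=; case: (posnP l) => [->|l_gt0]; first exact: geq_minl.
  have lt : m - l < m by lia.
  have := nested (m - l) (color j) lt; rewrite subSS subSn // /cheap_digit.
  by case: l {lel lt} l_gt0 => //= l _; lia.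
- by rewrite /cnt /= subnn need0 /cheap_digit sub0n minn0.
have [-> -> lt] := row l lel; have v1 := Ov _ lt; have v0 := Ov _ (ltnW lt).
split; last by rewrite dvdn_sub // dvdn_price.
rewrite ltn_neqAle; apply/andP; split; last first.
  by apply: leq_sum => c _; apply: leq_cheapest; apply: nested.
apply/eqP => e; have := price_inj p_gt1 item_exp_mono item_exp_col item_exp_step
  (@ordS_inj s) v0 v1 e (Ordinal s_gt0).
by have := Olt _ lt (Ordinal s_gt0); lia.
Qed.

End Configurations.

End DigitItems.

Lemma leading_costs (p s L : nat) (d : nat -> nat) : 1 < p -> 0 < s ->
    (forall j, d j <= p.-1) ->
  exists f : nat -> nat, [/\ f 0 = 0, 0 < f 1, forall m, 2 * f m.+1 < f m + f m.+2
    & forall m, [/\ forall cnt, config p s L d m cnt -> f m <= config_cost p L m cnt,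
        f m < p ^ L -> exists2 cnt, config p s L d m cnt & config_cost p L m cnt = f m
      & forall cnt cnt', config p s L d m cnt -> config p s L d m cnt' ->
          config_cost p L m cnt = f m -> config_cost p L m cnt' = f m ->
        forall j r, j < L -> r < m -> cnt j (m - r) = cnt' j (m - r)]].
Proof.
(* Filling the digits from L on with p - 1 makes the supply infinite; configurations read only j < L
   and do not change. *)
move=> p_gt1 s_gt0 d_small; pose dg j := if j < L then d j else p.-1.
have dg_small j : dg j <= p.-1 by rewrite /dg; case: ifP.
have dg_gt0 j : L <= j -> 0 < dg j.
  by move=> leLj; rewrite /dg ifN -?leqNgt //; lia.
have cfgE m cnt : config p s L d m cnt -> config p s L dg m cnt.
  by case=> c0 cS cl cd; split=> // j ltj; rewrite /dg ltj c0.
have cfgE' m cnt : config p s L dg m cnt -> config p s L d m cnt.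
  by case=> c0 cS cl cd; split=> // j ltj; rewrite c0 // /dg ltj.
pose ex := item_exp p_gt1 s_gt0 dg_gt0.
have ex_mono := item_exp_mono p_gt1 s_gt0 dg_gt0.
have ex_col := @item_exp_col _ _ _ _ p_gt1 s_gt0 dg_gt0.
have ex_step := item_exp_step p_gt1 s_gt0 dg_small dg_gt0.
have [O optO] := choice (fun m => exists_optimal ex p_gt1 (@ordS s) m).
exists (fun m => total_price p ex (@ordS s) m (O m)); split=> [||m|m].
- by rewrite /total_price big_ord0.
- have [[O0 Olt Ov] _] := optO 1; rewrite /total_price big_ord1 lt0n; apply/eqP => e.
  have e0 : price p ex (@ordS s) (O 1 0) = price p ex (@ordS s) (O 1 1).
    by rewrite e; apply: big1 => c _; rewrite /need !O0 muln0 /cheapest big_ord0.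
  have := price_inj p_gt1 ex_mono ex_col ex_step (@ordS_inj s) (Ov 0 isT) (Ov 1 isT) e0.
  by move/(_ (Ordinal s_gt0)); have := Olt 0 isT (Ordinal s_gt0); lia.
- apply: (total_strictly_convex p_gt1 ex_mono ex_col ex_step (@ordS_inj s)) => //.
  by rewrite card_ord.
split=> [cnt /cfgE cfg|lt|cnt cnt' /cfgE cfg /cfgE cfg' e e' j r ltj ltr].
- exact: (config_cost_opt_ge cfg).
- have [cnt [cfg e]] := optimal_config dg_small (optO m) lt.
  by exists cnt => //; apply: cfgE'.
have := config_of_optimal dg_small cfg (optO m) e ltj ltr.
have := config_of_optimal dg_small cfg' (optO m) e' ltj ltr.
by rewrite subSS => -> ->.
Qed.

Import Order.TTheory GRing.Theory Num.Theory.
Import numFieldNormedType.Exports.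
Local Open Scope classical_set_scope.
Local Open Scope ring_scope.

(** * Expansion of power sums *)

(** Exponents left after successive binomial expansions, starting at n and closed by the default 0
    of [nth]. Nothing forces t to decrease: a rise produces a zero binomial in [chain_coef]. *)
Definition chain (p : nat) n (t : seq 'I_p) l := nth 0%N (n :: map val t) l.

Definition chain_coef p m n (t : seq 'I_p) :=
  (\prod_(l < m) 'C(chain n t l, chain n t l.+1))%N.

Lemma chain_expansion (K : comNzRingType) p m (x : nat -> K) n : (n < p)%N ->
  (\sum_(i < m.+1) x i) ^+ n = \sum_(t : m.-tuple 'I_p)
    (\prod_(l < m.+1) x l ^+ (chain n t l - chain n t l.+1)) *+ chain_coef m n t.
Proof.
elim: m x n => [|m IHm] x n ltnp.
  rewrite big_ord1 (big_pred1 [tuple]) => [|t]; last by rewrite /= [t]tuple0; apply/esym/eqP.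
  by rewrite big_ord1 /chain_coef big_ord0 /chain /= subn0.
rewrite big_ord_recl exprDn (big_ord_widen p (fun i => (x ord0 ^+ (n - i) *
  (\sum_(i < m.+1) x (lift ord0 i)) ^+ i) *+ 'C(n, i))) // big_mkcond /=.
rewrite (reindex (fun q : 'I_p * m.-tuple 'I_p => [tuple of q.1 :: q.2])) /=; last first.
  exists (fun t : m.+1.-tuple 'I_p => (thead t, [tuple of behead t])) => [[i t]|t] _ /=.
    by rewrite theadE; congr (_, _); apply: val_inj.
  by rewrite [in RHS](tuple_eta t).
rewrite -(pair_big predT predT (fun (i : 'I_p) (t : m.-tuple 'I_p) =>
  (\prod_(l < m.+2) x l ^+ (chain n (i :: t) l - chain n (i :: t) l.+1)) *+
     chain_coef m.+1 n (i :: t))) /=.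
apply: eq_bigr => i _; case: ltnP => [_|lt].
  rewrite (IHm (fun i => x i.+1)) // mulr_sumr -sumrMnl; apply: eq_bigr => t _.
  have -> : chain_coef m.+1 n (i :: t) = ('C(n, i) * chain_coef m i t)%N.
    by rewrite /chain_coef big_ord_recl.
  by rewrite [in RHS]big_ord_recl mulrnAr -mulrnA mulnC.
apply/esym/big1 => t _; rewrite /chain_coef big_ord_recl /= bin_small ?mul0n //.
Qed.

(** If q - 1 does not divide k, some g has g ^ k different from 1, and rescaling by g multiplies the
    sum by g ^ k. For k = 0 the convention 0 ^ 0 = 1 gives the value q = 0. *)
Lemma sum_expr_finField (F : finFieldType) p s k : prime p -> (0 < s)%N ->
    #|F| = (p ^ s)%N ->
  \sum_(b : F) b ^+ k = if (0 < k)%N && (#|F|.-1 %| k)%N then -1 else 0.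
Proof.
move=> p_pr s_gt0 cardF; have F_gt1 := finNzRing_gt1 F.
have unit_pow (b : F) : b != 0 -> b ^+ #|F|.-1 = 1.
  move=> b0; apply: (mulfI b0); rewrite -exprS prednK ?expf_card ?mulr1 //.
  exact: ltnW.
have card0 : #|F|%:R = 0 :> F.
  by rewrite cardF natrX (pcharf0 (card_finPcharP cardF p_pr)) expr0n gtn_eqF.
have sum1 : \sum_(b : F | b != 0) 1 = -1 :> F.
  have e : 1 + \sum_(b : F | b != 0) 1 = 0 :> F.
    by rewrite -[RHS]card0 -sum1_card natr_sum [RHS](bigD1 0).
  by apply/eqP; rewrite -subr_eq0 opprK addrC e.
case: posnP => [->|k_gt0] /=.
  by rewrite (eq_bigr (fun=> 1)) // -[RHS]card0 -sum1_card natr_sum.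
case: (boolP (_ %| _)%N) => [/dvdnP[c ek]|ndiv].
  rewrite (bigD1 0) //= expr0n eqn0Ngt k_gt0 add0r -sum1; apply: eq_bigr => b b0.
  by rewrite ek mulnC exprM unit_pow // expr1n.
have [g g0 gk] : exists2 g : F, g != 0 & g ^+ k != 1.
  apply: contrapT => none; set r := (k %% #|F|.-1)%N.
  have r_gt0 : (0 < r)%N by rewrite lt0n.
  have ltr : (r < #|F|.-1)%N by rewrite ltn_mod -ltnS prednK // ltnW.
  have size_pol : size ('X^r - 1 : {poly F}) = r.+1 by rewrite size_XnsubC.
  have := @max_poly_roots _ ('X^r - 1) (enum (predC1 (0 : F))).
  rewrite -size_poly_eq0 size_pol enum_uniq -cardE cardC1 => /(_ isT) h.
  suff /h/(_ isT) : all (root ('X^r - 1)) (enum (predC1 (0 : F))).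
    by rewrite ltnS leqNgt ltr.
  apply/allP => b; rewrite mem_enum inE => b0.
  rewrite /root !hornerE subr_eq0; apply/eqP.
  have -> : b ^+ r = b ^+ k.
    by rewrite [in RHS](divn_eq k #|F|.-1) exprD mulnC exprM unit_pow // expr1n mul1r.
  by apply/eqP/negPn/negP => bk; apply: none; exists b.
have : g ^+ k * (\sum_(b : F) b ^+ k) = \sum_(b : F) b ^+ k.
  rewrite mulr_sumr [RHS](reindex_inj (mulfI g0)); apply: eq_bigr => b _.
  by rewrite exprMn.
move/eqP; rewrite -subr_eq0 -{2}[\sum_b _]mul1r -mulrBl mulf_eq0 subr_eq0 (negPf gk).
by move/eqP.
Qed.

Lemma sum_expr_pchar (K : comNzRingType) (I : finType) (f : I -> K) n :
  ([pchar K].-nat n)%N -> (\sum_i f i) ^+ n = \sum_i f i ^+ n.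
Proof.
move=> nn; apply: (big_morph (fun x => x ^+ n)) => [x y|]; first exact: exprDn_pchar.
by rewrite expr0n; case: n nn.
Qed.

(** Summation by parts; it turns the degree in u of a monomial, where the l-th part has weight l,
    into [config_cost]. *)
Lemma abel_sum (g : nat -> nat) n : (forall l, (l < n)%N -> (g l.+2 <= g l.+1)%N) ->
  (\sum_(l < n) l.+1 * (g l.+1 - g l.+2) + n * g n.+1 = \sum_(l < n) g l.+1)%N.
Proof.
elim: n => [|n IHn] gS; first by rewrite !big_ord0.
rewrite !big_ord_recr /= -IHn => [|l ltl]; last by apply: gS; apply: ltnW.
have := gS n (ltnSn n); move: (g n.+2) (g n.+1) => x y /subnKC <-.
rewrite addKn; move: (y - x)%N (\sum_(l < n) _)%N => k S; rewrite mulnDr !mulSn. lia.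
Qed.

Section PowerSums.
Variables (F : finFieldType) (K : fieldType) (iota : {rmorphism F -> K}) (u : K).
Variables (p s : nat).
Hypotheses (p_pr : prime p) (s_gt0 : (0 < s)%N) (cardF : #|F| = (p ^ s)%N).
Variables (L : nat) (d : nat -> nat).
Hypothesis d_small : forall j, (d j <= p.-1)%N.
Variable m : nat.

Local Notation family := {ffun 'I_L -> m.-tuple 'I_p}.

Definition counts (nu : family) j l : nat :=
  if insub j is Some i then chain (d j) (nu i) l else 0%N.

Definition counts_coef (nu : family) := (\prod_(j < L) chain_coef m (d j) (nu j))%N.

Definition one_unit (a : {ffun 'I_m -> F}) := 1 + \sum_(i < m) iota (a i) * u ^+ i.+1.

Lemma pcharK : p \in [pchar K].
Proof. by rewrite (fmorph_pchar iota) (card_finPcharP cardF). Qed.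

Let ext (a : {ffun 'I_m -> F}) l := if insub l is Some i then a i else 0.
Let monom a j l := if l is l'.+1 then (iota (ext a l') * u ^+ l) ^+ (p ^ j)%N else 1.

Lemma one_unit_frobenius a j : one_unit a ^+ (p ^ j)%N = \sum_(l < m.+1) monom a j l.
Proof.
have nn : ([pchar K].-nat (p ^ j))%N by rewrite pnatX pnatE ?pcharK.
rewrite big_ord_recl /one_unit exprDn_pchar // expr1n sum_expr_pchar //.
by congr (_ + _); apply: eq_bigr => i _; rewrite /= /ext valK.
Qed.

(** The exponent with which the coefficient of u ^ l in the 1-unit enters the selected monomial. *)
Definition part_size (cnt : nat -> nat -> nat) l :=
  (\sum_(j < L) p ^ j * (cnt j l - cnt j l.+1))%N.

Lemma sum_over_units (nu : family) :
  \sum_a \prod_(j < L) ((\prod_(l < m.+1) monom a j l ^+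
    (chain (d j) (nu j) l - chain (d j) (nu j) l.+1)) *+ chain_coef m (d j) (nu j)) =
  (\prod_(l < m) (u ^+ (l.+1 * part_size (counts nu) l.+1) *
    iota (\sum_b b ^+ part_size (counts nu) l.+1))) *+ counts_coef nu.
Proof.
pose k l := part_size (counts nu) l.
have eqa a : \prod_(j < L) ((\prod_(l < m.+1) monom a j l ^+
    (chain (d j) (nu j) l - chain (d j) (nu j) l.+1)) *+ chain_coef m (d j) (nu j)) =
    (\prod_(l < m) (iota (a l) * u ^+ l.+1) ^+ k l.+1) *+ counts_coef nu.
  rewrite prodrMn; congr (_ *+ _); rewrite exchange_big big_ord_recl /= big1 ?mul1r.
    apply: eq_bigr => l _; rewrite /k /part_size expr_sum; apply: eq_bigr => j _.
    by rewrite /ext valK exprM /counts valK.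
  by move=> j _; rewrite expr1n.
rewrite (eq_bigr _ (fun a _ => eqa a)) sumrMnl; congr (_ *+ _).
rewrite -(bigA_distr_bigA (fun (l : 'I_m) b => (iota b * u ^+ l.+1) ^+ k l.+1)).
apply: eq_bigr => l _; rewrite rmorph_sum mulr_sumr; apply: eq_bigr => b _.
by rewrite exprMn mulrC rmorphXn exprM.
Qed.

Lemma part_size_config nu : counts_coef nu != 0%N ->
  [/\ forall j, (j < L)%N -> counts nu j 0 = d j,
      forall j l, (j < L)%N -> (l <= m)%N -> (counts nu j l.+1 <= counts nu j l)%N
    & forall j, (j < L)%N -> counts nu j m.+1 = 0%N].
Proof.
move=> coef_neq0; split=> [j ltj|j l ltj lel|j ltj]; rewrite /counts insubT //=.
  move: lel; rewrite leq_eqVlt => /predU1P[->|ltl].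
    by rewrite /chain /= nth_default // size_map size_tuple.
  rewrite leqNgt; apply/negP => lt; case/negP: coef_neq0.
  rewrite /counts_coef (bigD1 (Ordinal ltj)) //= /chain_coef (bigD1 (Ordinal ltl)) //=.
  by rewrite bin_small ?mul0n.
by rewrite /chain /= nth_default // size_map size_tuple.
Qed.

Lemma part_sizeE cnt l : (forall j, (j < L)%N -> (cnt j l.+1 <= cnt j l)%N) ->
  (level_sum p L cnt l.+1 <= level_sum p L cnt l)%N /\
  part_size cnt l = (level_sum p L cnt l - level_sum p L cnt l.+1)%N.
Proof.
move=> mono; have e : (part_size cnt l + level_sum p L cnt l.+1 = level_sum p L cnt l)%N.
  rewrite /part_size /level_sum -big_split /=; apply: eq_bigr => j _.
  by rewrite -mulnDr subnK // mono.
by rewrite -e addnK leq_addl.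
Qed.

(** The sum over a factors into m power sums over F, each -1 or 0. A family that is not a
    configuration has a zero binomial or a zero power sum; the others contribute the sign (-1) ^
    m. *)
Lemma power_sum_expansion : \sum_a one_unit a ^+ (\sum_(j < L) d j * p ^ j) =
  \sum_(nu : family | `[< config p s L d m (counts nu) >])
    ((-1) ^+ m * u ^+ config_cost p L m (counts nu)) *+ counts_coef nu.
Proof.
have eqa a : one_unit a ^+ (\sum_(j < L) d j * p ^ j) = \sum_(nu : family)
    \prod_(j < L) ((\prod_(l < m.+1) monom a j l ^+
      (chain (d j) (nu j) l - chain (d j) (nu j) l.+1)) *+ chain_coef m (d j) (nu j)).
  rewrite expr_sum -(bigA_distr_bigA (fun (j : 'I_L) (t : m.-tuple 'I_p) =>
    (\prod_(l < m.+1) monom a j l ^+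
      (chain (d j) t l - chain (d j) t l.+1)) *+ chain_coef m (d j) t)).
  apply: eq_bigr => j _; rewrite mulnC exprM one_unit_frobenius; apply: chain_expansion.
  by rewrite (leq_ltn_trans (d_small j)) // ltn_predL prime_gt0.
rewrite (eq_bigr _ (fun a _ => eqa a)) exchange_big [RHS]big_mkcond.
apply: eq_bigr => nu _; rewrite sum_over_units.
have [->|coef_neq0] := eqVneq (counts_coef nu) 0%N; first by rewrite !mulr0n if_same.
have [c0 cS cl] := part_size_config coef_neq0.
have sizeE l : (l < m)%N -> _ :=
    fun ltl => @part_sizeE (counts nu) l.+1 (fun j ltj => cS j l.+1 ltj ltl).
case: asboolP => [cfg|ncfg].
  congr (_ *+ _); rewrite big_split /= mulrC; congr (_ * _).
    rewrite -[in RHS](card_ord m) -prodr_const; apply: eq_bigr => l _.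
    case: cfg => _ _ _ /(_ l.+1 (ltn_ord l)) [lt dv].
    rewrite (sum_expr_finField _ p_pr s_gt0 cardF) cardF (sizeE _ (ltn_ord l)).2 dv.
    by rewrite subn_gt0 lt rmorphN1.
  rewrite prodrXr; congr (_ ^+ _); rewrite /config_cost -abel_sum.
    have -> : level_sum p L (counts nu) m.+1 = 0%N.
      by apply: big1 => j _; rewrite cl ?muln0.
    by rewrite muln0 addn0; apply: eq_bigr => l _; rewrite (sizeE _ (ltn_ord l)).2.
  by move=> l ltl; have [] := sizeE l ltl.
have [l bad] : exists l : 'I_m, ~~ ((0 < part_size (counts nu) l.+1)%N &&
    (#|F|.-1 %| part_size (counts nu) l.+1)%N).
  apply/existsP; rewrite -negb_forall; apply/negP => /forallP good; apply: ncfg.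
  split=> // -[//|l] /andP[_ ltl]; have [_ e] := sizeE l ltl.
  by have := good (Ordinal ltl); rewrite /= e cardF subn_gt0 => /andP.
rewrite (bigD1 l) //= (sum_expr_finField _ p_pr s_gt0 cardF) (negPf bad).
by rewrite rmorph0 mulr0 mul0r mul0rn.
Qed.

End PowerSums.

(** * Non-archimedean absolute values *)

Section NonArchimedean.
Variables (R : realType) (K : fieldType) (N : K -> R).
Hypothesis absN : nonarch_abs N.

Lemma abs_ge0 x : 0 <= N x. Proof. by case: absN. Qed.
Lemma abs_eq0 x : (N x == 0) = (x == 0).
Proof. by case: absN => _ h _ _; apply/eqP/eqP => /h. Qed.
Lemma abs0 : N 0 = 0. Proof. by apply/eqP; rewrite abs_eq0. Qed.
Lemma abs_gt0 x : (0 < N x) = (x != 0).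
Proof. by rewrite lt_def abs_ge0 abs_eq0 andbT. Qed.
Lemma absM x y : N (x * y) = N x * N y. Proof. by case: absN. Qed.
Lemma absD x y : N (x + y) <= Num.max (N x) (N y). Proof. by case: absN. Qed.

Lemma abs1 : N 1 = 1.
Proof.
have h : N 1 != 0 by rewrite abs_eq0 oner_neq0.
by apply: (mulfI h); rewrite -absM !mulr1.
Qed.

Lemma absX x n : N (x ^+ n) = N x ^+ n.
Proof. by elim: n => [|n IHn]; rewrite ?abs1 // !exprS absM IHn. Qed.

Lemma absN1 : N (-1) = 1.
Proof. by apply/eqP; rewrite -sqrp_eq1 ?abs_ge0 // -absX sqrrN expr1n abs1. Qed.

Lemma absNN x : N (- x) = N x. Proof. by rewrite -mulN1r absM absN1 mul1r. Qed.

Lemma absV x : N x^-1 = (N x)^-1.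
Proof.
have [->|x0] := eqVneq x 0; first by rewrite invr0 abs0 invr0.
have h : N x != 0 by rewrite abs_eq0.
by apply: (mulfI h); rewrite -absM divff // abs1 divff.
Qed.

Lemma absB x y : N (x - y) = N (y - x). Proof. by rewrite -absNN opprB. Qed.

Lemma absD_le x y e : N x <= e -> N y <= e -> N (x + y) <= e.
Proof. by move=> hx hy; apply: le_trans (absD x y) _; rewrite ge_max hx hy. Qed.

Lemma absD_lt x y e : N x < e -> N y < e -> N (x + y) < e.
Proof. by move=> hx hy; apply: le_lt_trans (absD x y) _; rewrite gt_max hx hy. Qed.

Lemma absB_le x y e : N x <= e -> N y <= e -> N (x - y) <= e.
Proof. by move=> hx hy; apply: absD_le; rewrite ?absNN. Qed.

Lemma absB_lt x y e : N x < e -> N y < e -> N (x - y) < e.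
Proof. by move=> hx hy; apply: absD_lt; rewrite ?absNN. Qed.

Lemma absD_dominant x y : N y < N x -> N (x + y) = N x.
Proof.
move=> ltyx; apply/eqP; rewrite eq_le absD_le ?(ltW ltyx) //= leNgt; apply/negP => lt.
by have := absB_lt lt ltyx; rewrite addrK ltxx.
Qed.

Lemma abs_eq_of_close x y : N (x - y) < N x -> N y = N x.
Proof. by rewrite absB => /absD_dominant; rewrite addrC subrK. Qed.

Lemma abs_sum_le (I : Type) (r : seq I) (P : pred I) (f : I -> K) e : 0 <= e ->
  (forall i, P i -> N (f i) <= e) -> N (\sum_(i <- r | P i) f i) <= e.
Proof.
move=> e0 h; elim/big_rec: _ => [|i x Pi hx]; first by rewrite abs0.
by apply: absD_le; first exact: h.
Qed.

Lemma abs_nat n : N n%:R <= 1.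
Proof.
elim: n => [|n IHn]; first by rewrite abs0 ler01.
by rewrite mulrSr; apply: absD_le; rewrite ?abs1.
Qed.

Lemma abs_mulrn x n : N (x *+ n) <= N x.
Proof. by rewrite -mulr_natr absM ler_piMr ?abs_ge0 ?abs_nat. Qed.

Lemma abs_subX x y e n : N x <= 1 -> N y <= 1 -> N (x - y) <= e -> N (x ^+ n - y ^+ n) <= e.
Proof.
move=> x1 y1 xye; rewrite subrXX absM; apply: le_trans xye.
rewrite ler_piMr ?abs_ge0 // abs_sum_le // => i _.
by rewrite absM !absX mulr_ile1 ?exprn_ge0 ?abs_ge0 ?exprn_ile1 ?abs_ge0.
Qed.

Definition converges (t : nat -> K) l :=
  forall e, 0 < e -> exists n0, forall n, (n0 <= n)%N -> N (t n - l) < e.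

Lemma cvg_absP t l : cvg_abs N t l <-> converges t l.
Proof.
rewrite /cvg_abs; split=> [/cvgrPdist_lt h e /h|h].
  case=> n0 _ hn; exists n0 => n /hn /=.
  by rewrite sub0r normrN ger0_norm ?abs_ge0.
apply/cvgrPdist_lt => e /h[n0 hn]; exists n0 => // n /hn.
by rewrite /= sub0r normrN ger0_norm ?abs_ge0.
Qed.

Lemma cauchy_absP t : (forall e, 0 < e -> exists n0, forall m n,
  (n0 <= m)%N -> (n0 <= n)%N -> N (t m - t n) < e) -> cauchy_abs N t.
Proof.
move=> h e /h[n0 hn].
exists ([set m | (n0 <= m)%N], [set m | (n0 <= m)%N]); first by split; exists n0.
by move=> [m n] /= [hm hnn]; apply: hn.
Qed.

Lemma converges_unique t l l' : converges t l -> converges t l' -> l = l'.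
Proof.
move=> h h'; apply/eqP; rewrite -subr_eq0 -abs_eq0 eq_le abs_ge0 andbT leNgt.
apply/negP => e0; have [n hn] := h _ e0; have [n' hn'] := h' _ e0.
have := absB_lt (hn' _ (leq_maxr n n')) (hn _ (leq_maxl n n')).
by rewrite opprB addrC addrA subrK ltxx.
Qed.

Lemma lim_absE t l : converges t l -> lim_abs N t = l.
Proof.
move=> h; apply: (@converges_unique t) => //; apply/cvg_absP.
by rewrite /lim_abs; apply: (@xgetPex _ 0 [set l | cvg_abs N t l]); exists l; apply/cvg_absP.
Qed.

Lemma converges_le t l y e n0 : converges t l ->
  (forall n, (n0 <= n)%N -> N (t n - y) <= e) -> N (l - y) <= e.
Proof.
move=> h le_e; rewrite leNgt; apply/negP => lt.
have e0 : 0 <= e by apply: le_trans (abs_ge0 _) (le_e n0 (leqnn _)).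
have [n1 hn] := h _ (le_lt_trans e0 lt).
have := le_lt_trans (le_e _ (leq_maxl n0 n1)) lt; have := hn _ (leq_maxr n0 n1).
move=> h1 h2; have := absB_lt h2 h1; by rewrite opprB addrC addrA subrK ltxx.
Qed.

Hypothesis completeN : complete_abs N.

(** Ultrametrically a tail is bounded by its largest term, which gives both the Cauchy property and
    the error bound. *)
Lemma series_converges (t : nat -> K) : converges t 0 ->
  exists2 l, converges (fun n => \sum_(i < n) t i) l
    & forall M e, (forall n, (M <= n)%N -> N (t n) <= e) -> N (l - \sum_(i < M) t i) <= e.
Proof.
move=> t0; have tail M e n : (forall n, (M <= n)%N -> N (t n) <= e) -> (M <= n)%N ->
    N (\sum_(i < n) t i - \sum_(i < M) t i) <= e.
  move=> le_e leMn; rewrite -(subnKC leMn) big_split_ord /= [X in N X]addrC addKr.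
  apply: abs_sum_le => [|i _]; last by apply: le_e; rewrite leq_addr.
  exact: le_trans (abs_ge0 _) (le_e M (leqnn _)).
have [|l hl] := completeN (u := fun n => \sum_(i < n) t i).
  apply: cauchy_absP => e e0; have e20 : 0 < e / 2 by rewrite divr_gt0.
  have [n0 hn] := t0 _ e20; exists n0 => m n hm hnn.
  have le_e k : (n0 <= k)%N -> N (t k) <= e / 2.
    by move=> /hn; rewrite subr0 => /ltW.
  have lt_e : e / 2 < e by lra.
  have := absB_lt (le_lt_trans (tail _ _ _ le_e hm) lt_e) (le_lt_trans (tail _ _ _ le_e hnn) lt_e).
  by rewrite opprB addrA subrK.
move/cvg_absP in hl; exists l => // M e le_e.
by apply: (converges_le (n0 := M) hl) => n; apply: tail.
Qed.

End NonArchimedean.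

Lemma config_ext p s L d m cnt cnt' : config p s L d m cnt ->
    (forall j l, (j < L)%N -> (l <= m.+1)%N -> cnt j l = cnt' j l) ->
  config p s L d m cnt' /\ config_cost p L m cnt = config_cost p L m cnt'.
Proof.
move=> [c0 cS cl cd] e.
have es l : (l <= m.+1)%N -> level_sum p L cnt l = level_sum p L cnt' l.
  by move=> lel; apply: eq_bigr => j _; rewrite e.
split; last by apply: eq_bigr => l _; rewrite es // ltnW // ltnS.
split=> [j ltj|j l ltj lel|j ltj|l lel].
- by rewrite -e // c0.
- by rewrite -!e //; [apply: cS | apply: leqW].
- by rewrite -e // cl.
- by rewrite -!es //; [apply: cd | lia | lia].
Qed.

Section PowerSumNorm.
Variables (R : realType) (F : finFieldType) (K : fieldType) (N : K -> R).
Variables (iota : {rmorphism F -> K}) (u : K) (p s : nat).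
Hypotheses (p_pr : prime p) (s_gt0 : (0 < s)%N) (cardF : #|F| = (p ^ s)%N).
Hypotheses (absN : nonarch_abs N) (u_neq0 : u != 0) (u_lt1 : N u < 1).

(** Frobenius fixes n, so n ^ p = n in K and N n raised to p - 1 is 1. *)
Lemma abs_nat_unit n : ~~ (p %| n)%N -> N n%:R = 1.
Proof.
have pK := pcharK iota p_pr cardF; move=> ndvd.
have n_neq0 : n%:R != 0 :> K by rewrite -(dvdn_pcharf pK).
have := congr1 N (pFrobenius_aut_nat pK n); rewrite pFrobenius_autE (absX absN).
rewrite -[in X in X = _](prednK (prime_gt0 p_pr)) exprS -[RHS]mulr1 => /mulfI.
rewrite (abs_eq0 absN) n_neq0 => /(_ isT)/eqP.
by rewrite pexpr_eq1 ?(abs_ge0 absN) //; [move/eqP | have := prime_gt1 p_pr; lia].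
Qed.

Lemma ndvd_bin a b : (b <= a)%N -> (a < p)%N -> ~~ (p %| 'C(a, b))%N.
Proof.
move=> leba ltap; have ndvd_fact n : (n < p)%N -> ~~ (p %| n`!)%N.
  elim: n => [|n IHn] ltn; first by rewrite Euclid_dvd1.
  by rewrite factS Euclid_dvdM // negb_or IHn 1?ltnW // gtnNdvd.
apply: contra (ndvd_fact a ltap) => dv.
by rewrite -(bin_fact leba) dvdn_mulr.
Qed.

Variables (L : nat) (d : nat -> nat).
Hypothesis d_small : forall j, (d j <= p.-1)%N.

Definition digit_sum m :=
  \sum_(a : {ffun 'I_m -> F}) one_unit iota u a ^+ (\sum_(j < L) d j * p ^ j).

Lemma counts_coef_ndvd m (nu : {ffun 'I_L -> m.-tuple 'I_p}) :
  config p s L d m (counts d nu) -> ~~ (p %| counts_coef d nu)%N.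
Proof.
case=> c0 cS _ _; have countsE (j : 'I_L) l : counts d nu j l = chain (d j) (nu j) l.
  by rewrite /counts valK.
have ltp (j : 'I_L) l : (l <= m)%N -> (chain (d j) (nu j) l < p)%N.
  move=> lel; rewrite -countsE; apply: (@leq_ltn_trans (d j)).
    elim: l lel => [|l IHl] lel; first by rewrite c0.
    by apply: leq_trans (IHl (ltnW lel)); apply: cS => //; apply: ltnW.
  by rewrite (leq_ltn_trans (d_small j)) // ltn_predL prime_gt0.
rewrite /counts_coef Euclid_dvd_prod // big_orE; apply/existsPn => j /=.
rewrite /chain_coef Euclid_dvd_prod // big_orE; apply/existsPn => l /=.
by apply: ndvd_bin; rewrite ?ltp ?(ltnW (ltn_ord l)) // -!countsE cS // ltnW.
Qed.

(** Exactly one family reaches the cost f m, and its coefficient has absolute value 1; every other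
    term is smaller by at least a factor N u. *)
Lemma abs_digit_sum (f : nat -> nat) m :
    [/\ forall cnt, config p s L d m cnt -> (f m <= config_cost p L m cnt)%N,
        (f m < p ^ L)%N -> exists2 cnt, config p s L d m cnt & config_cost p L m cnt = f m
      & forall cnt cnt', config p s L d m cnt -> config p s L d m cnt' ->
          config_cost p L m cnt = f m -> config_cost p L m cnt' = f m ->
        forall j r, (j < L)%N -> (r < m)%N -> cnt j (m - r)%N = cnt' j (m - r)%N] ->
  N (digit_sum m) <= N u ^+ f m /\
  ((f m < p ^ L)%N -> N (digit_sum m) = N u ^+ f m).
Proof.
move=> [low exist uniq]; rewrite /digit_sum (power_sum_expansion _ _ p_pr s_gt0 cardF) //.
have u_gt0 : 0 < N u by rewrite (abs_gt0 absN).
have le_u a b : (a <= b)%N -> N u ^+ b <= N u ^+ a.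
  by move=> ?; apply: ler_wiXn2l; rewrite ?ltW.
pose term (nu : {ffun 'I_L -> m.-tuple 'I_p}) :=
  ((-1) ^+ m * u ^+ config_cost p L m (counts d nu)) *+ counts_coef d nu.
have termE nu : N (term nu) =
    N u ^+ config_cost p L m (counts d nu) * N (counts_coef d nu)%:R.
  by rewrite /term -mulr_natr !(absM absN) !(absX absN) (absN1 absN) expr1n mul1r.
have term_le nu : N (term nu) <= N u ^+ config_cost p L m (counts d nu).
  by rewrite termE ler_piMr ?abs_nat // exprn_ge0 // ltW.
split.
  apply: abs_sum_le => // [|nu /asboolP cfg]; first by rewrite exprn_ge0 // ltW.
  by apply: le_trans (term_le nu) (le_u _ _ (low _ cfg)).
move=> ltfL; have [cnt cfg ecost] := exist ltfL.
have p_gt0 := prime_gt0 p_pr.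
pose nu0 : {ffun 'I_L -> m.-tuple 'I_p} :=
  [ffun j : 'I_L => [tuple insubd (Ordinal p_gt0) (cnt j l.+1) | l < m]].
have cnt0 j l : (j < L)%N -> (l <= m.+1)%N -> cnt j l = counts d nu0 j l.
  move=> ltj; case: cfg => c0 cS cl _; rewrite /counts insubT /chain /=.
  case: l => [_|l]; first by rewrite c0.
  rewrite ltnS leq_eqVlt => /predU1P[->|ltl].
    by rewrite cl // nth_default //= size_map size_tuple.
  rewrite /= (nth_map (Ordinal p_gt0)) ?size_tuple // ffunE.
  rewrite -[l in RHS]/(val (Ordinal ltl)) -tnth_nth tnth_mktuple /= val_insubd ifT //.
  apply: (@leq_ltn_trans (d j)).
    elim: l ltl => [|l IHl] lel; first by rewrite -c0 // cS.
    by apply: leq_trans (IHl (ltnW lel)); apply: cS => //; apply: ltnW.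
  by rewrite (leq_ltn_trans (d_small j)) // ltn_predL prime_gt0.
have [cfg0 e0] := config_ext cfg cnt0.
have cost0 : config_cost p L m (counts d nu0) = f m by rewrite -e0.
rewrite (bigD1 nu0) /=; last exact/asboolP.
have term0 : N (term nu0) = N u ^+ f m.
  by rewrite termE cost0 abs_nat_unit ?mulr1 // counts_coef_ndvd.
rewrite (absD_dominant absN); rewrite -/(term nu0) term0 //.
apply: (@le_lt_trans _ _ (N u ^+ (f m).+1)); last first.
  by rewrite exprS gtr_pMl // exprn_gt0.
apply: abs_sum_le => // [|nu /andP[/asboolP cfg' ne]]; first by rewrite exprn_ge0 // ltW.
apply: le_trans (term_le nu) (le_u _ _ _).
rewrite ltn_neqAle low // andbT; apply: contra ne => /eqP ecost'.
apply/eqP/ffunP => j; apply: eq_from_tnth => l; apply: val_inj.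
have := uniq _ _ cfg' cfg0 (esym ecost') cost0 j (m - l.+1)%N (ltn_ord j).
rewrite subKn ?ltn_ord //; have ltm : (m - l.+1 < m)%N by have := ltn_ord l; lia.
move/(_ ltm); rewrite /counts !valK /chain /= !(nth_map (Ordinal p_gt0)) ?size_tuple //.
by rewrite -!tnth_nth.
Qed.

End PowerSumNorm.

(** * Coefficients of the zeta function *)

Lemma geometric_small (R : realType) (k e : R) : 0 <= k -> k < 1 -> 0 < e ->
  exists n0, forall n, (n0 <= n)%N -> k ^+ n < e.
Proof.
move=> k0 k1 e0; have := @cvg_expr R k; rewrite ger0_norm // => /(_ k1).
move/cvgrPdist_lt => /(_ e e0)[n0 _ hn]; exists n0 => n /hn /=.
by rewrite sub0r normrN ger0_norm // exprn_ge0.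
Qed.

Section PadicDigits.
Variables (p : nat) (y : padic_int p).
Hypothesis p_gt0 : (0 < p)%N.

Lemma zp_lt k : (y k < p ^ k)%N.
Proof. by rewrite -(zp_compat y k) ltn_mod expn_gt0 p_gt0. Qed.

Lemma zp_mod k k' : (k <= k')%N -> (y k' %% p ^ k = y k)%N.
Proof.
move=> /subnKC <-; elim: (k' - k)%N => [|n IHn]; first by rewrite addn0 modn_small ?zp_lt.
have := zp_compat y (k + n); rewrite addnS -IHn => <-.
by rewrite modn_dvdm // dvdn_exp2l // leq_addr.
Qed.

Definition zp_digit j := (y j.+1 %/ p ^ j)%N.

Lemma zp_digit_le j : (zp_digit j <= p.-1)%N.
Proof.
rewrite -ltnS prednK // /zp_digit ltn_divLR ?expn_gt0 ?p_gt0 //.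
by rewrite -expnS zp_lt.
Qed.

Lemma zp_digits k : (y k = \sum_(j < k) zp_digit j * p ^ j)%N.
Proof.
elim: k => [|k IHk]; first by have := zp_lt 0; rewrite big_ord0; case: (y 0).
by rewrite big_ord_recr /= -IHk [LHS](divn_eq _ (p ^ k)) zp_compat addnC.
Qed.

End PadicDigits.

Section GossCoefficients.
Variables (R : realType) (p s : nat) (F : finFieldType) (Om : fieldType).
Variables (N : Om -> R) (phi : {rmorphism {poly F} -> Om}).
Hypotheses (p_pr : prime p) (s_gt0 : (0 < s)%N) (cardF : #|F| = (p ^ s)%N).
Hypotheses (absN : nonarch_abs N) (completeN : complete_abs N).
Hypothesis absphi : forall n : {poly F}, n != 0 -> N (phi n) = #|F|%:R ^+ (size n).-1.

Local Notation T := (phi 'X).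
Local Notation u := (phi 'X)^-1.
Local Notation iota := (phi \o polyC : {rmorphism F -> Om}).

Lemma abs_T : N T = #|F|%:R.
Proof. by rewrite absphi ?polyX_eq0 // size_polyX. Qed.

Lemma card_gt1 : 1 < #|F|%:R :> R.
Proof. by rewrite ltr1n finNzRing_gt1. Qed.

Lemma T_neq0 : T != 0.
Proof. by rewrite -(abs_gt0 absN) abs_T (lt_trans ltr01 card_gt1). Qed.

Lemma u_neq0 : u != 0. Proof. by rewrite invr_eq0 T_neq0. Qed.

Lemma abs_u_gt0 : 0 < N u. Proof. by rewrite (abs_gt0 absN) u_neq0. Qed.

Lemma abs_u_lt1 : N u < 1.
Proof. by rewrite (absV absN) abs_T invf_lt1 ?card_gt1 // (lt_trans ltr01 card_gt1). Qed.

Lemma abs_iota b : N (iota b) <= 1.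
Proof.
have [->|b0] := eqVneq b 0; first by rewrite rmorph0 (abs0 absN) ler01.
by rewrite /= absphi ?polyC_eq0 // size_polyC b0 /= expr0.
Qed.

Lemma one_unitE m (a : {ffun 'I_m -> F}) : exists2 v, one_unit iota u a = 1 + v & N v <= N u.
Proof.
exists (\sum_(i < m) iota (a i) * u ^+ i.+1) => //.
apply: (abs_sum_le absN) => [|i _]; first exact: abs_ge0.
rewrite (absM absN) (absX absN) exprS mulrCA ler_piMr ?(abs_ge0 absN) //.
rewrite mulr_ile1 ?exprn_ge0 ?(abs_ge0 absN) ?abs_iota //.
by rewrite exprn_ile1 ?(abs_ge0 absN) // ltW ?abs_u_lt1.
Qed.

(** Passing from y k to a later residue multiplies by a power of (1 + v) ^ (p ^ k) = 1 + v ^ (p ^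
    k), which is within N u ^ (p ^ k) of 1. *)
Lemma abs_zp_pow m (a : {ffun 'I_m -> F}) (y : padic_int p) k :
  N (zp_pow N (one_unit iota u a) y - one_unit iota u a ^+ y k) <= N u ^+ (p ^ k)%N.
Proof.
have [v -> v_le] := one_unitE a; have pK := pcharK iota p_pr cardF.
have k_ge0 : 0 <= N u := abs_ge0 absN _.
have u_le1 : N u <= 1 := ltW abs_u_lt1.
have v1 : N (1 + v) <= 1.
  by apply: (absD_le absN); rewrite ?(abs1 absN) ?(le_trans v_le).
have step n n' : (n <= n')%N -> N ((1 + v) ^+ y n' - (1 + v) ^+ y n) <= N u ^+ (p ^ n)%N.
  move=> len; rewrite [y n'](divn_eq _ (p ^ n)) (zp_mod y (prime_gt0 p_pr) len) addnC.
  rewrite exprD -{2}[(1 + v) ^+ y n]mulr1 -mulrBr (absM absN) mulnC exprM.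
  apply: le_trans (_ : N (((1 + v) ^+ (p ^ n)) ^+ (y n' %/ p ^ n) - 1 ^+ (y n' %/ p ^ n)) <= _).
    by rewrite expr1n ler_piMl ?(abs_ge0 absN) // (absX absN) exprn_ile1 ?(abs_ge0 absN).
  apply: (abs_subX absN); rewrite ?(abs1 absN) ?(absX absN) ?exprn_ile1 ?(abs_ge0 absN) //.
  rewrite exprDn_pchar ?pnatX ?pnatE ?pK // expr1n addrC addKr (absX absN).
  by rewrite lerXn2r ?nnegrE ?(abs_ge0 absN).
have [l hl] : exists l, converges N (fun n => (1 + v) ^+ y n) l.
  have [|l /(cvg_absP absN)] := completeN (u := fun n => (1 + v) ^+ y n); last by exists l.
  apply: cauchy_absP => e e0.
  have [n0 hn] := geometric_small k_ge0 abs_u_lt1 e0; exists n0 => m1 n1 h1 h2.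
  have lt_e : N u ^+ (p ^ n0)%N < e by apply: hn; rewrite ltnW // ltn_expl // prime_gt1.
  have := absB_lt absN (le_lt_trans (step _ _ h1) lt_e) (le_lt_trans (step _ _ h2) lt_e).
  by rewrite opprB addrA subrK.
rewrite /zp_pow (lim_absE absN hl); apply: (converges_le absN (n0 := k) hl) => n; exact: step.
Qed.

Lemma sum_monic (f : Om -> Om) m :
  \sum_(n : {poly_m.+1 F} | (size n == m.+1) && (val n \is monic)) f (one_unit_part phi n) =
  \sum_(a : {ffun 'I_m -> F}) f (one_unit iota u a).
Proof.
pose low (a : {ffun 'I_m -> F}) : {poly F} := \sum_(i < m) a i *: 'X^(m - i.+1).
have size_low a : (size (low a) <= m)%N.
  apply: (leq_trans (size_sum _ _ _)); apply/bigmax_leqP => i _.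
  by apply: leq_trans (size_scale_leq _ _) _; rewrite size_polyXn; have := ltn_ord i; lia.
have size_full a : size ('X^m + low a) = m.+1.
  by rewrite size_polyDl size_polyXn // ltnS size_low.
have monic_full a : 'X^m + low a \is monic.
  by rewrite monicE lead_coefDl ?lead_coefXn // size_polyXn ltnS size_low.
pose h a : {poly_m.+1 F} := npolyp m.+1 ('X^m + low a).
have hE a : h a = 'X^m + low a :> {poly F} by rewrite npolypK // size_full.
pose h' (n : {poly_m.+1 F}) : {ffun 'I_m -> F} := [ffun i : 'I_m => n`_(m - i.+1)].
rewrite (reindex_onto h h') => [|n /andP[/eqP sn mn]]; last first.
  apply: val_inj; rewrite /= hE /low [RHS](_ : _ = \poly_(i < m.+1) n`_i); last first.
    by rewrite -{1}[val n]coefK sn.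
  rewrite poly_def big_ord_recr /= addrC.
  have -> : n`_m = 1 by move/monicP: mn; rewrite lead_coefE sn.
  rewrite scale1r; congr (_ + _); rewrite [RHS](reindex_inj rev_ord_inj) /=.
  by apply: eq_bigr => i _; rewrite ffunE.
apply: eq_big => [a|a _].
  have := size_full a; have := monic_full a; rewrite -hE => -> ->.
  rewrite eqxx /=; apply/eqP/ffunP => i; rewrite ffunE hE.
  rewrite coefD coefXn coef_sum (bigD1 i) //= coefZ coefXn eqxx mulr1.
  rewrite big1 ?addr0 => [|i' ni']; last first.
    rewrite coefZ coefXn (_ : (_ == _)%N = false) ?mulr0 //.
    by rewrite -val_eqE /= in ni'; have := ltn_ord i; have := ltn_ord i'; lia.
  by rewrite (_ : (_ == m)%N = false) ?add0r //; have := ltn_ord i; lia.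
congr f; rewrite /one_unit_part hE size_full /= rmorphD rmorphXn mulrDl.
rewrite divff ?expf_neq0 ?T_neq0 //; congr (1 + _).
rewrite /low rmorph_sum mulr_suml; apply: eq_bigr => i _.
rewrite -mul_polyC rmorphM rmorphXn -mulrA; congr (_ * _).
rewrite -[in X in _ / X](subnK (ltn_ord i)) exprD invfM mulrA divff ?mul1r ?exprVn //.
by rewrite expf_neq0 ?T_neq0.
Qed.

Variable y : padic_int p.

Definition goss_coef m := \sum_(a : {ffun 'I_m -> F}) zp_pow N (one_unit iota u a) y.

Lemma goss_coef_approx m k :
  N (goss_coef m - digit_sum iota u p k (zp_digit y) m) <= N u ^+ (p ^ k)%N.
Proof.
rewrite /goss_coef /digit_sum -sumrB.
apply: (abs_sum_le absN) => [|a _]; first by rewrite exprn_ge0 ?(abs_ge0 absN).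
by rewrite -zp_digits ?prime_gt0 // abs_zp_pow.
Qed.

Lemma ler_u a b : (a <= b)%N -> N u ^+ b <= N u ^+ a.
Proof. by move=> le; apply: ler_wiXn2l => //; rewrite ?(abs_ge0 absN) // ltW ?abs_u_lt1. Qed.

Lemma ltr_u a b : (a < b)%N -> N u ^+ b < N u ^+ a.
Proof. by move=> lt; rewrite ltr_iXn2l ?abs_u_gt0 ?abs_u_lt1. Qed.

Definition strict_costs (f : nat -> nat) :=
  [/\ f 0 = 0, 0 < f 1 & forall m, 2 * f m.+1 < f m + f m.+2]%N.

Lemma strict_costsS f m : strict_costs f -> (f m + m < f m.+1)%N.
Proof. by case=> f0 f1 fS; elim: m => [|m IHm]; [lia | have := fS m; lia]. Qed.

Lemma strict_costs_le f m n : strict_costs f -> (m <= n)%N -> (f m <= f n)%N.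
Proof.
move=> cf /subnKC <-; elim: (n - m)%N => [|k IHk]; first by rewrite addn0.
by rewrite addnS; have := strict_costsS (m + k) cf; lia.
Qed.

(** The costs come from the first k digits of y and change with k; the two cases tell where they
    determine the coefficient and where they only bound it. *)
Lemma goss_coef_costs k : exists2 f, strict_costs f &
  forall m, ((f m < p ^ k)%N -> N (goss_coef m) = N u ^+ f m) /\
    ((p ^ k <= f m)%N -> N (goss_coef m) <= N u ^+ (p ^ k)%N).
Proof.
have p_gt0 := prime_gt0 p_pr; have dle := zp_digit_le y p_gt0.
have [f [f0 f1 fS fP]] := leading_costs k (prime_gt1 p_pr) s_gt0 dle.
exists f => // m; have := goss_coef_approx m k.
have [le eq] := abs_digit_sum iota p_pr s_gt0 cardF absN u_neq0 abs_u_lt1 dle (fP m).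
split=> lt.
  rewrite -(eq lt); apply: (abs_eq_of_close absN); rewrite (eq lt) (absB absN).
  exact: le_lt_trans (goss_coef_approx m k) (ltr_u lt).
rewrite -[goss_coef m](subrK (digit_sum iota u p k (zp_digit y) m)).
by apply: (absD_le absN) => //; apply: le_trans le (ler_u lt).
Qed.

(** A precision finer than the nonzero value at M makes the costs exact at M, hence below M since
    costs increase. Coefficients may vanish later, whence the restriction to m <= M. *)
Lemma goss_coef_abs M : goss_coef M != 0 -> exists2 f, strict_costs f &
  forall m, (m <= M)%N -> N (goss_coef m) = N u ^+ f m.
Proof.
rewrite -(abs_gt0 absN) => SM_gt0.
have [k hk] := geometric_small (abs_ge0 absN _) abs_u_lt1 SM_gt0.
have [f cf fP] := goss_coef_costs k; exists f => // m lemM.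
apply: (fP m).1; apply: leq_ltn_trans (strict_costs_le cf lemM) _.
rewrite ltnNge; apply/negP => /(fP M).2; rewrite leNgt hk //.
by rewrite ltnW // ltn_expl // prime_gt1.
Qed.

Lemma goss_coef0 : N (goss_coef 0) = 1.
Proof.
have [f [f0 f1 fS] fP] := goss_coef_costs 0.
by rewrite (fP 0%N).1 f0 ?expr0.
Qed.

(** Strict convexity over the integers makes the increments of the costs grow by at least one each
    time, so the costs grow quadratically. *)
Lemma goss_coef_le m : N (goss_coef m) <= N u ^+ 'C(m, 2).
Proof.
have [->|S_neq0] := eqVneq (goss_coef m) 0; first by rewrite (abs0 absN) exprn_ge0 ?(abs_ge0 absN).
have [f cf /(_ _ (leqnn m)) ->] := goss_coef_abs S_neq0.
apply: ler_u; elim: {S_neq0} m => [|m IHm]; first by rewrite bin0n.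
by rewrite binS bin1; have := strict_costsS m cf; lia.
Qed.

Lemma goss_terms_small (r : R) : 0 <= r ->
  forall e, 0 < e -> exists n0, forall m, (n0 <= m)%N -> N u ^+ 'C(m, 2) * r ^+ m < e.
Proof.
move=> r0 e e0; have u0 := abs_ge0 absN u; have r1 : 0 < r + 1 by rewrite ltr_wpDl.
have r2 : 0 < (2 * (r + 1))^-1 by rewrite invr_gt0 mulr_gt0.
have [k hk] := geometric_small u0 abs_u_lt1 r2.
pose b m := N u ^+ 'C(m, 2) * r ^+ m.
have b0 m : 0 <= b m by rewrite mulr_ge0 ?exprn_ge0.
(* The ratio of consecutive terms is N u ^ m * r; using r + 1 in the threshold avoids a division by
   zero when r = 0. *)
have bS m : (k <= m)%N -> b m.+1 <= b m * 2^-1.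
  move=> lekm; have -> : b m.+1 = b m * (N u ^+ m * r).
    by rewrite /b binS bin1 exprD exprS; ring.
  rewrite ler_wpM2l //; have hm := ltW (hk _ lekm).
  apply: le_trans (_ : (2 * (r + 1))^-1 * (r + 1) <= _); last by rewrite invfM mulfVK ?gt_eqF.
  by rewrite ler_pM ?exprn_ge0 // lerDl.
have bk n : b (k + n)%N <= b k * 2^-1 ^+ n.
  elim: n => [|n IHn]; first by rewrite addn0 mulr1.
  rewrite addnS exprSr mulrA; apply: le_trans (bS _ (leq_addr _ _)) _.
  by rewrite ler_wpM2r // invr_ge0.
have ebk : 0 < e / (b k + 1) by rewrite divr_gt0 // ltr_wpDl.
have h2 : (2^-1 : R) < 1 by rewrite invf_lt1 // ltr1n.
have h20 : 0 <= 2^-1 :> R by rewrite invr_ge0.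
have [n hn] := geometric_small h20 h2 ebk.
exists (k + n)%N => m lem; have -> : m = (k + (m - k))%N by lia.
apply: le_lt_trans (bk _) _; have := hn (m - k)%N ltac:(lia).
rewrite ltr_pdivlMr ?ltr_wpDl // mulrC; apply: le_lt_trans.
by rewrite ler_wpM2r ?exprn_ge0 ?invr_ge0 // lerDl.
Qed.

End GossCoefficients.

(** * Power series with strictly convex coefficient valuations *)

Section StrictSeries.
Variables (R : realType) (K : fieldType) (N : K -> R) (S : nat -> K) (k : R).
Hypotheses (absN : nonarch_abs N) (completeN : complete_abs N).
Hypotheses (k_gt0 : 0 < k) (k_lt1 : k < 1) (S0 : N (S 0) = 1).
Hypothesis S_costs : forall M, S M != 0 ->
  exists2 f, strict_costs f & forall m, (m <= M)%N -> N (S m) = k ^+ f m.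
Hypothesis S_small : forall r : R, 0 <= r ->
  forall e, 0 < e -> exists n0, forall m, (n0 <= m)%N -> N (S m) * r ^+ m < e.

Definition term a i := a ^- i * S i.

Lemma abs_term a i : N (term a i) = N (S i) * N a^-1 ^+ i.
Proof. by rewrite /term (absM absN) mulrC -exprVn (absX absN). Qed.

Lemma term_small a : converges N (term a) 0.
Proof.
move=> e e0; have [n0 hn] := S_small (abs_ge0 absN a^-1) e0.
by exists n0 => n /hn; rewrite subr0 abs_term.
Qed.

Lemma series_value a : exists2 l, converges N (fun n => \sum_(i < n) term a i) l
  & forall M e, (forall n, (M <= n)%N -> N (term a n) <= e) ->
      N (l - \sum_(i < M) term a i) <= e.
Proof. exact: series_converges (term_small a). Qed.

Section ZeroOfSeries.
Variable a : K.
Hypotheses (a_neq0 : a != 0) (a_zero : converges N (fun n => \sum_(i < n) term a i) 0).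
Local Notation t := (term a).

(** All but finitely many terms are below mu / 2, so strict inequality has to be made uniform only
    over a finite set. *)
Lemma uniform_gap (P : pred nat) (mu : R) : 0 < mu ->
    (forall i, ~~ P i -> N (t i) < mu) ->
  exists2 rho, 0 < rho < 1 & forall i, ~~ P i -> N (t i) <= rho * mu.
Proof.
move=> mu0 lt_mu; have h2 : 0 < mu / 2 by rewrite divr_gt0.
have [n0 hn] := term_small a h2.
suff [rho rho1 le_rho] : exists2 rho, 2^-1 <= rho < 1 &
    forall i, (i < n0)%N -> ~~ P i -> N (t i) <= rho * mu.
  exists rho => [|i Pi]; first by lra.
  case: (ltnP i n0) => [lt|le]; first exact: le_rho.
  have := hn i le; rewrite subr0 => h; nra.
elim: {hn} n0 => [|n [rho rho1 IHn]]; first by exists 2^-1 => //; lra.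
have [Pn|nPn] := boolP (P n).
  exists rho => // i; rewrite ltnS leq_eqVlt => /predU1P[->|lt]; last exact: IHn.
  by rewrite Pn.
exists (Num.max rho (N (t n) / mu)) => [|i].
  rewrite le_max gt_max ltr_pdivrMr // mul1r lt_mu //; lra.
rewrite ltnS leq_eqVlt => /predU1P[-> _|lt Pi].
  by rewrite -ler_pdivrMr // le_max lexx orbT.
apply: le_trans (IHn i lt Pi) _; rewrite ler_wpM2r ?(ltW mu0) //.
by rewrite le_max lexx.
Qed.

(** Strict convexity of the costs makes the sizes N (t i) strictly log-concave up to j, so past two
    equal or descending terms they fall strictly. *)
Lemma max_term_consecutive mu i j : (i < j)%N -> N (t i) = mu -> N (t j) = mu -> 0 < mu ->
  (forall l, N (t l) <= mu) -> j = i.+1.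
Proof.
move=> ltij ei ej mu0 le_mu; apply/eqP; rewrite eqn_leq ltij andbT leqNgt; apply/negP => lt.
have Sj : S j != 0 by apply: contraTneq mu0 => Sj; rewrite -ej /term Sj mulr0 (abs0 absN) ltxx.
have [f [f0 f1 fS] fE] := S_costs Sj.
set r := N a^-1; have r0 : 0 < r by rewrite /r (abs_gt0 absN) invr_eq0.
have tE l : (l <= j)%N -> N (t l) = k ^+ f l * r ^+ l by move=> le; rewrite abs_term fE.
have t0 l : (l <= j)%N -> 0 < N (t l) by move=> le; rewrite tE // mulr_gt0 ?exprn_gt0.
have concave l : (l.+2 <= j)%N -> N (t l) * N (t l.+2) < N (t l.+1) ^+ 2.
  move=> le; rewrite !tE //; try lia.
  have -> : k ^+ f l * r ^+ l * (k ^+ f l.+2 * r ^+ l.+2) =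
    k ^+ (f l + f l.+2) * r ^+ l.+1 ^+ 2 by rewrite exprD !exprS; ring.
  rewrite exprMn ltr_pM2r ?exprn_gt0 // -exprM ltr_iXn2l //.
  by have := fS l; lia.
have decr n : (i + n.+2 <= j)%N -> N (t (i + n.+2)%N) < N (t (i + n.+1)%N).
  have step l : (l.+2 <= j)%N -> N (t l.+1) <= N (t l) -> N (t l.+2) < N (t l.+1).
    move=> le le1; rewrite -(ltr_pM2l (t0 l ltac:(lia))).
    apply: lt_le_trans (concave l le) _; rewrite expr2 ler_wpM2r //.
    by rewrite ltW // t0 // ltnW.
  elim: n => [|n IHn] le.
    by rewrite addn2 addn1; apply: step; [lia | rewrite ei].
  have := step (i + n.+1)%N; rewrite -!addnS; apply; first lia.
  by apply/ltW/IHn; lia.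
have [n en] : exists n, j = (i + n.+2)%N by exists (j - i - 2)%N; lia.
have := decr n; rewrite -en leqnn ej => /(_ isT); rewrite ltNge => /negP; apply.
exact: le_mu.
Qed.

Lemma dominant_pair : exists m rho, [/\ 0 < rho < 1, N (t m) = N (t m.+1), 0 < N (t m)
  & forall i, i != m -> i != m.+1 -> N (t i) <= rho * N (t m)].
Proof.
have t0 : N (t 0) = 1 by rewrite abs_term S0 mul1r expr0.
have [n0 hn] := term_small a (ltr01).
have [i1 _ i1max] := @arg_maxP _ R 'I_n0.+1 ord0 predT (fun i => N (t i)) isT.
set mu := N (t i1) in i1max.
have le_mu l : N (t l) <= mu.
  case: (ltnP l n0.+1) => [lt|/ltnW le]; first exact: (i1max (Ordinal lt)).
  apply: le_trans (i1max ord0 isT); rewrite /= t0 ltW //.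
  by have := hn l le; rewrite subr0.
have mu0 : 0 < mu by apply: lt_le_trans (le_mu 0%N); rewrite t0 ltr01.
(* A single maximal term could not be cancelled in a series with sum 0. *)
have [i2 i2ne i2mu] : exists2 i2, i2 != i1 :> nat & N (t i2) = mu.
  apply: contrapT => none.
  have [|rho rho1 rho_le] := @uniform_gap (pred1 (i1 : nat)) mu mu0.
    move=> i /= ne; rewrite lt_neqAle le_mu andbT; apply/eqP => e.
    by apply: none; exists i.
  have [n1 hn1] := a_zero mu0; have := hn1 (maxn n1 i1.+1) (leq_maxl _ _).
  have lt1 : (i1 < maxn n1 i1.+1)%N by rewrite leq_maxr.
  rewrite subr0 (bigD1 (Ordinal lt1)) //= (absD_dominant absN) ?ltxx //.
  apply: (@le_lt_trans _ _ (rho * mu)); last by rewrite -/mu gtr_pMl //; lra.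
  apply: (abs_sum_le absN) => [|i ne]; first by apply: mulr_ge0; lra.
  by apply: rho_le; rewrite -val_eqE in ne.
have [m [em emS]] : exists m, N (t m) = mu /\ N (t m.+1) = mu.
  case: (ltngtP i2 i1) i2ne => // lt _.
    by exists i2; rewrite -(max_term_consecutive lt i2mu (erefl _) mu0 le_mu).
  by exists i1; rewrite -(max_term_consecutive lt (erefl _) i2mu mu0 le_mu).
have [|rho rho1 rho_le] := @uniform_gap [pred i | (i == m) || (i == m.+1)] mu mu0.
  move=> i /=; rewrite negb_or => /andP[nm nmS]; rewrite lt_neqAle le_mu andbT; apply/eqP => e.
  case: (ltngtP i m) nm => // lt _.
    have := max_term_consecutive lt e em mu0 le_mu.
    have := max_term_consecutive (ltnW lt : (i < m.+1)%N) e emS mu0 le_mu; lia.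
  have := max_term_consecutive lt em e mu0 le_mu => ei; move: nmS; rewrite ei eqxx //.
exists m, rho; split; rewrite ?em ?emS // => i nm nmS.
by apply: rho_le; rewrite /= negb_or nm nmS.
Qed.

(* The coefficient of h ^ j in (1 + h) ^- m. *)
Definition bin_neg m j : K := (-1) ^+ j * 'C((m + j).-1, j)%:R.

Lemma abs_bin_neg m j : N (bin_neg m j) <= 1.
Proof. by rewrite /bin_neg (absM absN) (absX absN) (absN1 absN) expr1n mul1r abs_nat. Qed.

Lemma bin_neg0 m : bin_neg m 0 = 1.
Proof. by rewrite /bin_neg bin0 mul1r. Qed.

Lemma bin_negS m j : bin_neg m.+1 j.+1 + bin_neg m.+1 j = bin_neg m j.+1.
Proof.
rewrite /bin_neg !addnS !addSn /= binS natrD exprS; ring.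
Qed.

Lemma abs_one_plus h : N h < 1 -> N (1 + h) = 1.
Proof. by move=> h1; rewrite (absD_dominant absN) (abs1 absN). Qed.

(** Induction on m: multiplication by 1 + h, of absolute value 1, lowers m through the Pascal rule
    [bin_negS], up to one term of the truncation degree. *)
Lemma bin_neg_remainder h m n : N h < 1 ->
  N ((1 + h) ^- m - \sum_(j < n) bin_neg m j * h ^+ j) <= N h ^+ n.
Proof.
move=> h1; have u1 := abs_one_plus h1.
have u_neq0 : 1 + h != 0 by rewrite -(abs_gt0 absN) u1.
case: n => [|n]; first by rewrite big_ord0 subr0 (absV absN) (absX absN) u1 expr1n invr1.
elim: m => [|m IHm].
  rewrite expr0 invr1 big_ord_recl bin_neg0 mul1r big1 ?addr0 ?subrr ?(abs0 absN).
    by rewrite exprn_ge0 ?(abs_ge0 absN).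
  by move=> j _; rewrite /bin_neg bin_small ?mulr0 ?mul0r //= add0n.
pose B m := \sum_(j < n.+1) bin_neg m j * h ^+ j.
have eB : (1 + h) * B m.+1 = B m + bin_neg m.+1 n * h ^+ n.+1.
  rewrite mulrDl mul1r mulr_sumr /B [X in _ + X]big_ord_recr big_ord_recl.
  rewrite [in RHS]big_ord_recl !bin_neg0 /= -!addrA; congr (_ + _).
  rewrite [in LHS]addrA -big_split /=; congr (_ + _); last by rewrite exprS; ring.
  by apply: eq_bigr => j _; rewrite /bump add1n -(bin_negS m j) exprS; ring.
have -> : (1 + h) ^- m.+1 - B m.+1 =
    (1 + h)^-1 * ((1 + h) ^- m - B m - bin_neg m.+1 n * h ^+ n.+1).
  apply: (mulfI u_neq0); rewrite mulrA divff // mul1r mulrBr eB exprS invfM mulrA divff //.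
  by rewrite mul1r opprD addrA.
rewrite (absM absN) (absV absN) u1 invr1 mul1r (absB_le absN) //.
by rewrite (absM absN) (absX absN) ler_piMl ?exprn_ge0 ?(abs_ge0 absN) ?abs_bin_neg.
Qed.

Lemma taylor_coef j : exists C, converges N (fun M => \sum_(i < M) t i * bin_neg i j) C /\
  forall M e, (forall n, (M <= n)%N -> N (t n) <= e) ->
     N (C - \sum_(i < M) t i * bin_neg i j) <= e.
Proof.
have le_t i : N (t i * bin_neg i j) <= N (t i).
  by rewrite (absM absN) ler_piMr ?(abs_ge0 absN) ?abs_bin_neg.
have [|C hC tailC] := @series_converges _ _ _ absN completeN (fun i => t i * bin_neg i j).
  move=> e /(term_small a)[n0 hn]; exists n0 => n /hn; rewrite !subr0.
  exact: le_lt_trans (le_t n).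
by exists C; split=> // M e le_e; apply: tailC => n /le_e; apply: le_trans (le_t n).
Qed.

Lemma simple_zero_of_series (g : K -> K) :
  (forall x, x != 0 -> converges N (fun n => \sum_(i < n) term x i) (g x)) ->
  simple_zero N g a.
Proof.
move=> g_val; have [C hC] := choice taylor_coef.
have Ccvg j : converges N (fun M => \sum_(i < M) t i * bin_neg i j) (C j) by case: (hC j).
have Ctail j M e : (forall n, (M <= n)%N -> N (t n) <= e) ->
     N (C j - \sum_(i < M) t i * bin_neg i j) <= e by case: (hC j) => _; apply.
have Na_gt0 : 0 < N a by rewrite (abs_gt0 absN).
have C0 : C 0%N = 0.
  apply: (converges_unique absN) (Ccvg 0%N) _ => e /a_zero[n0 hn]; exists n0 => n /hn.
  suff -> : \sum_(i < n) t i * bin_neg i 0 = \sum_(i < n) t i by [].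
  by apply: eq_bigr => i _; rewrite bin_neg0 mulr1.
(* With x = a (1 + h) every x ^ - i is a ^ - i times a binomial series in h = (x - a) / a, valid for
   N h < 1. *)
exists (N a), (fun j => C j / a ^+ j); split=> // [[|//] _||x xa].
- by rewrite C0 mul0r.
- rewrite expr1 mulf_neq0 ?invr_eq0 //; apply/eqP => C1.
  have [m [rho [rho1 e_mu mu0 rho_le]]] := dominant_pair.
  set mu := N (t m) in e_mu mu0 rho_le.
  have rmu : rho * mu < mu by rewrite gtr_pMl //; lra.
  have [n1 hn1] := Ccvg 1%N _ mu0; have [n2 hn2] := a_zero mu0.
  pose M := maxn (maxn n1 n2) m.+2.
  have lt1 : N (\sum_(i < M) t i * bin_neg i 1) < mu.
    by have := hn1 M; rewrite C1 subr0; apply; rewrite /M; lia.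
  (* The weights -i of the first Taylor coefficient are only known modulo p. Adding m times the
     vanishing sum changes them to m - i, which kills t m and leaves t (m + 1) with weight -1 as the
     only term of size mu. *)
  have lt2 : N (\sum_(i < M) t i *+ m) < mu.
    rewrite sumrMnl; apply: le_lt_trans (abs_mulrn absN _ _) _.
    by have := hn2 M; rewrite subr0; apply; rewrite /M; lia.
  have := absD_lt absN lt1 lt2; rewrite -big_split /=.
  have ltm : (m < M)%N by rewrite /M; lia.
  have ltmS : (m.+1 < M)%N by rewrite /M; lia.
  have binE i : t i * bin_neg i 1 + t i *+ m = t i * (m%:R - i%:R).
    by rewrite /bin_neg addn1 /= bin1 -mulr_natr; ring.
  rewrite (bigD1 (Ordinal ltmS)) //= binE -opprB -natrB // subSnn mulrN1.
  rewrite (absD_dominant absN) ?(absNN absN) -?e_mu ?ltxx //.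
  apply: le_lt_trans rmu; apply: (abs_sum_le absN) => [|i ne].
    by rewrite mulr_ge0 ?(ltW mu0) //; lra.
  rewrite -val_eqE /= in ne; rewrite binE (absM absN).
  have [->|nem] := eqVneq (i : nat) m.
    by rewrite subrr (abs0 absN) mulr0 mulr_ge0 ?(ltW mu0) //; lra.
  apply: le_trans (rho_le _ nem ne); rewrite ler_piMr ?(abs_ge0 absN) //.
  by apply: (absB_le absN); apply: abs_nat.
have h1 : N ((x - a) / a) < 1 by rewrite (absM absN) (absV absN) ltr_pdivrMr // mul1r.
set h := (x - a) / a in h1.
have xE : x = a * (1 + h) by rewrite /h mulrDr mulr1 mulrCA divff // mulr1 addrC subrK.
have uh := abs_one_plus h1.
have x_neq0 : x != 0 by rewrite xE mulf_neq0 // -(abs_gt0 absN) uh.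
have absx i : N (term x i) = N (t i).
  by rewrite /term !(absM absN) !(absV absN) !(absX absN) xE (absM absN) uh mulr1.
apply/(cvg_absP absN) => e e0; have e2 : 0 < e / 2 by rewrite divr_gt0.
have e2lt : e / 2 < e by lra.
have [M hM] := term_small a e2.
have leM n : (M <= n)%N -> N (t n) <= e / 2 by move=> /hM; rewrite subr0 => /ltW.
have gM : N (g x - \sum_(i < M) term x i) <= e / 2.
  have [l hl tail] := series_value x.
  by rewrite (converges_unique absN (g_val x x_neq0) hl) tail // => n /leM; rewrite absx.
pose B := \sum_(i < M) N (t i) + 1.
have B_gt0 : 0 < B by rewrite ltr_wpDl // sumr_ge0 // => i _; apply: abs_ge0.
have le_B (i : 'I_M) : N (t i) <= B.
  rewrite /B (bigD1 i) //= -addrA lerDl addr_ge0 // sumr_ge0 // => j _; exact: abs_ge0.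
have eB : 0 < e / 2 / B by rewrite divr_gt0.
have [n0 hn0] := geometric_small (abs_ge0 absN h) h1 eB; exists n0 => n le_n.
have -> : \sum_(j < n) C j / a ^+ j * (x - a) ^+ j = \sum_(j < n) C j * h ^+ j.
  by apply: eq_bigr => j _; rewrite /h exprMn exprVn mulrA mulrAC.
apply: le_lt_trans e2lt; rewrite (absB absN).
(* Three errors: the tail of the series at x, the truncation of each (1 + h) ^ - i, and the tails of
   the Taylor coefficients. *)
have -> : g x - \sum_(j < n) C j * h ^+ j = (g x - \sum_(i < M) term x i) +
    (\sum_(i < M) t i * ((1 + h) ^- i - \sum_(j < n) bin_neg i j * h ^+ j) -
     \sum_(j < n) (C j - \sum_(i < M) t i * bin_neg i j) * h ^+ j).
  have -> : \sum_(i < M) term x i = \sum_(i < M) t i * (1 + h) ^- i.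
    by apply: eq_bigr => i _; rewrite /term xE exprMn invfM mulrAC.
  have -> : \sum_(i < M) t i * ((1 + h) ^- i - \sum_(j < n) bin_neg i j * h ^+ j) =
      \sum_(i < M) t i * (1 + h) ^- i -
      \sum_(j < n) (\sum_(i < M) t i * bin_neg i j) * h ^+ j.
    rewrite (eq_bigr (fun i : 'I_M => t i * (1 + h) ^- i -
      \sum_(j < n) t i * bin_neg i j * h ^+ j)) => [|i _].
      rewrite sumrB; congr (_ - _); rewrite exchange_big; apply: eq_bigr => j _.
      by rewrite mulr_suml.
    by rewrite mulrBr mulr_sumr; congr (_ - _); apply: eq_bigr => j _; rewrite mulrA.
  have -> : \sum_(j < n) (C j - \sum_(i < M) t i * bin_neg i j) * h ^+ j =
      \sum_(j < n) C j * h ^+ j - \sum_(j < n) (\sum_(i < M) t i * bin_neg i j) * h ^+ j.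
    by rewrite -sumrB; apply: eq_bigr => j _; rewrite mulrBl.
  by ring.
apply: (absD_le absN) => //; apply: (absB_le absN).
  apply: (abs_sum_le absN) => [|i _]; first exact: ltW.
  rewrite (absM absN); apply: le_trans (_ : B * (e / 2 / B) <= _).
    apply: ler_pM; rewrite ?(abs_ge0 absN) ?le_B //.
    apply: le_trans (bin_neg_remainder i n h1) _; exact/ltW/hn0.
  by rewrite mulrC divfK ?gt_eqF.
apply: (abs_sum_le absN) => [|j _]; first exact: ltW.
rewrite (absM absN); apply: le_trans (_ : e / 2 * 1 <= _); last by rewrite mulr1.
apply: ler_pM; rewrite ?(abs_ge0 absN) ?Ctail //.
by rewrite (absX absN) exprn_ile1 ?(abs_ge0 absN) // ltW.
Qed.

Lemma unit_power_close x i j : N (x - a) < N a ->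
  N (x ^+ i / x ^+ j - a ^+ i / a ^+ j) <= N a ^+ i / N a ^+ j * (N (x - a) / N a).
Proof.
move=> xa; have Na_gt0 : 0 < N a by rewrite (abs_gt0 absN).
set h := (x - a) / a; have hN : N h = N (x - a) / N a by rewrite /h (absM absN) (absV absN).
have h1 : N h < 1 by rewrite hN ltr_pdivrMr // mul1r.
have xE : x = a * (1 + h) by rewrite /h mulrDr mulr1 mulrCA divff // mulr1 addrC subrK.
have uh := abs_one_plus h1; have u_neq0 : 1 + h != 0 by rewrite -(abs_gt0 absN) uh.
have -> : x ^+ i / x ^+ j - a ^+ i / a ^+ j =
    a ^+ i / a ^+ j * (((1 + h) ^+ i - (1 + h) ^+ j) / (1 + h) ^+ j).
  rewrite xE !exprMn mulrBl divff ?expf_neq0 // mulrBr mulr1 invfM; congr (_ - _).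
  by rewrite !mulrA; congr (_ * _); rewrite mulrAC.
rewrite !(absM absN) !(absV absN) !(absX absN) uh expr1n invr1 mulr1 -hN.
rewrite ler_wpM2l ?divr_ge0 ?exprn_ge0 ?(abs_ge0 absN) //.
have near1 n : N ((1 + h) ^+ n - 1) <= N h.
  rewrite -[X in _ - X](expr1n K n); apply: (abs_subX absN); rewrite ?uh ?(abs1 absN) //.
  by rewrite addrC addKr.
by have := absB_le absN (near1 i) (near1 j); rewrite opprB addrA subrK.
Qed.

(* Solving the vanishing of the series for the dominant pair of terms exhibits
   the zero as the fixed point of a contraction defined over D. *)
Lemma zero_in_closed_subfield (D : K -> Prop) :
    D 1 -> (forall x z, D x -> D z -> D (x - z)) -> (forall x z, D x -> D z -> D (x / z)) ->
    (forall x, (forall e, 0 < e -> exists2 z, D z & N (x - z) < e) -> D x) ->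
    (forall i, D (S i)) -> D a.
Proof.
move=> D1 DB Ddiv Dlim DS.
have D0 : D 0 by rewrite -(subrr 1); apply: (DB).
have DV x : D x -> D x^-1 by move=> Dx; rewrite -div1r; apply: (Ddiv).
have DM x z : D x -> D z -> D (x * z).
  by move=> Dx Dz; rewrite -[z]invrK; apply: (Ddiv) => //; apply: (DV).
have DX x i : D x -> D (x ^+ i).
  by move=> Dx; elim: i => [|i IHi]; rewrite ?expr0 // exprS; apply: (DM).
have Dsum n (P : pred 'I_n) (f : 'I_n -> K) : (forall i, D (f i)) -> D (\sum_(i < n | P i) f i).
  move=> Df; apply: (big_ind D) => // x z Dx Dz; rewrite -[z]opprK; apply: (DB) => //.
  by rewrite -sub0r; apply: (DB).
have [m [rho [rho1 e_mu mu0 rho_le]]] := dominant_pair.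
set mu := N (t m) in e_mu mu0 rho_le.
have Na_gt0 : 0 < N a by rewrite (abs_gt0 absN).
have Sm_neq0 : S m != 0 by apply: contraTneq mu0 => Sm; rewrite /mu /term Sm mulr0 (abs0 absN) ltxx.
(* Multiplying the truncated series by a ^ (m + 1) / S m turns term m into a and term m + 1 into S
   (m + 1) / S m; [Psi] moves all but a to the other side. *)
pose Psi M x := - (S m.+1 / S m) -
  \sum_(i < M | ((i : nat) != m) && ((i : nat) != m.+1)) S i / S m * (x ^+ m.+1 / x ^+ i).
have DPsi M x : D x -> D (Psi M x).
  move=> Dx; apply: (DB); first by rewrite -sub0r; apply: (DB) => //; apply: (Ddiv).
  by apply: Dsum => i; apply: (DM); apply: (Ddiv) => //; apply: (DX).
have Psi_a M : (m.+1 < M)%N -> a - Psi M a = a ^+ m.+1 / S m * \sum_(i < M) t i.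
  move=> ltM; have ltM' : (m < M)%N by apply: ltnW.
  have tE i : a ^+ m.+1 / S m * t i = S i / S m * (a ^+ m.+1 / a ^+ i) by rewrite /term; ring.
  rewrite mulr_sumr (eq_bigr _ (fun (i : 'I_M) _ => tE i)) (bigD1 (Ordinal ltM')) //=.
  rewrite (bigD1 (Ordinal ltM)) /=; last by rewrite -val_eqE /= eqn_leq ltnn.
  have -> : S m / S m * (a ^+ m.+1 / a ^+ m) = a.
    by rewrite divff // mul1r exprS mulfK // expf_neq0.
  rewrite divff ?expf_neq0 // mulr1 /Psi opprB opprK [_ + S m.+1 / S m]addrC.
  congr (_ + (_ + _)); apply: eq_bigl => i; by rewrite -!val_eqE.
have term_bound i : i != m -> i != m.+1 ->
    N (S i / S m) * (N a ^+ m.+1 / N a ^+ i) <= rho * N a.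
  move=> nm nmS; have -> : N (S i / S m) * (N a ^+ m.+1 / N a ^+ i) = N (t i) / mu * N a.
    rewrite /mu !abs_term (absM absN) !(absV absN) exprS !exprVn; field.
    by rewrite (abs_eq0 absN) Sm_neq0 !expf_neq0 ?gt_eqF.
  by rewrite ler_pM2r // ler_pdivrMr //; apply: rho_le.
have approx e : 0 < e -> exists M, (m.+1 < M)%N /\ N (a - Psi M a) < e.
  move=> e0; have c0 : 0 < N (a ^+ m.+1 / S m).
    by rewrite (abs_gt0 absN) mulf_neq0 ?invr_eq0 // expf_neq0.
  have [n0 hn] := a_zero (divr_gt0 e0 c0); exists (maxn n0 m.+2); split; first lia.
  rewrite Psi_a ?(absM absN _ (\sum_(_ < _) _)); last lia.
  by have := hn _ (leq_maxl n0 m.+2); rewrite subr0 ltr_pdivlMr // mulrC.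
have rho_gt0 : 0 < rho by lra.
apply: Dlim => e e0.
(* Each application of [Psi] gains a factor rho; its truncation M is chosen anew at every step so
   that the cut-off error stays below the target. *)
suff steps n : exists2 x, D x & N (x - a) <= rho ^+ n.+1 * N a.
  have ea : 0 < e / N a by rewrite divr_gt0.
  have [n0 hn] := geometric_small (ltW rho_gt0) (proj2 (andP rho1)) ea.
  have [x Dx x_le] := steps n0; exists x => //; rewrite (absB absN).
  by apply: le_lt_trans x_le _; rewrite -ltr_pdivlMr // hn.
elim: n => [|n [x Dx x_le]].
  have [|M [ltM hM]] := approx (rho * N a); first exact: mulr_gt0.
  exists (- (S m.+1 / S m)); first by rewrite -sub0r; apply: (DB) => //; apply: (Ddiv).
  rewrite expr1 (absB absN) opprK.
  have -> : a + S m.+1 / S m = a - Psi M a + (Psi M a + S m.+1 / S m) by rewrite addrA subrK.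
  apply: (absD_le absN); first exact: ltW.
  rewrite /Psi addrAC addNr add0r (absNN absN); apply: (abs_sum_le absN).
    by rewrite mulr_ge0 // ltW.
  by move=> i /andP[nm nmS]; rewrite !(absM absN) -(absM absN) !(absV absN) !(absX absN) term_bound.
have xa : N (x - a) < N a.
  apply: le_lt_trans x_le _; rewrite gtr_pMl //.
  by rewrite exprn_ilt1 ?(ltW rho_gt0) //; case/andP: rho1.
have [|M [ltM hM]] := approx (rho ^+ n.+2 * N a); first by rewrite mulr_gt0 ?exprn_gt0.
exists (Psi M x); first exact: DPsi.
have -> : Psi M x - a = (Psi M x - Psi M a) + (Psi M a - a) by rewrite addrA subrK.
apply: (absD_le absN); last by rewrite (absB absN) ltW.
have -> : Psi M x - Psi M a = - \sum_(i < M | ((i : nat) != m) && ((i : nat) != m.+1))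
    S i / S m * (x ^+ m.+1 / x ^+ i - a ^+ m.+1 / a ^+ i).
  rewrite (eq_bigr (fun i : 'I_M => S i / S m * (x ^+ m.+1 / x ^+ i) -
    S i / S m * (a ^+ m.+1 / a ^+ i))) => [|i _]; last by rewrite mulrBr.
  by rewrite sumrB /Psi; ring.
rewrite (absNN absN); apply: (abs_sum_le absN) => [|i /andP[nm nmS]].
  by rewrite mulr_ge0 ?exprn_ge0 ?(ltW rho_gt0) ?(ltW Na_gt0).
rewrite (absM absN); apply: le_trans (_ : rho * N a * (N (x - a) / N a) <= _).
  apply: le_trans (_ : N (S i / S m) * (N a ^+ m.+1 / N a ^+ i * (N (x - a) / N a)) <= _).
    by rewrite ler_wpM2l ?(abs_ge0 absN) // unit_power_close.
  by rewrite mulrA ler_wpM2r ?divr_ge0 ?(abs_ge0 absN) // term_bound.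
have -> : rho * N a * (N (x - a) / N a) = rho * N (x - a) by field; rewrite gt_eqF.
by rewrite exprS -mulrA ler_pM2l.
Qed.

End ZeroOfSeries.
End StrictSeries.

(** * Rationality over the prime field *)

Section PrimeSubfield.
Variables (p : nat) (F : fieldType).
Hypotheses (p_pr : prime p) (pF : p \in [pchar F]).

Definition of_Fp (x : 'F_p) : F := (x : nat)%:R.

Lemma of_Fp_nat n : of_Fp n%:R = n%:R.
Proof. by rewrite /of_Fp val_Fp_nat // GRing.natr_mod_pchar. Qed.

Lemma of_Fp_additive : nmod_morphism of_Fp.
Proof.
split=> [|x y]; first exact: (of_Fp_nat 0).
by rewrite -[x]natr_Zp -[y]natr_Zp -natrD !of_Fp_nat natrD.
Qed.

Lemma of_Fp_multiplicative : monoid_morphism of_Fp.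
Proof.
split=> [|x y]; first exact: (of_Fp_nat 1).
by rewrite -[x]natr_Zp -[y]natr_Zp -natrM !of_Fp_nat natrM.
Qed.

HB.instance Definition _ := GRing.isNmodMorphism.Build _ _ of_Fp of_Fp_additive.
HB.instance Definition _ := GRing.isMonoidMorphism.Build _ _ of_Fp of_Fp_multiplicative.

Definition of_Fp_rmorphism : {rmorphism 'F_p -> F} := of_Fp.

End PrimeSubfield.

Section Rationality.
Variables (R : realType) (p s : nat) (F : finFieldType) (Om : fieldType).
Variables (N : Om -> R) (phi : {rmorphism {poly F} -> Om}).
Hypotheses (p_pr : prime p) (s_gt0 : (0 < s)%N) (cardF : #|F| = (p ^ s)%N).
Hypotheses (absN : nonarch_abs N) (completeN : complete_abs N).
Hypothesis absphi : forall n : {poly F}, n != 0 -> N (phi n) = #|F|%:R ^+ (size n).-1.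

Local Notation T := (phi 'X).
Local Notation u := (phi 'X)^-1.
Local Notation iota := (phi \o polyC : {rmorphism F -> Om}).
Let pF : p \in [pchar F] := card_finPcharP cardF p_pr.
Let inj_Fp := of_Fp_rmorphism p_pr pF.
Let psi : {rmorphism {poly 'F_p} -> Om} := phi \o map_poly inj_Fp.
Let q_gt1 : 1 < #|F|%:R :> R := card_gt1 R F.
Let q_gt0 : 0 < #|F|%:R :> R := lt_trans ltr01 q_gt1.
Let T_neq0 : T != 0 := T_neq0 absN absphi.

Lemma abs_psi A : A != 0 -> N (psi A) = #|F|%:R ^+ (size A).-1.
Proof. by move=> A0; rewrite /psi /= absphi ?map_poly_eq0 // size_map_poly. Qed.

Lemma psi_eq0 A : (psi A == 0) = (A == 0).
Proof.
have [->|A0] := eqVneq A 0; first by rewrite rmorph0 eqxx.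
by apply/negbTE; rewrite -(abs_gt0 absN) abs_psi // exprn_gt0.
Qed.

Lemma psiX : psi 'X = T. Proof. by rewrite /psi /= map_polyX. Qed.

(** * The field F_p(T) inside Om, its closure, and Laurent expansions *)

Definition fraction x := exists A B : {poly 'F_p}, B != 0 /\ x = psi A / psi B.

Lemma fraction_psi A : fraction (psi A).
Proof. by exists A, 1; rewrite oner_neq0 rmorph1 divr1. Qed.

Lemma fractionB x z : fraction x -> fraction z -> fraction (x - z).
Proof.
move=> [A [B [B0 ->]]] [C [D [D0 ->]]]; exists (A * D - C * B), (B * D).
split; first exact: mulf_neq0.
by rewrite rmorphB !rmorphM; field; rewrite !psi_eq0 B0 D0.
Qed.

Lemma fractionM x z : fraction x -> fraction z -> fraction (x * z).
Proof.
move=> [A [B [B0 ->]]] [C [D [D0 ->]]]; exists (A * C), (B * D).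
by split; [exact: mulf_neq0 | rewrite !rmorphM mulf_div].
Qed.

Lemma fractionV x : fraction x -> fraction x^-1.
Proof.
move=> [A [B [B0 ->]]]; have [->|A0] := eqVneq A 0.
  by rewrite rmorph0 mul0r invr0 -(rmorph0 psi); apply: fraction_psi.
by exists B, A; rewrite invf_div.
Qed.

Lemma fraction0 : fraction 0.
Proof. by rewrite -(rmorph0 psi); apply: fraction_psi. Qed.

Lemma fractionD x z : fraction x -> fraction z -> fraction (x + z).
Proof.
move=> fx fz; rewrite -[z]opprK; apply: fractionB => //.
by rewrite -sub0r; apply: fractionB => //; apply: fraction0.
Qed.

Lemma fraction_digit_sum L d m : (forall j, (d j <= p.-1)%N) ->
  fraction (digit_sum iota u p L d m).
Proof.
move=> d_small; rewrite /digit_sum (power_sum_expansion _ _ p_pr s_gt0 cardF) //.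
apply: big_ind => [||nu _]; [exact: fraction0 | exact: fractionD |].
set c := config_cost _ _ _ _; exists ((-1) ^+ m *+ counts_coef d nu), 'X^c.
split; first by rewrite expf_neq0 // polyX_eq0.
by rewrite rmorphMn rmorphXn rmorphN1 rmorphXn psiX exprVn mulrnAl.
Qed.

Definition approximable x := forall e, 0 < e -> exists2 z, fraction z & N (x - z) < e.

Lemma approximable_fraction x : fraction x -> approximable x.
Proof. by move=> fx e e0; exists x; rewrite // subrr (abs0 absN). Qed.

Lemma approximable1 : approximable 1.
Proof. by apply: approximable_fraction; rewrite -(rmorph1 psi); apply: fraction_psi. Qed.

Lemma approximableB x z : approximable x -> approximable z -> approximable (x - z).
Proof.
move=> ax az e e0; have [x' fx xx'] := ax e e0; have [z' fz zz'] := az e e0.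
exists (x' - z'); first exact: fractionB.
have -> : x - z - (x' - z') = (x - x') - (z - z') by ring.
exact: absB_lt.
Qed.

Lemma approximableV z : approximable z -> approximable z^-1.
Proof.
move=> az; have [->|z0] := eqVneq z 0.
  by rewrite invr0; apply: approximable_fraction; apply: fraction0.
move=> e e0; have Nz : 0 < N z by rewrite (abs_gt0 absN).
have m0 : 0 < Num.min (N z) (e * (N z * N z)) by rewrite lt_min Nz !mulr_gt0.
have [w fw] := az _ m0; rewrite lt_min => /andP[zw zw'].
have Nw := abs_eq_of_close absN zw; have w0 : w != 0 by rewrite -(abs_gt0 absN) Nw.
exists w^-1; first exact: fractionV.
have -> : z^-1 - w^-1 = (w - z) / (z * w) by field; rewrite z0 w0.
by rewrite !(absM absN) (absV absN) (absM absN) Nw (absB absN) ltr_pdivrMr ?mulr_gt0.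
Qed.

Lemma approximableM x z : approximable x -> approximable z -> approximable (x * z).
Proof.
move=> ax az e e0; have x1 : 0 < N x + 1 by rewrite ltr_wpDl ?(abs_ge0 absN).
have m0 : 0 < Num.min 1 (e / (N x + 1)) by rewrite lt_min ltr01 divr_gt0.
have [w fw] := az _ m0; rewrite lt_min => /andP[zw1 zw].
have w1 : 0 < N w + 1 by rewrite ltr_wpDl ?(abs_ge0 absN).
have [v fv xv] := ax _ (divr_gt0 e0 w1).
exists (v * w); first exact: fractionM.
have -> : x * z - v * w = x * (z - w) + (x - v) * w by ring.
apply: (absD_lt absN); rewrite (absM absN).
  apply: le_lt_trans (_ : (N x + 1) * N (z - w) < e).
    by rewrite ler_wpM2r ?(abs_ge0 absN) // lerDl.
  by rewrite mulrC -ltr_pdivlMr.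
apply: le_lt_trans (_ : N (x - v) * (N w + 1) < e).
  by rewrite ler_wpM2l ?(abs_ge0 absN) // lerDl.
by rewrite -ltr_pdivlMr.
Qed.

Lemma approximable_div x z : approximable x -> approximable z -> approximable (x / z).
Proof. by move=> ax az; apply: approximableM => //; apply: approximableV. Qed.

Lemma approximable_lim x :
  (forall e, 0 < e -> exists2 z, approximable z & N (x - z) < e) -> approximable x.
Proof.
move=> h e e0; have [z az xz] := h e e0; have [w fw zw] := az e e0.
exists w => //; have -> : x - w = (x - z) + (z - w) by rewrite addrA subrK.
exact: absD_lt.
Qed.

Lemma approximable_goss_coef (y : padic_int p) m : approximable (goss_coef N phi y m).
Proof.
move=> e e0; have [k hk] := geometric_small (abs_ge0 absN u) (abs_u_lt1 absN absphi) e0.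
exists (digit_sum iota u p k (zp_digit y) m).
  by apply: fraction_digit_sum; apply: zp_digit_le; apply: prime_gt0.
apply: le_lt_trans (goss_coef_approx p_pr cardF absN completeN absphi y m k) _.
by apply: hk; rewrite ltnW // ltn_expl // prime_gt1.
Qed.

(** Division with remainder applied to a nearby fraction: the remainder over B has negative degree,
    hence absolute value below 1. *)
Lemma integral_part x n : approximable x -> exists P, N (x * T ^+ n - psi P) < 1.
Proof.
move=> ax; have Tn : 0 < N (T ^+ n) by rewrite (abs_gt0 absN) expf_neq0.
have [_ [A [B [B0 ->]]] close] := ax _ (divr_gt0 ltr01 Tn).
exists (A * 'X^n %/ B).
have -> : x * T ^+ n - psi (A * 'X^n %/ B) =
    (x - psi A / psi B) * T ^+ n + psi (A * 'X^n %% B) / psi B.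
  have : psi (A * 'X^n) = psi (A * 'X^n %/ B) * psi B + psi (A * 'X^n %% B).
    by rewrite -rmorphM -rmorphD -divp_eq.
  rewrite rmorphM rmorphXn psiX mulrBl mulrAC => ->.
  by field; rewrite psi_eq0.
apply: (absD_lt absN); first by rewrite (absM absN) -ltr_pdivlMr.
have [->|R0] := eqVneq (A * 'X^n %% B) 0; first by rewrite rmorph0 mul0r (abs0 absN).
rewrite (absM absN) (absV absN) !abs_psi // ltr_pdivrMr ?exprn_gt0 // mul1r.
rewrite ltr_eXn2l //; have lt : (size (A * 'X^n %% B)%R < size B)%N by rewrite ltn_modp.
by move: R0 lt; rewrite -size_poly_gt0; move: (size _) (size _) => x1 x2; lia.
Qed.

(** P n is the polynomial part of x T ^ n, so P (n + 1) - T P n is smaller than T in absolute value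
    and therefore a constant, the next coefficient of the expansion. *)
Lemma laurent_approximable x : approximable x -> laurent N phi (prime_subfield F) x.
Proof.
move=> ax; have [P hP] := choice (fun n => integral_part n ax).
have PS n : P n.+1 = P n * 'X + ((P n.+1)`_0)%:P.
  pose D := P n.+1 - P n * 'X.
  have sD : (size D <= 1)%N.
    have [->|D0] := eqVneq D 0; first by rewrite size_poly0.
    rewrite leqNgt; apply/negP => lt.
    have : N (psi D) < #|F|%:R.
      have -> : psi D = (x * T ^+ n - psi (P n)) * T - (x * T ^+ n.+1 - psi (P n.+1)).
        by rewrite /D rmorphB rmorphM psiX exprS; ring.
      apply: (absB_lt absN); last exact: lt_trans (hP _) q_gt1.
      by rewrite (absM absN) absphi ?polyX_eq0 // size_polyX expr1 gtr_pMl.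
    rewrite abs_psi // ltNge => /negP; apply.
    by rewrite -[X in X <= _]expr1 ler_eXn2l //; lia.
  have eD : P n.+1 = P n * 'X + D by rewrite /D addrC subrK.
  rewrite {1}eD; congr (_ + _); rewrite [D]size1_polyC //; congr (_%:P).
  by rewrite /D coefB coefMX subr0.
pose m := size (P 0%N).
(* Degrees m down to 1 are read off P 0, the one of degree m = size (P 0) being zero; the later
   coefficients are the constant terms of the P n. *)
pose c i : 'F_p := if (i < m)%N then (P 0%N)`_(m - i) else (P (i - m)%N)`_0.
have psiP n : psi (P n) = \sum_(i < (m + n).+1) phi (inj_Fp (c i))%:P * T ^+ (m + n - i).
  elim: n => [|n IHn].
    rewrite addn0 (reindex_inj rev_ord_inj).
    have -> : psi (P 0%N) = \sum_(i < m.+1) phi (inj_Fp (P 0%N)`_i)%:P * T ^+ i.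
      have {1}-> : P 0%N = \sum_(i < m.+1) (P 0%N)`_i *: 'X^i.
        by rewrite big_ord_recr /= nth_default // scale0r addr0 -poly_def coefK.
      rewrite rmorph_sum; apply: eq_bigr => i _.
      by rewrite -mul_polyC rmorphM rmorphXn psiX /psi /= map_polyC.
    apply: eq_bigr => i _; have lei : (i <= m)%N by rewrite -ltnS.
    have er : rev_ord i = (m - i)%N :> nat by rewrite /= subSS.
    rewrite er subKn //; congr (phi (inj_Fp _)%:P * _); rewrite /c.
    case: ltnP => [lt|ge]; first by rewrite subKn.
    have -> : (i : nat) = 0%N by lia.
    by rewrite subn0 subnn.
  rewrite PS rmorphD rmorphM psiX IHn addnS [RHS]big_ord_recr; congr (_ + _).
    rewrite mulr_suml; apply: eq_bigr => i _; rewrite -mulrA -exprSr; congr (_ * _ ^+ _).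
    by have := ltn_ord i; move=> /= ?; lia.
  rewrite [nat_of_ord _]/= subnn expr0 mulr1 /psi /= map_polyC /c ifN; last by rewrite -leqNgt; lia.
  by rewrite (_ : ((m + n).+1 - m)%N = n.+1) //; lia.
exists m, (fun i => inj_Fp (c i)); split=> [i|]; first by exists (c i : nat).
apply/(cvg_absP absN) => e e0.
have [n0 hn0] := geometric_small (abs_ge0 absN u) (abs_u_lt1 absN absphi) e0.
exists (m + n0).+1 => n' len; pose n := (n' - m.+1)%N.
have -> : n' = (m + n).+1 by rewrite /n; lia.
have -> : \sum_(i < (m + n).+1) phi (inj_Fp (c i))%:P * (T ^+ m / T ^+ i) = psi (P n) / T ^+ n.
  rewrite psiP mulr_suml; apply: eq_bigr => i _; rewrite -mulrA; congr (_ * _).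
  move: (nat_of_ord i) (ltn_ord i) => j; rewrite ltnS => lej.
  have eT : T ^+ (m + n) = T ^+ (m + n - j) * T ^+ j by rewrite -exprD subnK.
  by apply: (canRL (mulfK _)); rewrite ?expf_neq0 // mulrAC -exprD eT mulfK ?expf_neq0.
rewrite (absB absN).
have -> : x - psi (P n) / T ^+ n = (x * T ^+ n - psi (P n)) * u ^+ n.
  by rewrite exprVn mulrBl mulfK ?expf_neq0.
rewrite (absM absN) (absX absN); apply: lt_trans (hn0 n _); last by rewrite /n; lia.
by rewrite gtr_pMl // exprn_gt0 // (abs_u_gt0 absN absphi).
Qed.

End Rationality.

Theorem theorem1p1 (R : realType) (p s : nat) (F : finFieldType)
    (Om : fieldType) (N : Om -> R) (phi : {rmorphism {poly F} -> Om})
    (p_prime : prime p) (s_gt0 : (1 <= s)%N) (cardF : #|F| = (p ^ s)%N)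
    (OmP : completed_alg_closure N phi) (y : padic_int p) (a : Om) :
  a != 0 -> goss_zeta N phi a (zp_opp y) = 0 ->
  [/\ simple_zero N (fun x => goss_zeta N phi x (zp_opp y)) a,
      K_infty N phi a
    & laurent N phi (prime_subfield F) a].
Proof.
move=> a_neq0 za; have [absN absphi completeN _ _] := OmP.
(* [goss_zeta] negates its argument, so a double negation appears; it can stay, because the results
   on [goss_coef] hold for every p-adic integer. *)
pose y' := zp_opp (zp_opp y); pose S := goss_coef N phi y'.
have k_gt0 := abs_u_gt0 absN absphi; have k_lt1 := abs_u_lt1 absN absphi.
have S0 : N (S 0%N) = 1 by apply: (goss_coef0 p_prime s_gt0 cardF).
have S_costs M : S M != 0 -> exists2 f, strict_costs f &
    forall m, (m <= M)%N -> N (S m) = N (phi 'X)^-1 ^+ f m.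
  exact: (goss_coef_abs p_prime s_gt0 cardF).
have S_small r : 0 <= r -> forall e, 0 < e ->
    exists n0, forall m, (n0 <= m)%N -> N (S m) * r ^+ m < e.
  move=> r0 e e0; have [n0 hn] := goss_terms_small p_prime s_gt0 cardF absN absphi r0 e0.
  exists n0 => m /hn; apply: le_lt_trans; rewrite ler_wpM2r ?exprn_ge0 //.
  exact: (goss_coef_le p_prime s_gt0 cardF).
have zeta_val x : converges N (fun n => \sum_(i < n) term S x i) (goss_zeta N phi x (zp_opp y)).
  have [l hl _] := series_value absN completeN S_small x.
  suff -> : goss_zeta N phi x (zp_opp y) = l by [].
  apply: (lim_absE absN) => e /hl[n0 hn]; exists n0 => n /hn.
  congr (N (_ - _) < _); apply: eq_bigr => i _; rewrite /term; congr (_ * _).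
  exact: (esym (sum_monic p_prime s_gt0 cardF absN absphi (fun w => zp_pow N w y') i)).
have a_zero : converges N (fun n => \sum_(i < n) term S a i) 0 by have := zeta_val a; rewrite za.
have lau : laurent N phi (prime_subfield F) a.
  apply: (@laurent_approximable R p s F Om N phi p_prime s_gt0 cardF absN absphi).
  apply: (zero_in_closed_subfield absN k_gt0 k_lt1 S0 S_costs S_small a_neq0 a_zero).
  - exact: approximable1.
  - exact: approximableB.
  - exact: approximable_div.
  - exact: approximable_lim.
  - by move=> i; apply: approximable_goss_coef.
split=> //; last by case: lau => m [c [_ h]]; exists m, c.
by apply: (simple_zero_of_series absN completeN k_gt0 k_lt1 S0 S_costs S_small a_neq0 a_zero).
Qed.
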